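(* Let $\varphi:\mathbb C^+\to\mathcal L(\mathcal U;\mathcal Y)$ be an operator Schur function. Then the kernel function $$K_s(\mu,\mu_*,\lambda,\lambda_* ):=\begin{bmatrix}\dfrac{1-\varphi(\mu)\varphi(\lambda)^*}{\mu+\overline\lambda} & \dfrac{\varphi(\overline{\lambda_*})-\varphi(\mu)}{\mu-\overline{\lambda_*}}\\[2mm] \dfrac{\varphi(\lambda)^*-\varphi(\overline{\mu_*})^*}{\mu_*-\overline\lambda} & \dfrac{1-\varphi(\overline{\mu_*})^*\varphi(\overline{\lambda_*})}{\mu_*+\overline{\lambda_*}}\end{bmatrix},\qquad \mu,\mu_*,\lambda,\lambda_*\in\mathbb C^+,$$ is positive; denote its reproducing kernel Hilbert space by $\mathcal H_s$. Define the linear operator $S_s:\begin{bmatrix}\mathcal H_s\\ \mathcal U\end{bmatrix}\supset\mathrm{dom}(S_s)\to\begin{bmatrix}\mathcal H_s\\ \mathcal Y\end{bmatrix}$ by $S_s\begin{bmatrix}\begin{bmatrix}x_1\\ x_2\end{bmatrix}\\ u\end{bmatrix}=\begin{bmatrix}\begin{bmatrix}z_1\\ z_2\end{bmatrix}\\ y\end{bmatrix}$, where $$y:=\lim_{\operatorname{Re}\eta\to+\infty}\big(\eta\,x_1(\eta)+\varphi(\eta)u\big),\qquad (1)$$ $$\begin{bmatrix}z_1(\mu)\\ z_2(\mu_* )\end{bmatrix}:=\begin{bmatrix}\mu\,x_1(\mu)\\ -\mu_*\,x_2(\mu_* )\end{bmatrix}+\begin{bmatrix}\varphi(\mu)\\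 1\end{bmatrix}u-\begin{bmatrix}1\\ \varphi(\overline{\mu_*})^*\end{bmatrix}y,\quad \mu,\mu_*\in\mathbb C^+,\qquad (2)$$ and $\mathrm{dom}(S_s)$ is the set of all $\begin{bmatrix}\begin{bmatrix}x_1\\ x_2\end{bmatrix}\\ u\end{bmatrix}\in\begin{bmatrix}\mathcal H_s\\ \mathcal U\end{bmatrix}$ for which the limit (1) exists in $\mathcal Y$ and the function (2) lies in $\mathcal H_s$. Then $S_s$ is a simple, conservative system node with input space $\mathcal U$, state space $\mathcal H_s$ and output space $\mathcal Y$. The transfer function of $S_s$ is $\varphi$, and conversely every simple, conservative system node with transfer function $\varphi$ is unitarily similar to $S_s$.
   Context: All Hilbert spaces are complex; inner products are linear in the first slot; $\begin{bmatrix}\mathcal X\\ \mathcal U\end{bmatrix}$ is the orthogonal direct sum; $1$ denotes an identity operator; $\mathbb C^+=\{\lambda\in\mathbb C:\operatorname{Re}\lambda>0\}$. $\mathcal U,\mathcal Y$ are separable Hilbert spaces. An operator Schur function on $\mathbb C^+$ is an analytic function $\varphi:\mathbb C^+\to\mathcal L(\mathcal U;\mathcal Y)$ whose values are contractions. Kernel: removable singularities of $K_s$ (at $\mu=\overline{\lambda_*}$ and $\mu_*=\overline\lambda$) are removed by continuity. $K_s$ is an $\mathcal L(\begin{bmatrix}\mathcal Y\\ \mathcal U\end{bmatrix})$-valued kernel in the two variables $(\mu,\mu_* ),(\lambda,\lambda_* )\in\mathbb C^+\times\mathbb C^+$. Positive means $\sum_{j,k=1}^N\langle K_s(\omega_j,\zeta_j,\omega_k,\zeta_k)h_k,h_j\rangle\ge0$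 for all finite families $(\omega_k,\zeta_k)\in\mathbb C^+\times\mathbb C^+$, $h_k\in\begin{bmatrix}\mathcal Y\\ \mathcal U\end{bmatrix}$. Elements of its RKHS are functions of the form $(\mu,\mu_* )\mapsto\begin{bmatrix}x_1(\mu)\\ x_2(\mu_* )\end{bmatrix}$ with $x_1:\mathbb C^+\to\mathcal Y$, $x_2:\mathbb C^+\to\mathcal U$ analytic, written $\begin{bmatrix}x_1\\ x_2\end{bmatrix}$. System nodes: a system node with input/state/output Hilbert spaces $(\mathcal U,\mathcal X,\mathcal Y)$ is a linear operator $S=\begin{bmatrix}A\&B\\ C\&D\end{bmatrix}:\begin{bmatrix}\mathcal X\\ \mathcal U\end{bmatrix}\supset\mathrm{dom}(S)\to\begin{bmatrix}\mathcal X\\ \mathcal Y\end{bmatrix}$ ($A\&B$ and $C\&D$ are its rows, defined on $\mathrm{dom}(S)$) such that $S$ and $A\&B$ are closed; the main operator $A$, $Ax=A\&B\begin{bmatrix}x\\ 0\end{bmatrix}$ with $\mathrm{dom}(A)=\{x:\begin{bmatrix}x\\ 0\end{bmatrix}\in\mathrm{dom}(S)\}$, generates a $C_0$-semigroup on $\mathcal X$; and for every $u\in\mathcal U$ there is $x\in\mathcal X$ with $\begin{bmatrix}x\\ u\end{bmatrix}\in\mathrm{dom}(S)$. For a fixed $\beta\in\mathrm{res}(A)$ (resolvent set), $\mathcal X_{-1}$ is the completion of $\mathcal X$ in the norm $\|(\beta-A)^{-1}x\|$, and $A_{-1}\in\mathcal L(\mathcal X;\mathcal X_{-1})$ is the unique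 continuous extension of $A$; $(\lambda-A_{-1})^{-1}$ maps $\mathcal X_{-1}$ onto $\mathcal X$ for $\lambda\in\mathrm{res}(A)$. The control operator is the unique $B\in\mathcal L(\mathcal U;\mathcal X_{-1})$ with $A\&B=\begin{bmatrix}A_{-1}&B\end{bmatrix}|_{\mathrm{dom}(S)}$; the observation operator is $C:\mathrm{dom}(A)\to\mathcal Y$, $Cx=C\&D\begin{bmatrix}x\\ 0\end{bmatrix}$; the transfer function is $\lambda\mapsto C\&D\begin{bmatrix}(\lambda-A_{-1})^{-1}B\\ 1\end{bmatrix}$, $\lambda\in\mathrm{res}(A)$. The adjoint $S^*$ is a system node with main operator $A^*$, control operator $C^*$ and observation operator $B^*$; $A^d_{-1}$ denotes the extension of $A^*$ to $\mathcal X$ with values in the extrapolation space of $A^*$, and $(\overline\lambda-A^d_{-1})^{-1}C^*=(C(\lambda-A)^{-1})^*$. $S$ is passive if $2\operatorname{Re}\langle z,x\rangle\le\|u\|^2-\|y\|^2$ for all $\begin{bmatrix}x\\ u\end{bmatrix}\in\mathrm{dom}(S)$, $\begin{bmatrix}z\\ y\end{bmatrix}=S\begin{bmatrix}x\\ u\end{bmatrix}$; energy preserving if equality always holds; conservative if both $S$ and $S^*$ are energy preserving. For passive $S$ one has $\mathbb C^+\subset\mathrm{res}(A)$, and the transfer function is considered on $\mathbb C^+$. A passive $S$ is simple if the closed linear span of all $(\lambda-A^d_{-1})^{-1}C^*\gamma+(\lambda_*-A_{-1})^{-1}B\nu$, $\lambda,\lambda_*\in\mathbb C^+$, $\gamma\in\mathcal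 Y$, $\nu\in\mathcal U$, is $\mathcal X$. Two system nodes $S_0,S_1$ with state spaces $\mathcal X_0,\mathcal X_1$ and the same input and output spaces are unitarily similar if there is a unitary $E:\mathcal X_0\to\mathcal X_1$ with $\begin{bmatrix}E&0\\ 0&1\end{bmatrix}\mathrm{dom}(S_0)\subset\mathrm{dom}(S_1)$ and $\begin{bmatrix}E&0\\ 0&1\end{bmatrix}S_0=S_1\begin{bmatrix}E&0\\ 0&1\end{bmatrix}\Big|_{\mathrm{dom}(S_0)}$. *)

(* Defs.v *)
From HB Require Import structures.
From mathcomp Require Import all_boot all_order all_algebra complex.
From mathcomp Require Import all_classical all_reals all_analysis.
Import Order.TTheory GRing.Theory Num.Theory.
Import numFieldTopology.Exports numFieldNormedType.Exports.

Set Implicit Arguments.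
Unset Strict Implicit.
Unset Printing Implicit Defensive.

Local Open Scope classical_set_scope.
Local Open Scope ring_scope.

HB.instance Definition _ (R : realType) :=
  PseudoPointedMetric.copy R[i] (R[i])^o.

(* [{dot H for Num.conj}] is linear in its first argument and conjugate-linear
   in its second one; the norm of a normed module over [R[i]] takes its values
   in [R[i]]. *)
HB.mixin Record isHilbert (R : realType) H of CompleteNormedModule R[i] H := {
  inner : {dot H for (@Num.conj R[i])};
  inner_norm : forall x : H, inner x x = `|x| ^+ 2 }.

#[short(type="hilbertType")]
HB.structure Definition Hilbert (R : realType) :=
  {H of isHilbert R H & CompleteNormedModule R[i] H}.

Definition separable (T : topologicalType) : Prop :=
  exists2 D : set T, countable D & dense D.

Definition lin_span (R : realType) (V : lmodType R[i]) (G : set V) : set V :=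
  [set x | exists n (c : 'I_n -> R[i]) (v : 'I_n -> V),
      (forall i, G (v i)) /\ x = \sum_(i < n) c i *: v i].

(* The orthogonal direct sum of X and Y is carried by the product type.  Its
   norm is not the (sup) norm of the product, but both induce the product
   topology, which is the one used for closedness of graphs below. *)
Definition dsum_inner (R : realType) (X Y : hilbertType R) (p q : X * Y) : R[i] :=
  inner p.1 q.1 + inner p.2 q.2.

(* The Hilbert space adjoint of a bounded operator; it exists by the Riesz
   representation theorem, so the default value 0 is never used for such T. *)
Definition adjoint (R : realType) (U Y : hilbertType R) (T : U -> Y) (y : Y) : U :=
  xget 0 [set v : U | forall u, inner (T u) y = inner u v].

Section HalfPlane.
Variable R : realType.

Definition cplus : set R[i] := [set z | 0 < complex.Re z].

Definition cplus2 : set (R[i] * R[i]) := cplus `*` cplus.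

(* The filter of "Re eta -> +oo", with no constraint on Im eta. *)
Definition Re_pinfty : set_system R[i] :=
  [set A | exists M : R, forall eta : R[i], M < complex.Re eta -> A eta].

(* Removal of the singularity of f at a by continuity.  In the kernel below it
   is applied vector by vector: phi is analytic in operator norm, so this is the
   same operator as the one given by the limit in operator norm. *)
Definition remove_sing (V : hilbertType R) (a : R[i]) (f : R[i] -> V) (m : R[i]) : V :=
  if m == a then lim (f @ a^') else f m.

(* Complex differentiability in the operator norm at each point of cplus. *)
Definition operator_analytic (U Y : hilbertType R) (phi : R[i] -> {linear U -> Y}) : Prop :=
  forall lam, cplus lam -> exists D : {linear U -> Y}, continuous D /\
    forall e : R, 0 < e -> \forall h \near (0 : R[i])^', forall u : U,
      `|h^-1 *: (phi (lam + h) u - phi lam u) - D u| <= (e%:C)%C * `|u|.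

(* The values of phi outside cplus are irrelevant. *)
Definition operator_schur (U Y : hilbertType R) (phi : R[i] -> {linear U -> Y}) : Prop :=
  operator_analytic phi /\
  forall lam, cplus lam -> forall u : U, `|phi lam u| <= `|u|.

End HalfPlane.

Section ReproducingKernels.
Variables (R : realType) (Y U : hilbertType R) (T : Type).

Definition positive_kernel (Omega : set T) (K : T -> T -> Y * U -> Y * U) : Prop :=
  forall (N : nat) (w : 'I_N -> T) (h : 'I_N -> Y * U),
    (forall j, Omega (w j)) ->
    0 <= \sum_(j < N) \sum_(k < N) dsum_inner (K (w j) (w k) (h k)) (h j).

(* The reproducing kernel Hilbert space of K, as a Hilbert space of functions
   on Omega: [rk_fun x] is the function which x stands for. *)
Record rkhs (Omega : set T) (K : T -> T -> Y * U -> Y * U) := Rkhs {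
  rk_space :> hilbertType R;
  rk_fun : rk_space -> T -> Y * U;
  rk_fun_linear : forall w, Omega w -> forall (a : R[i]) (x x' : rk_space),
    rk_fun (a *: x + x') w = a *: rk_fun x w + rk_fun x' w;
  rk_fun_inj : forall x : rk_space,
    (forall w, Omega w -> rk_fun x w = 0) -> x = 0;
  rk_reproducing : forall w, Omega w -> forall h : Y * U,
    exists k : rk_space,
      (forall w', Omega w' -> rk_fun k w' = K w' w h) /\
      (forall x : rk_space, inner x k = dsum_inner (rk_fun x w) h) }.

End ReproducingKernels.

(* Unbounded operators are given by their graphs. *)
Section UnboundedOperators.
Variable R : realType.

Definition linear_operator (V W : lmodType R[i]) (G : set (V * W)) : Prop :=
  [/\ G 0,
      forall (a : R[i]) (p q : V * W), G p -> G q -> G (a *: p + q)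
    & forall v w w', G (v, w) -> G (v, w') -> w = w'].

Definition dom (V W : Type) (G : set (V * W)) : set V :=
  [set v | exists w, G (v, w)].

Variable X : hilbertType R.

(* T = (lam - A)^-1 *)
Definition is_resolvent (A : set (X * X)) (lam : R[i]) (T : {linear X -> X}) : Prop :=
  [/\ continuous T,
      forall x, A (T x, lam *: T x - x)
    & forall x z, A (x, z) -> T (lam *: x - z) = x].

Definition resolvent_set (A : set (X * X)) : set R[i] :=
  [set lam | exists T, is_resolvent A lam T].

Record C0_semigroup (T : R -> {linear X -> X}) : Prop := {
  C0_id : forall x, T 0 x = x;
  C0_add : forall s t, 0 <= s -> 0 <= t -> forall x, T (s + t) x = T s (T t x);
  C0_bounded : forall t, 0 <= t -> continuous (T t);
  C0_strong : forall x, T t x @[t --> 0^'+] --> x }.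

Definition generates_C0 (A : set (X * X)) : Prop :=
  exists T : R -> {linear X -> X}, C0_semigroup T /\
    forall x z, A (x, z) <-> ((t^-1)%:C)%C *: (T t x - x) @[t --> 0^'+] --> z.

(* A completion X_{-1} of X in the norm |(beta - A)^-1 x|, for some beta in the
   resolvent set of A, together with the continuous extension A_{-1} of A. *)
Record extrapolation (A : set (X * X)) := Extrapolation {
  ex_beta : R[i];
  ex_res : {linear X -> X};
  ex_resP : is_resolvent A ex_beta ex_res;
  ex_space : completeNormedModType R[i];
  ex_emb : {linear X -> ex_space};
  ex_emb_norm : forall x, `|ex_emb x| = `|ex_res x|;
  ex_emb_dense : dense (range ex_emb);
  ex_op : {linear X -> ex_space};
  ex_op_bounded : continuous ex_op;
  ex_opE : forall x z, A (x, z) -> ex_op x = ex_emb z }.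

End UnboundedOperators.

Section SystemNodes.
Variables (R : realType) (U X Y : hilbertType R).

Definition node := set ((X * U) * (X * Y)).

Definition AB (S : node) : set ((X * U) * X) :=
  [set p | exists y, S (p.1, (p.2, y))].

Definition main_operator (S : node) : set (X * X) :=
  [set p | AB S ((p.1, 0), p.2)].

Definition system_node (S : node) : Prop :=
  [/\ linear_operator S, closed S, closed (AB S),
      generates_C0 (main_operator S)
    & forall u, exists x, dom S (x, u)].

Definition control_operator (S : node) (E : extrapolation (main_operator S))
    (B : {linear U -> ex_space E}) : Prop :=
  continuous B /\
  forall x u z, AB S ((x, u), z) -> ex_emb E z = ex_op E x + B u.

(* x = (lam - A_{-1})^-1 B u *)
Definition control_resolvent (S : node) (lam : R[i]) (u : U) (x : X) : Prop :=
  resolvent_set (main_operator S) lam /\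
  exists (E : extrapolation (main_operator S)) (B : {linear U -> ex_space E}),
    control_operator B /\ lam *: ex_emb E x - ex_op E x = B u.

Definition has_transfer_function (S : node) (phi : R[i] -> {linear U -> Y}) : Prop :=
  forall lam, cplus lam -> forall u, exists x z,
    control_resolvent S lam u x /\ S ((x, u), (z, phi lam u)).

Definition passive (S : node) : Prop :=
  forall x u z y, S ((x, u), (z, y)) ->
    2 * 'Re (inner z x) <= `|u| ^+ 2 - `|y| ^+ 2.

Definition energy_preserving (S : node) : Prop :=
  forall x u z y, S ((x, u), (z, y)) ->
    2 * 'Re (inner z x) = `|u| ^+ 2 - `|y| ^+ 2.

End SystemNodes.

Definition adjoint_node (R : realType) (U X Y : hilbertType R) (S : node U X Y) :
    node Y X U :=
  [set q | forall p, S p -> dsum_inner p.2 q.1 = dsum_inner p.1 q.2].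

Definition conservative (R : realType) (U X Y : hilbertType R) (S : node U X Y) : Prop :=
  energy_preserving S /\ energy_preserving (adjoint_node S).

(* The operator C^* is the control operator of the adjoint node. *)
Definition simple (R : realType) (U X Y : hilbertType R) (S : node U X Y) : Prop :=
  passive S /\
  closure (lin_span [set x : X | exists lam lams (gam : Y) (nu : U) (x1 x2 : X),
    [/\ cplus lam, cplus lams, control_resolvent (adjoint_node S) lam gam x1,
        control_resolvent S lams nu x2 & x = x1 + x2]]) = setT.

Definition unitarily_similar (R : realType) (U Y X0 X1 : hilbertType R)
    (S0 : node U X0 Y) (S1 : node U X1 Y) : Prop :=
  exists E : {linear X0 -> X1},
    [/\ forall x x', inner (E x) (E x') = inner x x',
        forall x1, exists x0, E x0 = x1
      & forall x u z y, S0 ((x, u), (z, y)) -> S1 ((E x, u), (E z, y))].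

Section CanonicalModel.
Variables (R : realType) (U Y : hilbertType R) (phi : R[i] -> {linear U -> Y}).

Definition Ks (w z : R[i] * R[i]) (h : Y * U) : Y * U :=
  let: (mu, mus) := w in
  let: (lam, lams) := z in
  ( (mu + lam^*)^-1 *: (h.1 - phi mu (adjoint (phi lam) h.1))
    + remove_sing (lams^*)
        (fun m => (m - lams^*)^-1 *: (phi (lams^*) h.2 - phi m h.2)) mu,
    remove_sing (lam^*)
        (fun m => (m - lam^*)^-1 *:
           (adjoint (phi lam) h.1 - adjoint (phi (m^*)) h.1)) mus
    + (mus + lams^*)^-1 *: (h.2 - adjoint (phi (mus^*)) (phi (lams^*) h.2)) ).

Definition Ss (Hs : rkhs (@cplus2 R) Ks) : node U Hs Y :=
  [set p | let: ((x, u), (z, y)) := p in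
    exists (x1 : R[i] -> Y) (x2 : R[i] -> U),
      [/\ forall mu mus, cplus mu -> cplus mus ->
            rk_fun x (mu, mus) = (x1 mu, x2 mus),
          eta *: x1 eta + phi eta u @[eta --> @Re_pinfty R] --> y
        & forall mu mus, cplus mu -> cplus mus ->
            rk_fun z (mu, mus) =
              (mu *: x1 mu + phi mu u - y,
               - (mus *: x2 mus) + u - adjoint (phi (mus^*)) y)]].

End CanonicalModel.

Arguments Ss {R U Y phi} Hs.

(* Main.v *)
(** Positivity of K_s.  Fix a vertical line in C^+ to the left of all points.  For
    vectors F, E whose components are elementary fractions, the integral over the
    line of |F|^2 + |E|^2 - 2 Re <phi E, F> is nonnegative because phi is
    contractive, and by residues it is the quadratic form of K_s; letting the line
    tend to the imaginary axis gives the kernel itself.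

    Conservativity.  The kernel functions e1(l, g) and e2(m, v) of the two
    components are total in H_s and give elements of the graph of S_s, and the
    reproducing property shows that S_s consists of all ((x, u), (z, y)) with
    <z, x'> + <x, z'> = <u, u'> - <y, y'> for every such element.  A Cayley
    transform of this family extends to a unitary operator, of which S_s is the
    inverse Cayley transform; so S_s and its adjoint preserve energy and their
    equations (lambda - A) x - B u = f are solvable.  The Lumer-Phillips theorem
    then makes S_s a system node, and e2 provides the transfer function.

    Uniqueness.  In the state space of any simple conservative node with transfer
    function phi, the vectors that span it by simplicity have the Gram matrix of
    the e1(l, g) and e2(m, v), since the energy balance determines this matrix,
    except for the mixed entries at conjugate points, which follow by continuity.
    The unitary operator which matches the two families intertwines the nodes. *)
Require Import Defs.
From HB Require Import structures.
From mathcomp Require Import all_boot all_order all_algebra complex.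
From mathcomp Require Import ring lra.
From mathcomp Require Import all_classical all_reals all_analysis.
Import Order.TTheory GRing.Theory Num.Theory.
Import numFieldTopology.Exports numFieldNormedType.Exports.

Set Implicit Arguments.
Unset Strict Implicit.
Unset Printing Implicit Defensive.

Local Open Scope classical_set_scope.
Local Open Scope ring_scope.

(** * Complex numbers and real-valued norms *)

Section ComplexNumbers.
Variable R : realType.
Implicit Types (z w : R[i]) (r s : R).

(** Two obstacles shape the positivity proof: no values of [phi] on the imaginary axis are
    available, and the two families of points in the quadratic form may meet, which would give
    double poles. So the line lies inside the half plane, and only the points of the first family
    move with it; a small shift separates the families. Line integrals are replaced by dyadic
    trapezoidal sums, and residues are measured against one reference integrand, so that the value
    of pi never enters.

    The limit (1) follows from (2): the norm bound on point evaluations makes x1 decay. The graph of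
    S_s is therefore given by a family of scalar equations, one for each kernel function, and this
    form serves closedness, the adjoint and the similarity alike.

    The definitions of the transfer function and of simplicity refer to some extrapolation space.
    The vector x with (lam - A_{-1}) x = B u is identified with the x for which S sends (x, u) to
    some (lam x, y), an equation inside the state space. *)

Definition cR r : R[i] := (r%:C)%C.

Lemma ReD z w : complex.Re (z + w) = complex.Re z + complex.Re w.
Proof. by case: z w => [a b] [c d]. Qed.
Lemma ReN z : complex.Re (- z) = - complex.Re z.
Proof. by case: z. Qed.
Lemma ReB z w : complex.Re (z - w) = complex.Re z - complex.Re w.
Proof. by rewrite ReD ReN. Qed.
Lemma ImD z w : complex.Im (z + w) = complex.Im z + complex.Im w.
Proof. by case: z w => [a b] [c d]. Qed.
Lemma ImN z : complex.Im (- z) = - complex.Im z.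
Proof. by case: z. Qed.
Lemma ImB z w : complex.Im (z - w) = complex.Im z - complex.Im w.
Proof. by rewrite ImD ImN. Qed.
Lemma ReM z w :
  complex.Re (z * w) = complex.Re z * complex.Re w - complex.Im z * complex.Im w.
Proof. by case: z w => [a b] [c d]. Qed.
Lemma ImM z w :
  complex.Im (z * w) = complex.Re z * complex.Im w + complex.Im z * complex.Re w.
Proof. by case: z w => [a b] [c d]. Qed.
Lemma ReJ z : complex.Re (z^*) = complex.Re z.
Proof. by case: z. Qed.
Lemma ImJ z : complex.Im (z^*) = - complex.Im z.
Proof. by case: z. Qed.
Lemma Re_cR r : complex.Re (cR r) = r. Proof. by []. Qed.
Lemma Im_cR r : complex.Im (cR r) = 0. Proof. by []. Qed.
Lemma ceqP z w : complex.Re z = complex.Re w -> complex.Im z = complex.Im w -> z = w.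
Proof. by case: z w => [a b] [c d] /= -> ->. Qed.

Lemma cRD r s : cR (r + s) = cR r + cR s. Proof. exact: rmorphD. Qed.
Lemma cRN r : cR (- r) = - cR r. Proof. exact: rmorphN. Qed.
Lemma cRB r s : cR (r - s) = cR r - cR s. Proof. exact: rmorphB. Qed.
Lemma cRM r s : cR (r * s) = cR r * cR s. Proof. exact: rmorphM. Qed.
Lemma cRV r : cR r^-1 = (cR r)^-1. Proof. exact: fmorphV. Qed.
Lemma cRX r n : cR (r ^+ n) = cR r ^+ n. Proof. exact: rmorphXn. Qed.
Lemma cR1 : cR 1 = 1. Proof. by []. Qed.
Lemma cR0 : cR 0 = 0. Proof. by []. Qed.
Lemma cR_inj : injective cR. Proof. by move=> r s []. Qed.
Lemma cRJ r : (cR r)^* = cR r. Proof. by apply: ceqP; rewrite ?ReJ ?ImJ //= oppr0. Qed.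
Lemma cR_eq0 r : (cR r == 0) = (r == 0).
Proof. by apply/eqP/eqP => [/(congr1 (@complex.Re R))|->]. Qed.
Lemma cR_le r s : (cR r <= cR s) = (r <= s). Proof. exact: lecR. Qed.
Lemma cR_lt r s : (cR r < cR s) = (r < s). Proof. exact: ltcR. Qed.
Lemma cR_gt0 (e : R[i]) : 0 < e -> exists2 r : R, 0 < r & e = cR r.
Proof.
case: e => a b; rewrite ltcE /= => /andP[/eqP -> a0]; exists a => //.
Qed.
Lemma addJ z : z + z^* = cR (2 * complex.Re z).
Proof. by apply: ceqP; rewrite !(ReD, ImD, ReJ, ImJ, Re_cR, Im_cR); ring. Qed.
Lemma ReiM z : complex.Re ('i%C * z) = - complex.Im z.
Proof. by case: z => a b /=; ring. Qed.

End ComplexNumbers.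

Section RealNorm.
Variable R : realType.

(** Norms over [R[i]] are elements of [R[i]]; as a real number the norm is open to real
    arithmetic. *)
Definition nm (V : normedZmodType R[i]) (x : V) : R := complex.Re `|x|.

Section Zmod.
Variable V : normedZmodType R[i].
Implicit Types x y : V.

Lemma nmE x : `|x| = cR (nm x).
Proof. by have := ger0_Im (normr_ge0 x); rewrite /nm; case: `|x| => a b /= ->. Qed.
Lemma nm_ge0 x : 0 <= nm x.
Proof. by have := normr_ge0 x; rewrite nmE -(cR0 R) cR_le. Qed.
Lemma nm0 : nm (0 : V) = 0. Proof. by rewrite /nm normr0. Qed.
Lemma nmN x : nm (- x) = nm x. Proof. by rewrite /nm normrN. Qed.
Lemma nmD x y : nm (x + y) <= nm x + nm y.
Proof. by have := ler_normD x y; rewrite !nmE -cRD cR_le. Qed.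
Lemma nmB x y : nm (x - y) <= nm x + nm y.
Proof. by rewrite -(nmN y) nmD. Qed.
Lemma nmC x y : nm (x - y) = nm (y - x). Proof. by rewrite -nmN opprB. Qed.
Lemma nm_tri x y z : nm (x - z) <= nm (x - y) + nm (y - z).
Proof. by apply: le_trans (nmD _ _); rewrite addrA subrK. Qed.
Lemma nm_eq0 x : nm x = 0 -> x = 0.
Proof. by move=> h; apply/eqP; rewrite -normr_eq0 nmE h. Qed.
Lemma nm_distl x y : nm x <= nm (x - y) + nm y.
Proof. by apply: le_trans (nmD _ _); rewrite subrK. Qed.
Lemma nm_le_eq0 x : (forall e, 0 < e -> nm x <= e) -> x = 0.
Proof.
move=> h; apply: nm_eq0; apply/eqP; rewrite eq_le nm_ge0 andbT.
by apply/ler_addgt0Pl => e e0; rewrite addr0 h.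
Qed.
End Zmod.

Lemma nmZ (V : normedModType R[i]) (a : R[i]) (x : V) : nm (a *: x) = nm a * nm x.
Proof. by apply: cR_inj; rewrite cRM -!nmE normrZ. Qed.
Lemma nmM (a b : R[i]) : nm (a * b) = nm a * nm b.
Proof. by apply: cR_inj; rewrite cRM -!nmE normrM. Qed.
Lemma nmV (a : R[i]) : nm a^-1 = (nm a)^-1.
Proof. by apply: cR_inj; rewrite cRV -!nmE normfV. Qed.
Lemma nm_cR (r : R) : nm (cR r) = `|r|.
Proof. by apply: cR_inj; rewrite -nmE normc_def /= expr0n addr0 sqrtr_sqr. Qed.
Lemma nm_cR0 (r : R) : 0 <= r -> nm (cR r) = r.
Proof. by move=> h; rewrite nm_cR ger0_norm. Qed.
Lemma nm1 : nm (1 : R[i]) = 1. Proof. by rewrite -(cR1 R) nm_cR normr1. Qed.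
Lemma nmJ (a : R[i]) : nm a^* = nm a.
Proof. by rewrite /nm norm_conjC. Qed.
Lemma nm_sqr (a : R[i]) : nm a ^+ 2 = complex.Re a ^+ 2 + complex.Im a ^+ 2.
Proof. by apply: cR_inj; rewrite cRX -nmE -add_Re2_Im2. Qed.
Lemma nm_sqrJ (a : R[i]) : cR (nm a ^+ 2) = a * a^*.
Proof. by rewrite cRX -nmE normCK. Qed.
Lemma ler_Re_nm (a : R[i]) : `|complex.Re a| <= nm a.
Proof. by rewrite -(@ler_pXn2r _ 2) ?nnegrE ?nm_ge0 // nm_sqr real_normK ?num_real // lerDl sqr_ge0. Qed.
Lemma ler_Im_nm (a : R[i]) : `|complex.Im a| <= nm a.
Proof. by rewrite -(@ler_pXn2r _ 2) ?nnegrE ?nm_ge0 // nm_sqr real_normK ?num_real // lerDr sqr_ge0. Qed.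
Lemma Re_le_nm (a : R[i]) : complex.Re a <= nm a.
Proof. exact: le_trans (ler_norm _) (ler_Re_nm a). Qed.
Lemma nm_le_ReIm (a : R[i]) : nm a <= `|complex.Re a| + `|complex.Im a|.
Proof.
rewrite -(@ler_pXn2r _ 2) ?nnegrE ?nm_ge0 ?addr_ge0 //.
rewrite nm_sqr sqrrD !real_normK ?num_real // -addrA [X in _ <= _ + X]addrC addrA.
by rewrite lerDl mulrn_wge0 // mulr_ge0.
Qed.
Lemma nm_gt0 (a : R[i]) : (0 < nm a) = (a != 0).
Proof. by rewrite -cR_lt cR0 -nmE normr_gt0. Qed.

Lemma cvg_nm (T : Type) (V : normedModType R[i]) (F : set_system T) {FF : Filter F}
    (f : T -> V) (l : V) :
  f @ F --> l <-> forall e : R, 0 < e -> \forall x \near F, nm (l - f x) < e.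
Proof.
split=> [/cvgrPdist_lt h e e0|h].
  have := h (cR e); rewrite -(cR0 R) cR_lt => /(_ e0).
  by apply: filterS => x; rewrite nmE cR_lt.
apply/cvgrPdist_lt => e /cR_gt0[r r0 ->].
by apply: filterS (h r r0) => x; rewrite nmE cR_lt.
Qed.

Lemma nbhs_nm (V : normedModType R[i]) (x : V) (A : set V) :
  nbhs x A <-> exists2 e : R, 0 < e & forall y, nm (x - y) < e -> A y.
Proof.
split=> [/nbhs_normP [e /= /cR_gt0[r r0 ->] h]|[e e0 h]].
  by exists r => // y hy; apply: h => /=; rewrite nmE cR_lt.
apply/nbhs_normP; exists (cR e) => /=; first by rewrite -(cR0 R) cR_lt.
by move=> y /=; rewrite nmE cR_lt; apply: h.
Qed.

Lemma nbhsC_nm (x : R[i]) (A : set R[i]) :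
  nbhs x A <-> exists2 e : R, 0 < e & forall y, nm (x - y) < e -> A y.
Proof. exact: (@nbhs_nm (R[i]^o) x A). Qed.

Lemma dnbhsC_nm (x : R[i]) (A : set R[i]) :
  nbhs x^' A <-> exists2 e : R, 0 < e & forall y, nm (x - y) < e -> y != x -> A y.
Proof. by split=> [/nbhsC_nm//|h]; apply/nbhsC_nm. Qed.

Lemma cvg_seq_nm (V : normedModType R[i]) (u : nat -> V) (l : V) :
  u @ \oo --> l <->
  forall e : R, 0 < e -> exists N, forall n, (N <= n)%N -> nm (l - u n) < e.
Proof.
split=> [/cvg_nm h e e0|h].
  by have [N _ hN] := h e e0; exists N.
by apply/cvg_nm => e /h [N hN]; exists N.
Qed.

Definition cauchy_nm (V : normedZmodType R[i]) (u : nat -> V) :=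
  forall e : R, 0 < e ->
    exists N, forall m n, (N <= m)%N -> (N <= n)%N -> nm (u m - u n) < e.

Lemma cauchy_nm_cvg (V : completeNormedModType R[i]) (u : nat -> V) :
  cauchy_nm u -> exists l : V, u @ \oo --> l.
Proof.
move=> h; suff : cvg (u @ \oo : set_system V) by move=> /cvg_ex.
apply: cauchy_cvg; apply: cauchy_exP => e /cR_gt0[r r0 ->].
have [N hN] := h r r0; exists (u N); exists N => // n hn.
by rewrite -ball_normE /= nmE cR_lt; apply: hN => //; exact: leqnn.
Qed.

Lemma half_lt (e : R) : 0 < e -> 0 < e / 2. Proof. by move=> ?; rewrite divr_gt0. Qed.

Lemma bound_lt_exp2 (x : R) : exists N : nat, forall n, (N <= n)%N -> x < 2 ^+ n.
Proof.
have [N hN] : exists N : nat, x < N%:R.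
  by exists (Num.trunc `|x|).+1; apply: le_lt_trans (ler_norm x) _; exact: truncnS_gt.
exists N => n Nn; apply: lt_trans hN _; rewrite -natrX ltr_nat.
by apply: leq_ltn_trans Nn _; exact: ltn_expl.
Qed.

Lemma geo_small (C e : R) : 0 < e -> exists N : nat, forall n, (N <= n)%N ->
  C / 2 ^+ n < e.
Proof.
move=> e0; have [N hN] := bound_lt_exp2 (C / e); exists N => n /hN h.
by rewrite ltr_pdivrMr ?exprn_gt0 // -ltr_pdivrMl // mulrC.
Qed.

Lemma inv_small (C e : R) : 0 < e -> exists N : nat, forall n, (N <= n)%N ->
  C / n.+1%:R < e.
Proof.
move=> e0; exists (Num.trunc `|C / e|).+1 => n hn.
rewrite ltr_pdivrMr // -ltr_pdivrMl // mulrC; apply: le_lt_trans (ler_norm _) _.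
apply: lt_le_trans (truncnS_gt _) _; rewrite ler_nat; exact: leqW.
Qed.

Lemma geo_tail (V : normedZmodType R[i]) (u : nat -> V) (C : R) :
  (forall n, nm (u n.+1 - u n) <= C / 2 ^+ n) ->
  forall m n, (m <= n)%N -> nm (u n - u m) <= 2 * C / 2 ^+ m.
Proof.
move=> h m n mn; rewrite -(subnK mn); move: (n - m)%N => k {n mn}.
(* The subtracted term makes the bound inductive: it is the part of the geometric tail not yet
   used. *)
suff : nm (u (k + m)%N - u m) <= 2 * C / 2 ^+ m - 2 * C / 2 ^+ (k + m).
  move=> hh; apply: le_trans hh _; rewrite lerBlDr lerDl.
  have C0 : 0 <= C by have := le_trans (nm_ge0 _) (h 0%N); rewrite expr0 divr1.
  by rewrite divr_ge0 ?exprn_ge0 // mulr_ge0.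
elim: k => [|k IH]; first by rewrite add0n !subrr nm0.
apply: le_trans (nm_tri _ (u (k + m)%N) _) _; rewrite addSn.
apply: le_trans (lerD (h _) IH) _; rewrite exprS invfM.
set a := (2 ^+ (k + m))^-1.
have -> : 2 * C * (2^-1 * a) = C * a by field.
by lra.
Qed.

Lemma geo_cauchy (V : normedZmodType R[i]) (u : nat -> V) (C : R) :
  (forall n, nm (u n.+1 - u n) <= C / 2 ^+ n) -> cauchy_nm u.
Proof.
move=> /geo_tail h e e0; have [N hN] := geo_small (2 * C) e0.
exists N => m n hm hn; case: (leqP m n) => [mn|/ltnW mn]; first rewrite nmC.
  exact: le_lt_trans (h _ _ mn) (hN _ hm).
exact: le_lt_trans (h _ _ mn) (hN _ hn).
Qed.

Lemma nm_lim_le (V : normedModType R[i]) (u : nat -> V) (l x : V) (C : R) (N : nat) :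
  u @ \oo --> l -> (forall n, (N <= n)%N -> nm (x - u n) <= C) -> nm (x - l) <= C.
Proof.
move=> /cvg_seq_nm ul h; apply/ler_addgt0Pr => e /ul [M hM].
apply: le_trans (nm_tri _ (u (maxn N M)) _) _.
rewrite lerD ?h ?leq_maxl // nmC ltW // hM // leq_maxr //.
Qed.

Lemma seq_lim_uniq (V : normedModType R[i]) (u : nat -> V) (l l' : V) :
  u @ \oo --> l -> u @ \oo --> l' -> l = l'.
Proof. exact: (@cvg_unique V (@norm_hausdorff _ V)). Qed.

(** Real and imaginary parts are 1-Lipschitz, so completeness is inherited from R. *)
Lemma cauchyC_cvg (u : nat -> R[i]) : cauchy_nm u ->
  exists l, forall e : R, 0 < e -> exists N, forall n, (N <= n)%N -> nm (l - u n) < e.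
Proof.
move=> h.
have cv (p : R[i] -> R) : (forall z w, p (z - w) = p z - p w) ->
   (forall z, `|p z| <= nm z) -> exists l : R, p \o u @ \oo --> l.
  move=> pB pn; suff : cvg (p \o u @ \oo : set_system R) by move=> /cvg_ex.
  apply: cauchy_cvg; apply: cauchy_exP => e e0.
  have [N hN] := h e e0; exists (p (u N)); exists N => // n hn.
  rewrite -ball_normE /= -pB; apply: le_lt_trans (pn _) (hN _ _ _ hn).
  exact: leqnn.
have [a /cvgrPdist_lt ha] := cv _ (@ReB R) ler_Re_nm.
have [b /cvgrPdist_lt hb] := cv _ (@ImB R) ler_Im_nm.
exists (a +i* b)%C => e e0.
have [N _ hN] := ha _ (half_lt e0); have [M _ hM] := hb _ (half_lt e0).
exists (maxn N M) => n; rewrite geq_max => /andP[/hN /= h1 /hM /= h2].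
apply: le_lt_trans (nm_le_ReIm _) _; rewrite ReB ImB /=; lra.
Qed.

End RealNorm.

(** * Inner products, the Riesz representation, adjoints *)

Section InnerProducts.
Variables (R : realType) (H : hilbertType R).
Implicit Types (x y z : H) (a : R[i]).

Lemma ipDl x y z : inner (x + y) z = inner x z + inner y z.
Proof. exact: linearDl. Qed.
Lemma ipDr x y z : inner x (y + z) = inner x y + inner x z.
Proof. exact: linearDr. Qed.
Lemma ipZl a x y : inner (a *: x) y = a * inner x y.
Proof. exact: linearZl_LR. Qed.
Lemma ipZr a x y : inner x (a *: y) = a^* * inner x y.
Proof. exact: linearZr_LR. Qed.
Lemma ipNl x y : inner (- x) y = - inner x y.
Proof. exact: linearNl. Qed.
Lemma ipNr x y : inner x (- y) = - inner x y.
Proof. exact: linearNr. Qed.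
Lemma ipBl x y z : inner (x - y) z = inner x z - inner y z.
Proof. by rewrite ipDl ipNl. Qed.
Lemma ipBr x y z : inner x (y - z) = inner x y - inner x z.
Proof. by rewrite ipDr ipNr. Qed.
Lemma ip0l x : inner 0 x = 0. Proof. exact: linear0l. Qed.
Lemma ip0r x : inner x 0 = 0. Proof. exact: linear0r. Qed.
Lemma ipC x y : inner y x = (inner x y)^*.
Proof. by rewrite [LHS]hermC expr0 mul1r. Qed.
Lemma ip_suml (I : Type) (r : seq I) (P : pred I) (F : I -> H) y :
  inner (\sum_(i <- r | P i) F i) y = \sum_(i <- r | P i) inner (F i) y.
Proof. by elim/big_rec2: _ => [|i u v _ <-]; rewrite ?ip0l ?ipDl. Qed.
Lemma ip_sumr (I : Type) (r : seq I) (P : pred I) (F : I -> H) y :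
  inner y (\sum_(i <- r | P i) F i) = \sum_(i <- r | P i) inner y (F i).
Proof. by elim/big_rec2: _ => [|i u v _ <-]; rewrite ?ip0r ?ipDr. Qed.

Definition rip x y : R := complex.Re (inner x y).

Lemma ip_nm x : inner x x = cR (nm x ^+ 2).
Proof. by rewrite inner_norm nmE cRX. Qed.
Lemma rip_nm x : rip x x = nm x ^+ 2. Proof. by rewrite /rip ip_nm. Qed.
Lemma ripC x y : rip y x = rip x y. Proof. by rewrite /rip ipC ReJ. Qed.
Lemma ripDl x y z : rip (x + y) z = rip x z + rip y z.
Proof. by rewrite /rip ipDl ReD. Qed.
Lemma ripDr x y z : rip x (y + z) = rip x y + rip x z.
Proof. by rewrite /rip ipDr ReD. Qed.
Lemma ripNl x y : rip (- x) y = - rip x y.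
Proof. by rewrite /rip ipNl ReN. Qed.
Lemma ripNr x y : rip x (- y) = - rip x y.
Proof. by rewrite /rip ipNr ReN. Qed.
Lemma ripBl x y z : rip (x - y) z = rip x z - rip y z.
Proof. by rewrite ripDl ripNl. Qed.
Lemma ripBr x y z : rip x (y - z) = rip x y - rip x z.
Proof. by rewrite ripDr ripNr. Qed.
Lemma ripZl (r : R) x y : rip (cR r *: x) y = r * rip x y.
Proof. by rewrite /rip ipZl ReM Re_cR Im_cR mul0r subr0. Qed.
Lemma ripZr (r : R) x y : rip x (cR r *: y) = r * rip x y.
Proof. by rewrite ripC ripZl ripC. Qed.
Lemma rip0l x : rip 0 x = 0. Proof. by rewrite /rip ip0l. Qed.
Lemma rip0r x : rip x 0 = 0. Proof. by rewrite /rip ip0r. Qed.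

Lemma nm_sqrD x y : nm (x + y) ^+ 2 = nm x ^+ 2 + 2 * rip x y + nm y ^+ 2.
Proof. by rewrite -!rip_nm !ripDl !ripDr (ripC x y); ring. Qed.
Lemma nm_sqrB x y : nm (x - y) ^+ 2 = nm x ^+ 2 - 2 * rip x y + nm y ^+ 2.
Proof. by rewrite nm_sqrD nmN ripNr; ring. Qed.

(** For unit vectors this is [|x - y|^2 >= 0]; the rest is scaling. *)
Lemma rip_CS x y : rip x y <= nm x * nm y.
Proof.
have h x' y' : nm x' = 1 -> nm y' = 1 -> rip x' y' <= 1.
  by move=> hx hy; have := sqr_ge0 (nm (x' - y')); rewrite nm_sqrB hx hy; lra.
have [->|x0] := eqVneq x 0; first by rewrite rip0l nm0 mul0r.
have [->|y0] := eqVneq y 0; first by rewrite rip0r nm0 mulr0.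
have nx : 0 < nm x by rewrite lt_def nm_ge0 andbT; apply: contra_neq x0; exact: nm_eq0.
have ny : 0 < nm y by rewrite lt_def nm_ge0 andbT; apply: contra_neq y0; exact: nm_eq0.
have := h (cR (nm x)^-1 *: x) (cR (nm y)^-1 *: y).
rewrite !nmZ !nm_cR0 ?invr_ge0 ?nm_ge0 // !mulVf ?gt_eqF // => /(_ erefl erefl).
by rewrite ripZl ripZr mulrA -invfM ler_pdivrMl ?mulr_gt0 // mulr1.
Qed.

(** Multiplying x by the conjugate of [inner x y] makes the product real, which reduces the claim to
    [rip_CS]. *)
Lemma ip_CS x y : nm (inner x y) <= nm x * nm y.
Proof.
have [->|h0] := eqVneq (inner x y) 0; first by rewrite nm0 mulr_ge0 ?nm_ge0.
have n0 : 0 < nm (inner x y) by rewrite nm_gt0.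
have := rip_CS ((inner x y)^* *: x) y.
rewrite /rip ipZl mulrC -nm_sqrJ Re_cR nmZ nmJ -mulrA expr2.
by rewrite ler_pM2l.
Qed.

Lemma ip_eq0 x : (forall y, inner x y = 0) -> x = 0.
Proof.
by move=> /(_ x); rewrite ip_nm => /eqP; rewrite cR_eq0 sqrf_eq0 => /eqP/nm_eq0.
Qed.
Lemma ip_eq x y : (forall z, inner x z = inner y z) -> x = y.
Proof.
by move=> h; apply/eqP; rewrite -subr_eq0; apply/eqP/ip_eq0 => z; rewrite ipBl h subrr.
Qed.
Lemma ip_eqr x y : (forall z, inner z x = inner z y) -> x = y.
Proof. by move=> h; apply: ip_eq => z; rewrite ipC h -ipC. Qed.

Lemma rip_ip (z w : R[i]) :
  (forall a : R[i], complex.Re (a * z) = complex.Re (a * w)) -> z = w.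
Proof.
move=> h; have := h 1; rewrite !mul1r => h1; have := h 'i%C; rewrite !ReiM.
by move=> /oppr_inj h2; exact: ceqP.
Qed.

Lemma nm_ip_bound x (C : R) : 0 <= C -> (forall y, nm (inner x y) <= C * nm y) -> nm x <= C.
Proof.
move=> C0 /(_ x); rewrite ip_nm nm_cR0 ?exprn_ge0 ?nm_ge0 //.
have [->|x0] := eqVneq x 0; first by rewrite nm0.
have nx : 0 < nm x by rewrite lt_def nm_ge0 andbT; apply: contra_neq x0; exact: nm_eq0.
by rewrite expr2 ler_pM2r.
Qed.

Lemma ip_lim (u v : nat -> H) (l m : H) : u @ \oo --> l -> v @ \oo --> m ->
  forall e : R, 0 < e -> exists N, forall n, (N <= n)%N ->
    nm (inner l m - inner (u n) (v n)) < e.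
Proof.
move=> /cvg_seq_nm ul /cvg_seq_nm vm e e0.
pose M := nm l + nm m + 1.
have M0 : 0 < M by rewrite ltr_wpDl ?addr_ge0 ?nm_ge0.
pose d := Num.min 1 (e / (2 * M)).
have d0 : 0 < d by rewrite lt_min ltr01 /= divr_gt0 // mulr_gt0.
have [N hN] := ul d d0; have [N' hN'] := vm d d0.
exists (maxn N N') => n; rewrite geq_max => /andP[/hN h1 /hN' h2].
have -> : inner l m - inner (u n) (v n) =
  inner (l - u n) m + inner (u n) (m - v n).
  by rewrite ipBl ipBr addrA subrK.
apply: le_lt_trans (nmD _ _) _.
have un : nm (u n) <= M.
  rewrite (le_trans (nm_distl _ l)) // nmC /M addrC -addrA lerD2l.
  by rewrite (le_trans (ltW h1)) // ge_min lerDr nm_ge0.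
have mM : nm m < M by rewrite /M; have := nm_ge0 l; lra.
apply: (@le_lt_trans _ _ (nm (l - u n) * M + M * nm (m - v n))).
  rewrite lerD //; first by rewrite (le_trans (ip_CS _ _)) // ler_wpM2l ?nm_ge0 // ltW.
  by rewrite (le_trans (ip_CS _ _)) // ler_wpM2r ?nm_ge0.
rewrite mulrC -mulrDr mulrC -ltr_pdivlMr //.
have : d <= e / (2 * M) by rewrite ge_min lexx orbT.
have -> : e / (2 * M) = e / M / 2 by field; rewrite gt_eqF.
lra.
Qed.

End InnerProducts.

Lemma ip_lim_eq (R : realType) (H H' : hilbertType R) (u v : nat -> H) (u' v' : nat -> H')
    (l m : H) (l' m' : H') :
  u @ \oo --> l -> v @ \oo --> m -> u' @ \oo --> l' -> v' @ \oo --> m' ->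
  (forall n, inner (u n) (v n) = inner (u' n) (v' n)) -> inner l m = inner l' m'.
Proof.
move=> h1 h2 h3 h4 E; apply/eqP; rewrite -subr_eq0; apply/eqP/nm_le_eq0 => e e0.
have [N hN] := ip_lim h1 h2 (half_lt e0); have [N' hN'] := ip_lim h3 h4 (half_lt e0).
have := hN _ (leq_maxl N N'); have := hN' _ (leq_maxr N N'); rewrite -E.
set c := inner (u _) _ => h h'.
by apply: le_trans (nm_tri _ c _) _; rewrite (nmC c); lra.
Qed.

Section SequentialTopology.
Variable R : realType.

Lemma closure_nm (V : normedModType R[i]) (A : set V) (x : V) :
  closure A x <-> forall e : R, 0 < e -> exists2 y, A y & nm (x - y) < e.
Proof.
split=> [h e e0|h B /nbhs_nm [e e0 hB]].
  have [y [Ay /= hy]] := h [set y | nm (x - y) < e] ltac:(by apply/nbhs_nm; exists e).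
  by exists y.
by have [y Ay hy] := h e e0; exists y; split => //; apply: hB.
Qed.

Lemma closure_seq (V : normedModType R[i]) (A : set V) (x : V) :
  closure A x -> exists u : nat -> V, (forall n, A (u n)) /\ u @ \oo --> x.
Proof.
move=> /closure_nm h.
have /choice [u hu] : forall n, exists y, A y /\ nm (x - y) < n.+1%:R^-1.
  by move=> n; have [|y] := h (n.+1%:R^-1); rewrite ?invr_gt0 //; exists y.
exists u; split => [n|]; first by have [] := hu n.
apply/cvg_seq_nm => e e0; have [N hN] := inv_small 1 e0; exists N => n /hN.
by rewrite mul1r; apply: lt_trans; have [] := hu n.
Qed.

Lemma seq_closure (V : normedModType R[i]) (A : set V) (x : V) (u : nat -> V) :
  (forall n, A (u n)) -> u @ \oo --> x -> closure A x.
Proof.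
move=> uA /cvg_seq_nm h; apply/closure_nm => e /h [N hN].
by exists (u N) => //; apply: hN; exact: leqnn.
Qed.

Lemma seq_cst (V : normedModType R[i]) (x : V) : (fun _ : nat => x) @ \oo --> x.
Proof. exact: cvg_cst. Qed.
Lemma seqD (V : normedModType R[i]) (u v : nat -> V) x y :
  u @ \oo --> x -> v @ \oo --> y -> (fun n => u n + v n) @ \oo --> x + y.
Proof. exact: cvgD. Qed.
Lemma seqB (V : normedModType R[i]) (u v : nat -> V) x y :
  u @ \oo --> x -> v @ \oo --> y -> (fun n => u n - v n) @ \oo --> x - y.
Proof. exact: cvgB. Qed.
Lemma seqZ (V : normedModType R[i]) (a : R[i]) (u : nat -> V) x :
  u @ \oo --> x -> (fun n => a *: u n) @ \oo --> a *: x.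
Proof. exact: cvgZl_tmp. Qed.

End SequentialTopology.

Section BoundedOperators.
Variable R : realType.

Definition bounded_by (V W : normedModType R[i]) (T : V -> W) (C : R) :=
  forall x, nm (T x) <= C * nm x.

Lemma bounded_continuous (V W : normedModType R[i]) (T : {linear V -> W}) C :
  bounded_by T C -> continuous T.
Proof.
move=> hT x; apply/cvg_nm => e e0.
have M0 : 0 < `|C| + 1 by rewrite ltr_wpDl.
apply/nbhs_nm; exists (e / (`|C| + 1)) => [|y]; first by rewrite divr_gt0.
rewrite ltr_pdivlMr // => h; rewrite -linearB (le_lt_trans (hT _)) //.
apply: le_lt_trans h; rewrite mulrC ler_wpM2l ?nm_ge0 //.
by have := ler_norm C; lra.
Qed.

Lemma continuous_bounded (V W : normedModType R[i]) (T : {linear V -> W}) :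
  continuous T -> exists2 C, 0 <= C & bounded_by T C.
Proof.
move=> /(_ 0) /cvg_nm /(_ 1 ltr01) /nbhs_nm [d d0 h].
exists (2 / d); first by rewrite divr_ge0 // ltW.
move=> x; have [->|x0] := eqVneq x 0; first by rewrite linear0 !nm0 mulr0.
have nx : 0 < nm x by rewrite lt_def nm_ge0 andbT; apply: contra_neq x0; exact: nm_eq0.
have r0 : 0 < d / 2 / nm x by rewrite !divr_gt0.
have := h (cR (d / 2 / nm x) *: x); rewrite sub0r nmN nmZ nm_cR0 ?(ltW r0) //.
rewrite divfK ?gt_eqF // linear0 sub0r nmN linearZ_LR nmZ nm_cR0 ?(ltW r0) //.
have dd : d / 2 < d by lra.
move=> /(_ dd) /ltW; rewrite -ler_pdivlMl // mulr1 => /le_trans; apply.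
suff -> : (d / 2 / nm x)^-1 = 2 / d * nm x by [].
by field; rewrite !gt_eqF.
Qed.

Lemma bounded_seq (V W : normedModType R[i]) (T : {linear V -> W}) C (u : nat -> V) x :
  bounded_by T C -> u @ \oo --> x -> (fun n => T (u n)) @ \oo --> T x.
Proof.
move=> hT /cvg_seq_nm ux; apply/cvg_seq_nm => e e0.
have M0 : 0 < `|C| + 1 by rewrite ltr_wpDl.
have [N hN] := ux _ (divr_gt0 e0 M0); exists N => n /hN; rewrite ltr_pdivlMr // => h.
rewrite -linearB (le_lt_trans (hT _)) //; apply: le_lt_trans h.
by rewrite mulrC ler_wpM2l ?nm_ge0 //; have := ler_norm C; lra.
Qed.

Lemma mk_linear (V W : lmodType R[i]) (f : V -> W) :
  (forall a x y, f (a *: x + y) = a *: f x + f y) ->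
  exists T : {linear V -> W}, forall x, T x = f x.
Proof.
move=> h.
pose g := GRing.isLinear.Build R[i] V W *:%R f h.
by exists (HB.pack_for {linear V -> W} f g).
Qed.

End BoundedOperators.

Section Riesz.
Variables (R : realType) (H : hilbertType R).

Record closed_subspace (M : set H) : Prop := ClosedSubspace {
  csub0 : M 0;
  csub_lin : forall a x y, M x -> M y -> M (a *: x + y);
  csub_lim : forall (u : nat -> H) l, (forall n, M (u n)) -> u @ \oo --> l -> M l }.

Lemma csubZ (M : set H) a x : closed_subspace M -> M x -> M (a *: x).
Proof. by move=> cM Mx; rewrite -[_ *: _]addr0; apply: csub_lin (csub0 cM). Qed.
Lemma csubD (M : set H) x y : closed_subspace M -> M x -> M y -> M (x + y).
Proof. by move=> cM Mx My; rewrite -[x]scale1r; apply: csub_lin. Qed.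

(* The representing vector maximizes [2 Re f w - |w|^2] over M. *)
Lemma riesz_subspace (M : set H) (f : H -> R[i]) (C : R) : closed_subspace M ->
  (forall a x y, f (a *: x + y) = a * f x + f y) ->
  (forall x, M x -> nm (f x) <= C * nm x) ->
  exists2 v, M v & forall w, M w -> f w = inner w v.
Proof.
move=> cM fl fb.
have fD x y : f (x + y) = f x + f y by rewrite -[x]scale1r fl mul1r scale1r.
have f0 : f 0 = 0 by apply: (addIr (f 0)); rewrite -fD !add0r.
have fZ a x : f (a *: x) = a * f x by rewrite -[_ *: _]addr0 fl f0 addr0.
pose J w := 2 * complex.Re (f w) - nm w ^+ 2.
have JC w : M w -> J w <= C ^+ 2.
  move=> Mw; have := le_trans (Re_le_nm (f w)) (fb w Mw).
  have := sqr_ge0 (C - nm w); rewrite /J sqrrB; lra.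
pose A := [set J w | w in M].
have hA : has_sup A.
  split; first by exists (J 0); exists 0 => //; exact: csub0.
  by exists (C ^+ 2) => _ [w Mw <-]; exact: JC.
(* Parallelogram identity: it measures the strict concavity of J at the midpoint. *)
have Jmid v w : J (cR 2^-1 *: (v + w)) = (J v + J w) / 2 + nm (v - w) ^+ 2 / 4.
  rewrite /J fZ fD ReM Re_cR Im_cR mul0r subr0 nmZ nm_cR0 ?invr_ge0 // ReD.
  by rewrite exprMn nm_sqrD nm_sqrB; field.
(* By the midpoint identity, a gap of at most 4^-n / 8 below the supremum keeps consecutive terms
   within 2^-n of each other. *)
have /choice [v hv] : forall n, exists v, M v /\ sup A - (4 ^+ n)^-1 / 8 < J v.
  move=> n; have e0 : 0 < (4 ^+ n)^-1 / 8 :> R by rewrite divr_gt0 // invr_gt0 exprn_gt0.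
  by have [_ [w Mw <-] h] := sup_adherent e0 hA; exists w.
have Jsup w : M w -> J w <= sup A.
  by move=> Mw; apply: ub_le_sup; [case: hA|exists w].
have vc : forall n, nm (v n.+1 - v n) <= 1 / 2 ^+ n.
  move=> n; rewrite mul1r -(@ler_pXn2r _ 2) ?nnegrE ?nm_ge0 ?invr_ge0 ?exprn_ge0 //.
  rewrite exprVn -exprM muln2 -addnn exprD -exprMn (_ : 2 * 2 = 4 :> R); last by ring.
  have [M1 h1] := hv n; have [M2 h2] := hv n.+1.
  have Mm : M (cR 2^-1 *: (v n.+1 + v n)) by apply: csubZ (csubD _ _ _).
  have := Jsup _ Mm; rewrite Jmid; move: h1 h2; rewrite exprS invfM.
  have : 0 < (4 ^+ n)^-1 :> R by rewrite invr_gt0 exprn_gt0.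
  move: (4 ^+ n)^-1 (J (v n)) (J (v n.+1)) (nm _ ^+ 2) => q a b c; lra.
have [l vl] := cauchy_nm_cvg (geo_cauchy vc).
have Ml : M l by apply: csub_lim vl => // n; case: (hv n).
exists l => // w Mw.
(* First variation at the maximizer in the direction w'. Applied to [a *: w] and to its opposite, it
   yields equality. *)
have key w' : M w' -> complex.Re (f w') <= rip l w'.
  move=> Mw'; rewrite -subr_le0; apply/ler_addgt0Pr => e e0; rewrite add0r.
  pose t := e / (nm w' ^+ 2 + 1).
  have q0 : 0 < nm w' ^+ 2 + 1 by rewrite ltr_wpDl ?exprn_ge0 ?nm_ge0.
  have t0 : 0 < t by exact: divr_gt0.
  have step n : 2 * t * (complex.Re (f w') - rip (v n) w') <=
      t ^+ 2 * nm w' ^+ 2 + (4 ^+ n)^-1 / 8.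
    have [M1 h1] := hv n.
    have := Jsup (v n + cR t *: w') (csubD cM M1 (csubZ _ cM Mw')).
    move: h1; rewrite /J fD fZ !ReD ReM Re_cR Im_cR mul0r subr0 nm_sqrD ripZr nmZ.
    by rewrite nm_cR0 ?(ltW t0) // exprMn; lra.
  have tq : t * nm w' ^+ 2 <= e.
    by rewrite /t mulrAC ler_pdivrMr // ler_wpM2l ?(ltW e0) // lerDl.
  have d0 : 0 < e / 4 by rewrite divr_gt0.
  have [N hN] := ip_lim vl (@seq_cst _ _ w') d0.
  have [N' hN'] := geo_small 1 (mulr_gt0 t0 e0).
  have := hN _ (leq_maxl N N'); have := hN' _ (leq_maxr N N').
  move: (maxn N N') => n h1 h2.
  have h3 : (4 ^+ n)^-1 <= (2 ^+ n)^-1 :> R.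
    by rewrite lef_pV2 ?posrE ?exprn_gt0 // lerXn2r ?nnegrE // ler_nat.
  have h4 : rip (v n) w' - rip l w' <= e / 4.
    rewrite /rip -ReB; apply: le_trans (Re_le_nm _) _; rewrite nmC; exact: ltW h2.
  rewrite mul1r in h1.
  have := step n.
  have -> : t ^+ 2 * nm w' ^+ 2 = t * (t * nm w' ^+ 2) by ring.
  have : t * (t * nm w' ^+ 2) <= t * e by rewrite ler_pM2l.
  move=> h5 h6; have : 2 * t * (complex.Re (f w') - rip (v n) w') <= 2 * t * (e * (9/16)).
    lra.
  by rewrite ler_pM2l; [lra|exact: mulr_gt0].
apply: rip_ip => a; rewrite -fZ -ipZl -/(rip _ _) ripC.
have Maw : M (a *: w) by exact: csubZ.
apply/eqP; rewrite eq_le key //= -lerN2.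
have := key _ (csubZ (-1) cM Maw); rewrite [f (-1 *: _)]fZ mulN1r ReN.
by rewrite scaleN1r ripNr.
Qed.

Lemma riesz (f : H -> R[i]) (C : R) :
  (forall a x y, f (a *: x + y) = a * f x + f y) ->
  (forall x, nm (f x) <= C * nm x) -> exists v, forall w, f w = inner w v.
Proof.
move=> fl fb; have cT : closed_subspace [set: H] by split.
by have [v _ h] := riesz_subspace cT fl (fun x _ => fb x); exists v => w; apply: h.
Qed.

Lemma closure_closed_subspace (M : set H) : M 0 ->
  (forall a x y, M x -> M y -> M (a *: x + y)) -> closed_subspace (closure M).
Proof.
move=> M0 Ml; split => [|a x y /closure_seq[u [Mu ux]] /closure_seq[v [Mv vy]]|u l Mu ul].
- exact: subset_closure.
- apply: (@seq_closure _ _ _ _ (fun n => a *: u n + v n)) => [n|]; first exact: Ml.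
  exact: seqD (seqZ ux) vy.
- by apply: closed_closure; exact: seq_closure ul.
Qed.

Lemma lin_span_sub (V : lmodType R[i]) (G : set V) (x : V) : G x -> lin_span G x.
Proof.
by move=> Gx; exists 1%N, (fun=> 1), (fun=> x); split => //; rewrite big_ord1 scale1r.
Qed.

Lemma lin_span0 (V : lmodType R[i]) (G : set V) : lin_span G 0.
Proof.
by exists 0%N, (fun=> 1), (fun=> 0); split; [case|rewrite big_ord0].
Qed.

Lemma lin_span_lin (V : lmodType R[i]) (G : set V) a (x y : V) :
  lin_span G x -> lin_span G y -> lin_span G (a *: x + y).
Proof.
move=> [n [c [v [Gv ->]]]] [m [d [w [Gw ->]]]].
exists (n + m)%N, (fun i => match fintype.split i with inl j => a * c j | inr j => d j end),
  (fun i => match fintype.split i with inl j => v j | inr j => w j end); split.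
  by move=> i; case: (fintype.split i).
rewrite big_split_ord scaler_sumr; congr (_ + _); apply: eq_bigr => i _.
  by rewrite (unsplitK (inl i)) scalerA.
by rewrite (unsplitK (inr i)).
Qed.

(** The Riesz vector v of the functional [inner _ x] on the closed span is the projection of x, so
    [x - v] is orthogonal to G. *)
Lemma total_dense (G : set H) :
  (forall x, (forall g, G g -> inner x g = 0) -> x = 0) ->
  closure (lin_span G) = [set: H].
Proof.
move=> tot; apply/seteqP; split => // x _.
have cM := closure_closed_subspace (@lin_span0 _ G) (@lin_span_lin _ G).
have fl a u v : inner (a *: u + v) x = a * inner u x + inner v x.
  by rewrite ipDl ipZl.
have [v Mv hv] := riesz_subspace cM fl (fun u _ => le_trans (ip_CS u x) (eq_ind _ (fun r => r <= _) (lexx _) _ (mulrC _ _))).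
suff /eqP : x - v = 0 by rewrite subr_eq0 => /eqP ->.
apply: tot => g Gg; rewrite ipC ipBr hv ?subrr ?conjC0 //.
by apply: subset_closure; exact: lin_span_sub.
Qed.

Lemma dense_total (G : set H) (x : H) : closure (lin_span G) = [set: H] ->
  (forall g, G g -> inner x g = 0) -> x = 0.
Proof.
move=> dG xG; have : closure (lin_span G) x by rewrite dG.
move=> /closure_seq[u [Gu ux]].
have e : forall n, inner x (u n) = inner (0 : H) (0 : H).
  move=> n; have [m [c [v [Gv ->]]]] := Gu n.
  by rewrite ip0l ip_sumr big1 // => i _; rewrite ipZr xG ?mulr0.
have := ip_lim_eq (@seq_cst _ _ x) ux (@seq_cst _ _ 0) (@seq_cst _ _ 0) e.
by rewrite ip_nm ip0l => /eqP; rewrite cR_eq0 sqrf_eq0 => /eqP/nm_eq0.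
Qed.

End Riesz.

Section Adjoints.
Variable R : realType.

Lemma adjointE (U Y : hilbertType R) (T : {linear U -> Y}) C : bounded_by T C ->
  forall u y, inner (T u) y = inner u (adjoint T y).
Proof.
move=> hT u y.
have [v hv] : exists v, forall w, inner (T w) y = inner w v.
  apply: (@riesz _ _ _ (C * nm y)) => [a w w'|w].
    by rewrite linearP ipDl ipZl.
  rewrite (le_trans (ip_CS _ _)) // mulrAC ler_wpM2r ?nm_ge0 //.
rewrite /adjoint; case: xgetP => [w _ hw|/(_ v)]; first exact: hw.
by case.
Qed.

Lemma adjoint_uniq (U Y : hilbertType R) (T : {linear U -> Y}) C y v : bounded_by T C ->
  (forall u, inner (T u) y = inner u v) -> adjoint T y = v.
Proof. by move=> hT h; apply: ip_eqr => z; rewrite -(adjointE hT) h. Qed.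

Lemma adjoint_bounded (U Y : hilbertType R) (T : {linear U -> Y}) C : 0 <= C ->
  bounded_by T C -> bounded_by (adjoint T) C.
Proof.
move=> C0 hT y; apply: nm_ip_bound => [|u]; first by rewrite mulr_ge0 ?nm_ge0.
rewrite ipC nmJ -(adjointE hT) (le_trans (ip_CS _ _)) // mulrAC.
by rewrite ler_wpM2r ?nm_ge0.
Qed.

End Adjoints.

(** * Hilbert spaces from complete positive forms *)

(** Completeness is a field because the two kinds of spaces built from such forms, orthogonal sums
    and Gram spaces, are complete by construction; no completion is taken. *)
Record complete_form (R : realType) (V : lmodType R[i]) := CompleteForm {
  cf :> V -> V -> R[i];
  cf_lin : forall a x y z, cf (a *: x + y) z = a * cf x z + cf y z;
  cf_herm : forall x y, cf y x = (cf x y)^*;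
  cf_pos : forall x, x != 0 -> 0 < cf x x;
  cf_complete : forall u : nat -> V,
    (forall e : R, 0 < e -> exists N, forall m n, (N <= m)%N -> (N <= n)%N ->
       complex.Re (cf (u m - u n) (u m - u n)) < e) ->
    exists l, forall e : R, 0 < e -> exists N, forall n, (N <= n)%N ->
       complex.Re (cf (l - u n) (l - u n)) < e }.

(* [V] with the norm and the topology induced by the form. *)
Definition form_space_of (R : realType) (V : lmodType R[i]) (f : complete_form V) : Type := V.

Section FormNorm.
Variables (R : realType) (V : lmodType R[i]) (f : complete_form V).
Implicit Types x y : V.

Local Notation form_space := (form_space_of f).

Lemma cfD x y z : f (x + y) z = f x z + f y z.
Proof. by rewrite -[x in LHS]scale1r cf_lin mul1r. Qed.
Lemma cf0l z : f 0 z = 0.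
Proof. by apply: (addIr (f 0 z)); rewrite -cfD !add0r. Qed.
Lemma cfZ a x z : f (a *: x) z = a * f x z.
Proof. by rewrite -[a *: x]addr0 cf_lin cf0l addr0. Qed.
Lemma cfDr x y z : f z (x + y) = f z x + f z y.
Proof. by rewrite cf_herm cfD rmorphD /= -!cf_herm. Qed.
Lemma cfZr a x z : f z (a *: x) = a^* * f z x.
Proof. by rewrite cf_herm cfZ rmorphM /= -cf_herm. Qed.

Definition cfq x : R := complex.Re (f x x).

Lemma cfq_ge0 x : 0 <= cfq x.
Proof.
have [->|/(cf_pos f) h] := eqVneq x 0; first by rewrite /cfq cf0l.
by have := ltW h; rewrite lecE => /andP[].
Qed.
Lemma cfqE x : f x x = cR (cfq x).
Proof.
apply: ceqP => //=; have /(congr1 (@complex.Im R)) := cf_herm f x x.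
rewrite ImJ; lra.
Qed.
Lemma cfq0 x : cfq x = 0 -> x = 0.
Proof.
move=> h; apply/eqP; apply: contraT => /(cf_pos f).
by rewrite cfqE h -(cR0 R) ltxx.
Qed.
Lemma cfqD x y : cfq (x + y) = cfq x + 2 * complex.Re (f x y) + cfq y.
Proof.
by rewrite /cfq cfD !cfDr !ReD (cf_herm f x y) ReJ; ring.
Qed.
Lemma cfqZ a x : cfq (a *: x) = nm a ^+ 2 * cfq x.
Proof.
by rewrite /cfq cfZ cfZr mulrA -nm_sqrJ ReM Re_cR Im_cR mul0r subr0.
Qed.

Definition cfnorm x : R[i] := cR (Num.sqrt (cfq x)).

Lemma cf_CS x y : complex.Re (f x y) <= Num.sqrt (cfq x) * Num.sqrt (cfq y).
Proof.
set a := Num.sqrt _; set b := Num.sqrt _.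
have a2 : a ^+ 2 = cfq x by rewrite sqr_sqrtr ?cfq_ge0.
have b2 : b ^+ 2 = cfq y by rewrite sqr_sqrtr ?cfq_ge0.
have a0 : 0 <= a by exact: sqrtr_ge0.
have b0 : 0 <= b by exact: sqrtr_ge0.
have [ae|an] := eqVneq a 0.
  have -> : x = 0 by apply: cfq0; rewrite -a2 ae expr0n.
  by rewrite cf0l ae mul0r.
have [be|bn] := eqVneq b 0.
  have -> : y = 0 by apply: cfq0; rewrite -b2 be expr0n.
  by rewrite cf_herm cf0l conjC0 be mulr0.
have ab0 : 0 < a * b by rewrite mulr_gt0 // lt_def ?an ?bn.
have := cfq_ge0 (cR b *: x + cR (- a) *: y).
rewrite cfqD !cfqZ cfZ cfZr cRJ mulrA -cRM ReM Re_cR Im_cR mul0r subr0.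
rewrite !nm_cR !real_normK ?num_real // -a2 -b2 => h.
by rewrite -(ler_pM2l ab0); lra.
Qed.

Lemma cfnormD x y : cfnorm (x + y) <= cfnorm x + cfnorm y.
Proof.
rewrite /cfnorm -cRD cR_le -(@ler_pXn2r _ 2) ?nnegrE ?addr_ge0 ?sqrtr_ge0 //.
rewrite sqrrD !sqr_sqrtr ?cfq_ge0 // cfqD.
by have := cf_CS x y; lra.
Qed.
Lemma cfnormZ a x : cfnorm (a *: x) = `|a| * cfnorm x.
Proof.
by rewrite /cfnorm cfqZ sqrtrM ?exprn_ge0 ?nm_ge0 // sqrtr_sqr ger0_norm ?nm_ge0 // cRM nmE.
Qed.
Lemma cfnorm0 x : cfnorm x = 0 -> x = 0.
Proof.
move=> /cR_inj /eqP; rewrite sqrtr_eq0 => h; apply: cfq0.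
by apply/eqP; rewrite eq_le h cfq_ge0.
Qed.

HB.instance Definition _ := GRing.Lmodule.copy form_space V.
HB.instance Definition _ :=
  Lmodule_isNormed.Build R[i] form_space cfnormD cfnormZ cfnorm0.

Lemma form_space_nm (x : form_space) : nm x = Num.sqrt (cfq x).
Proof. by []. Qed.

Lemma form_space_nm2 (x : form_space) : nm x ^+ 2 = cfq x.
Proof. by rewrite form_space_nm sqr_sqrtr ?cfq_ge0. Qed.

Lemma form_space_complete (F : set_system form_space) :
  ProperFilter F -> cauchy F -> cvg F.
Proof.
move=> FF /cauchyP Fc.
(* Completeness speaks of filters: the centres of balls of radius 2^-n that belong to F form a
   Cauchy sequence, and its limit is the limit of F. *)
have /choice [u hu] : forall n : nat, exists x : form_space,
    F [set y | nm (x - y) < 1 / 2 ^+ n].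
  move=> n; have d0 : 0 < (1 / 2 ^+ n : R) by rewrite divr_gt0 // exprn_gt0.
  have [|x hx] := Fc (cR (1 / 2 ^+ n)); first by rewrite -(cR0 R) cR_lt.
  exists x; apply: filterS hx => y; by rewrite -ball_normE /= nmE cR_lt.
have uc m n : nm (u m - u n) < 1 / 2 ^+ m + 1 / 2 ^+ n.
  have [y [/= h1 h2]] := filter_ex (filterI (hu m) (hu n)).
  by apply: le_lt_trans (nm_tri _ y _) _; rewrite (nmC y); apply: ltrD.
have [l hl] : exists l : form_space, forall e : R, 0 < e -> exists N, forall n, (N <= n)%N -> nm (l - u n) < e.
  have [|l hl] := @cf_complete _ _ f u.
    move=> e e0; have s0 : 0 < Num.sqrt e by rewrite sqrtr_gt0.
    have [N hN] := geo_small 1 (half_lt s0); exists N => m n /hN h1 /hN h2.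
    rewrite -/(cfq _) -(form_space_nm2 (u m - u n)) -[e]sqr_sqrtr ?(ltW e0) //.
    rewrite ltr_pXn2r ?nnegrE ?nm_ge0 ?sqrtr_ge0 //.
    by apply: lt_trans (uc m n) _; lra.
  exists l => e e0; have [N hN] := hl (e ^+ 2) (exprn_gt0 2 e0); exists N => n /hN.
  by rewrite -/(cfq _) -(form_space_nm2 (l - u n)) ltr_pXn2r ?nnegrE ?nm_ge0 ?(ltW e0).
apply/cvg_ex; exists l; apply/cvg_nm => e e0.
have [N hN] := hl _ (half_lt e0); have [N' hN'] := geo_small 1 (half_lt e0).
have := hu (maxn N N'); apply: filterS => y /= hy.
apply: le_lt_trans (nm_tri _ (u (maxn N N')) _) _.
by have := hN _ (leq_maxl N N'); have := hN' _ (leq_maxr N N'); lra.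
Qed.

HB.instance Definition _ := Uniform_isComplete.Build form_space form_space_complete.

Definition form_inner (x y : form_space) : R[i] := f x y.

Lemma form_inner_bilinear :
  bilinear_for *%R (Num.conj \; *%R) form_inner.
Proof.
split=> [y a x x'|x a y y'].
  by rewrite /form_inner cf_lin.
by rewrite /form_inner cfDr cfZr.
Qed.

HB.instance Definition _ := bilinear_isBilinear.Build R[i] form_space form_space R[i]
   *%R (Num.conj \; *%R) form_inner form_inner_bilinear.
Lemma form_inner_herm x y : form_inner x y = (-1) ^+ false * Num.conj (form_inner y x).
Proof. by rewrite expr0 mul1r /form_inner -cf_herm. Qed.
HB.instance Definition _ := isHermitianSesquilinear.Build R[i] form_space false
  Num.conj form_inner form_inner_herm.
Lemma form_inner_pos x : x != 0 -> 0 < form_inner x x.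
Proof. exact: cf_pos. Qed.
HB.instance Definition _ := isDotProduct.Build R[i] form_space form_inner form_inner_pos.

Lemma form_inner_norm (x : form_space) : form_inner x x = `|x| ^+ 2.
Proof. by rewrite nmE -cRX form_space_nm2 -cfqE. Qed.

HB.instance Definition _ := isHilbert.Build R form_space form_inner_norm.

End FormNorm.

(** * Orthogonal direct sums as Hilbert spaces *)

Section DirectSums.
Variables (R : realType) (X Y : hilbertType R).

Lemma dsum_lin (a : R[i]) (p q r : X * Y) :
  dsum_inner (a *: p + q) r = a * dsum_inner p r + dsum_inner q r.
Proof. by rewrite /dsum_inner /= !ipDl !ipZl; ring. Qed.

Lemma dsum_herm (p q : X * Y) : dsum_inner q p = (dsum_inner p q)^*.
Proof. by rewrite /dsum_inner rmorphD /= -!ipC. Qed.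

Lemma dsum_nm (p : X * Y) : dsum_inner p p = cR (nm p.1 ^+ 2 + nm p.2 ^+ 2).
Proof. by rewrite /dsum_inner !ip_nm cRD. Qed.

Lemma nm_pos (V : normedModType R[i]) (x : V) : x != 0 -> 0 < nm x.
Proof. by move=> h; rewrite lt_def nm_ge0 andbT; apply: contra_neq h; exact: nm_eq0. Qed.

Lemma dsum_pos (p : X * Y) : p != 0 -> 0 < dsum_inner p p.
Proof.
move=> h; rewrite dsum_nm -(cR0 R) cR_lt lt_def addr_ge0 ?exprn_ge0 ?nm_ge0 // andbT.
apply: contra_neqN h; rewrite paddr_eq0 ?exprn_ge0 ?nm_ge0 // !sqrf_eq0.
by move=> /andP[/eqP/nm_eq0 h1 /eqP/nm_eq0 h2]; rewrite [p]surjective_pairing h1 h2.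
Qed.

Lemma dsum_complete (u : nat -> X * Y) :
  (forall e : R, 0 < e -> exists N, forall m n, (N <= m)%N -> (N <= n)%N ->
     complex.Re (dsum_inner (u m - u n) (u m - u n)) < e) ->
  exists l, forall e : R, 0 < e -> exists N, forall n, (N <= n)%N ->
     complex.Re (dsum_inner (l - u n) (l - u n)) < e.
Proof.
move=> h.
have c1 : cauchy_nm (fun n => (u n).1).
  move=> e e0; have [N hN] := h _ (exprn_gt0 2 e0); exists N => m n hm hn.
  rewrite -(@ltr_pXn2r _ 2) ?nnegrE ?nm_ge0 ?(ltW e0) //.
  apply: le_lt_trans (hN m n hm hn); rewrite dsum_nm Re_cR.
  by rewrite lerDl exprn_ge0 ?nm_ge0.
have c2 : cauchy_nm (fun n => (u n).2).
  move=> e e0; have [N hN] := h _ (exprn_gt0 2 e0); exists N => m n hm hn.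
  rewrite -(@ltr_pXn2r _ 2) ?nnegrE ?nm_ge0 ?(ltW e0) //.
  apply: le_lt_trans (hN m n hm hn); rewrite dsum_nm Re_cR.
  by rewrite lerDr exprn_ge0 ?nm_ge0.
have [x /cvg_seq_nm hx] := cauchy_nm_cvg c1; have [y /cvg_seq_nm hy] := cauchy_nm_cvg c2.
exists (x, y) => e e0.
have s0 : 0 < Num.sqrt (e / 2) by rewrite sqrtr_gt0 divr_gt0.
have [N hN] := hx _ s0; have [N' hN'] := hy _ s0.
exists (maxn N N') => n; rewrite geq_max => /andP[/hN h1 /hN' h2].
rewrite dsum_nm Re_cR /=.
have e2 : 0 <= e / 2 by rewrite divr_ge0 // ltW.
have sq t : 0 <= t -> t < Num.sqrt (e / 2) -> t ^+ 2 < e / 2.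
  by move=> t0 lt; rewrite -[ltRHS]sqr_sqrtr // ltr_pXn2r ?nnegrE ?sqrtr_ge0.
by have := sq _ (nm_ge0 _) h1; have := sq _ (nm_ge0 _) h2; lra.
Qed.

(** The pairs are those of the product type, but the norm is that of the orthogonal sum, so that
    closed spans of pairs can serve as graphs of isometries. *)
Definition dsum : hilbertType R :=
  form_space_of (CompleteForm dsum_lin dsum_herm dsum_pos dsum_complete).

Lemma dsum_ip (p q : dsum) : inner p q = inner p.1 q.1 + inner p.2 q.2.
Proof. by []. Qed.

Lemma dsum_nm2 (p : dsum) : nm p ^+ 2 = nm p.1 ^+ 2 + nm p.2 ^+ 2.
Proof. by apply: cR_inj; rewrite -ip_nm dsum_ip !ip_nm cRD. Qed.

Lemma dsum_nm_fst (p : dsum) : nm p.1 <= nm p.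
Proof.
by rewrite -(@ler_pXn2r _ 2) ?nnegrE ?nm_ge0 // dsum_nm2 lerDl exprn_ge0 ?nm_ge0.
Qed.
Lemma dsum_nm_snd (p : dsum) : nm p.2 <= nm p.
Proof.
by rewrite -(@ler_pXn2r _ 2) ?nnegrE ?nm_ge0 // dsum_nm2 lerDr exprn_ge0 ?nm_ge0.
Qed.

Lemma dsum_lim_fst (u : nat -> dsum) (l : dsum) :
  u @ \oo --> l -> (fun n => (u n).1) @ \oo --> l.1.
Proof.
move=> /cvg_seq_nm h; apply/cvg_seq_nm => e /h[N hN]; exists N => n /hN.
exact: le_lt_trans (dsum_nm_fst (l - u n)).
Qed.
Lemma dsum_lim_snd (u : nat -> dsum) (l : dsum) :
  u @ \oo --> l -> (fun n => (u n).2) @ \oo --> l.2.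
Proof.
move=> /cvg_seq_nm h; apply/cvg_seq_nm => e /h[N hN]; exists N => n /hN.
exact: le_lt_trans (dsum_nm_snd (l - u n)).
Qed.

End DirectSums.

(** * Isometries determined by the Gram matrix of a total family *)

Section IsometryExtension.
Variable R : realType.

Definition total (H : hilbertType R) (I : Type) (a : I -> H) :=
  forall x, (forall i, inner x (a i) = 0) -> x = 0.

Lemma total_eq (H : hilbertType R) (I : Type) (a : I -> H) (x y : H) : total a ->
  (forall i, inner x (a i) = inner y (a i)) -> x = y.
Proof.
move=> ta h; apply/eqP; rewrite -subr_eq0; apply/eqP/ta => i.
by rewrite ipBl h subrr.
Qed.

(** The closed span of the pairs [(a i, b i)] is a graph: both coordinates have the same inner
    products on it, so the first coordinate determines the second. It lies over every x because
    approximants of x lift to pairs whose second coordinates are Cauchy. *)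
Lemma isometric_extension (H1 H2 : hilbertType R) (I : Type) (a : I -> H1) (b : I -> H2) :
  (forall i j, inner (a i) (a j) = inner (b i) (b j)) -> total a ->
  exists W : {linear H1 -> H2},
    (forall x y, inner (W x) (W y) = inner x y) /\ forall i, W (a i) = b i.
Proof.
move=> ab ta.
pose c i : dsum H1 H2 := (a i, b i).
pose L := lin_span (range c); pose G := closure L.
have cG : closed_subspace G.
  by apply: closure_closed_subspace; [exact: lin_span0|exact: lin_span_lin].
have Lip p q : L p -> L q -> inner p.1 q.1 = inner p.2 q.2.
  have sum_fst m (d : 'I_m -> R[i]) (v : 'I_m -> dsum H1 H2) :
      (\sum_i d i *: v i).1 = \sum_i d i *: (v i).1.
    by elim/big_rec2: _ => //= i x y _ <-.
  have sum_snd m (d : 'I_m -> R[i]) (v : 'I_m -> dsum H1 H2) :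
      (\sum_i d i *: v i).2 = \sum_i d i *: (v i).2.
    by elim/big_rec2: _ => //= i x y _ <-.
  move=> [m [d [v [Gv ->]]]] [n [e [w [Gw ->]]]].
  rewrite !sum_fst !sum_snd !ip_suml; apply: eq_bigr => i _.
  rewrite !ip_sumr; apply: eq_bigr => j _; rewrite !ipZl !ipZr; congr (_ * (_ * _)).
  by have [k _ <-] := Gv i; have [k' _ <-] := Gw j; exact: ab.
have Gip p q : G p -> G q -> inner p.1 q.1 = inner p.2 q.2.
  move=> /closure_seq[u [Lu up]] /closure_seq[v [Lv vq]].
  apply: (ip_lim_eq (dsum_lim_fst up) (dsum_lim_fst vq) (dsum_lim_snd up) (dsum_lim_snd vq)).
  by move=> n; exact: Lip.
have Gnm p : G p -> nm p.1 = nm p.2.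
  move=> Gp; apply/eqP; rewrite -(@eqrXn2 _ 2) ?nm_ge0 //; apply/eqP/cR_inj.
  by rewrite -!ip_nm Gip.
have ex x : exists y, G (x, y).
  have : closure (lin_span (range a)) x.
    rewrite total_dense // => z hz; apply: ta => i; apply: hz; by exists i.
  move=> /closure_seq[u [Lu ux]].
  have lift n : exists y, L (u n, y).
    have [m [d [v [Gv ->]]]] := Lu n.
    have /choice[k hk] : forall i, exists k, a k = v i by move=> i; have [k _ <-] := Gv i; exists k.
    exists (\sum_i d i *: b (k i)); exists m, d, (fun i => c (k i)); split.
      by move=> i; exists (k i).
    apply: (@eq_trans _ _ (\sum_i d i *: a (k i), \sum_i d i *: b (k i))).
      by congr pair; apply: eq_bigr => i _; rewrite hk.
    by symmetry; elim/big_rec3: _ => //= i x1 x2 x3 _ ->.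
  have [y hy] := choice lift.
  have yc : cauchy_nm (fun n => y n).
    move=> e e0; have [N hN] := (cvg_seq_nm _ _).1 ux _ (half_lt e0); exists N => m n hm hn.
    have Gmn : G (u m - u n, y m - y n).
      have -> : (u m - u n, y m - y n) = -1 *: (u n, y n) + (u m, y m) :> dsum H1 H2.
        by apply: (@eq_trans _ _ (-1 *: u n + u m, -1 *: y n + y m)) => //; rewrite !scaleN1r ![- _ + _]addrC.
      by apply: (csub_lin cG); apply: subset_closure; exact: hy.
    have /= <- := Gnm _ Gmn.
    apply: le_lt_trans (nm_tri _ x _) _; rewrite (nmC _ x).
    by have := hN _ hm; have := hN _ hn; lra.
  have [l yl] := cauchy_nm_cvg yc; exists l.
  apply: (csub_lim cG (u := fun n => (u n, y n))) => [n|]; first exact: subset_closure.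
  apply/cvg_seq_nm => e e0.
  have [N hN] := (cvg_seq_nm _ _).1 ux _ (half_lt e0).
  have [N' hN'] := (cvg_seq_nm _ _).1 yl _ (half_lt e0).
  exists (maxn N N') => n; rewrite geq_max => /andP[/hN h1 /hN' h2].
  rewrite -(@ltr_pXn2r _ 2) ?nnegrE ?nm_ge0 ?(ltW e0) // dsum_nm2 /=.
  have := nm_ge0 (x - u n); have := nm_ge0 (l - y n).
  by move: (nm (x - u n)) (nm (l - y n)) h1 h2 => p q; nra.
have [W hW] := choice ex.
have Wuniq x y : G (x, y) -> y = W x.
  move=> Gxy; apply/eqP; rewrite -subr_eq0; apply/eqP/nm_eq0.
  have G0 : G (0, y - W x).
    have -> : (0, y - W x) = -1 *: (x, W x) + (x, y) :> dsum H1 H2.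
      by apply: (@eq_trans _ _ (-1 *: x + x, -1 *: W x + y)) => //; rewrite !scaleN1r addNr addrC.
    by apply: (csub_lin cG).
  by have /= <- := Gnm _ G0; rewrite nm0.
have [W' hW'] : exists W' : {linear H1 -> H2}, forall x, W' x = W x.
  by apply: mk_linear => r x y; symmetry; apply: Wuniq; apply: (csub_lin cG r (hW x) (hW y)).
exists W'; split => [x y|i]; first by rewrite !hW'; symmetry; exact: (Gip _ _ (hW x) (hW y)).
rewrite hW'; symmetry; apply: Wuniq; apply: subset_closure; apply: lin_span_sub.
by exists i.
Qed.

(** The extension V in the opposite direction gives surjectivity: [W (V y)] and y have the same
    inner product with every [b i]. *)
Lemma unitary_extension (H1 H2 : hilbertType R) (I : Type) (a : I -> H1) (b : I -> H2) :
  (forall i j, inner (a i) (a j) = inner (b i) (b j)) -> total a -> total b ->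
  exists W : {linear H1 -> H2},
    [/\ forall x y, inner (W x) (W y) = inner x y, forall y, exists x, W x = y
      & forall i, W (a i) = b i].
Proof.
move=> ab ta tb.
have [W [Wi Wa]] := isometric_extension ab ta.
have [V [Vi Vb]] := isometric_extension (fun i j => esym (ab i j)) tb.
exists W; split => // y; exists (V y); apply: (total_eq tb) => i.
by rewrite -{1}Wa Wi -Vb Vi.
Qed.

End IsometryExtension.

(** * Reproducing kernel Hilbert spaces *)

Section GramSpace.
Variables (R : realType) (J : Type) (g : J -> J -> R[i]).

(* [fcomb v] is a finite combination of kernel functions, and [fev F v] is the inner
   product of F with it in the space to be built; that space consists of the [F]
   for which [fev F] is bounded. *)
Definition fev (F : J -> R[i]) (v : seq (R[i] * J)) : R[i] :=
  \sum_(p <- v) (p.1)^* * F p.2.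
Definition fcomb (v : seq (R[i] * J)) (j : J) : R[i] :=
  \sum_(p <- v) p.1 * g p.2 j.
Definition fscale (c : R[i]) (v : seq (R[i] * J)) := [seq (c * p.1, p.2) | p <- v].

Hypothesis g_herm : forall i j, g j i = (g i j)^*.
Hypothesis g_pos : forall v, 0 <= fev (fcomb v) v.

Lemma fev_cat F u v : fev F (u ++ v) = fev F u + fev F v.
Proof. by rewrite /fev big_cat. Qed.
Lemma fev_scale F c v : fev F (fscale c v) = c^* * fev F v.
Proof.
by rewrite /fev big_map mulr_sumr; apply: eq_bigr => p _ /=; rewrite rmorphM mulrA.
Qed.
Lemma fev_lin a F G v : fev (fun j => a * F j + G j) v = a * fev F v + fev G v.
Proof.
rewrite /fev mulr_sumr -big_split; apply: eq_bigr => p _ /=; ring.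
Qed.
Lemma fev_sub F G v : fev (fun j => F j - G j) v = fev F v - fev G v.
Proof.
rewrite /fev -sumrB; apply: eq_bigr => p _ /=; ring.
Qed.
Lemma fcomb_cat u v j : fcomb (u ++ v) j = fcomb u j + fcomb v j.
Proof. by rewrite /fcomb big_cat. Qed.
Lemma fcomb_scale c v j : fcomb (fscale c v) j = c * fcomb v j.
Proof.
by rewrite /fcomb big_map mulr_sumr; apply: eq_bigr => p _ /=; rewrite mulrA.
Qed.
Lemma fcomb_herm u v : fev (fcomb u) v = (fev (fcomb v) u)^*.
Proof.
rewrite /fev /fcomb rmorph_sum /=.
under eq_bigr do rewrite mulr_sumr.
under [RHS]eq_bigr do rewrite rmorphM /= conjCK rmorph_sum mulr_sumr /=.
rewrite exchange_big /=; apply: eq_bigr => p _; apply: eq_bigr => q _.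
by rewrite rmorphM /= -g_herm; ring.
Qed.
Lemma eq_fev F G v : F =1 G -> fev F v = fev G v.
Proof. by move=> FG; apply: eq_bigr => p _; rewrite FG. Qed.

Definition fsq v : R := complex.Re (fev (fcomb v) v).
Definition flen v : R := Num.sqrt (fsq v).

Lemma fsqE v : fev (fcomb v) v = cR (fsq v).
Proof. by apply: ceqP => //=; rewrite (ger0_Im (g_pos v)). Qed.
Lemma fsq_ge0 v : 0 <= fsq v.
Proof. by have := g_pos v; rewrite fsqE -(cR0 R) cR_le. Qed.
Lemma flen_ge0 v : 0 <= flen v. Proof. exact: sqrtr_ge0. Qed.
Lemma flen_sqr v : flen v ^+ 2 = fsq v. Proof. by rewrite sqr_sqrtr ?fsq_ge0. Qed.
Lemma fsq_cat u v : fsq (u ++ v) = fsq u + 2 * complex.Re (fev (fcomb u) v) + fsq v.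
Proof.
rewrite /fsq (@eq_fev _ (fun j => 1 * fcomb u j + fcomb v j)); last first.
  by move=> j; rewrite fcomb_cat mul1r.
rewrite fev_lin mul1r !fev_cat !ReD (fcomb_herm v u) ReJ; ring.
Qed.
Lemma fsq_scale c v : fsq (fscale c v) = nm c ^+ 2 * fsq v.
Proof.
rewrite /fsq (@eq_fev _ (fun j => c * fcomb v j + 0)); last first.
  by move=> j; rewrite fcomb_scale addr0.
rewrite fev_lin fev_scale /fev [X in _ + X]big1 => [|p _]; last by rewrite mulr0.
by rewrite addr0 mulrA -nm_sqrJ ReM Re_cR Im_cR mul0r subr0.
Qed.

Definition fbnd (F : J -> R[i]) (C : R) := forall v, nm (fev F v) <= C * flen v.

Lemma fbnd_Re F (C : R) : (forall v, complex.Re (fev F v) <= C * flen v) -> fbnd F C.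
Proof.
move=> h v.
have [h0|h0] := eqVneq (fev F v) 0.
  have := h v; have := h (fscale (-1) v); rewrite h0 fev_scale h0 mulr0 nm0 //.
have n0 : 0 < nm (fev F v) by rewrite nm_gt0.
pose c := fev F v; have := h (fscale c v).
rewrite fev_scale mulrC -nm_sqrJ Re_cR /flen fsq_scale sqrtrM ?exprn_ge0 ?nm_ge0 //.
by rewrite sqrtr_sqr ger0_norm ?nm_ge0 // mulrCA expr2 ler_pM2l.
Qed.

Lemma le_prod_eps (x a b : R) : 0 <= a -> 0 <= b ->
  (forall e, 0 < e -> x <= (a + e) * (b + e)) -> x <= a * b.
Proof.
move=> a0 b0 h; apply/ler_addgt0Pr => e e0.
pose d := Num.min 1 (e / (a + b + 1)).
have q0 : 0 < a + b + 1 by lra.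
have d0 : 0 < d by rewrite lt_min ltr01 /= divr_gt0.
have d1 : d <= 1 by rewrite ge_min lexx.
have de : d * (a + b + 1) <= e by rewrite -ler_pdivlMr // ge_min lexx orbT.
apply: le_trans (h d d0) _; nra.
Qed.

(** Cauchy-Schwarz for a form that may be degenerate: the test vector is
    [(|v| + e) u - (|u| + e) v], so that no length is zero. *)
Lemma fcomb_bnd u : fbnd (fcomb u) (flen u).
Proof.
apply: fbnd_Re => v; apply: le_prod_eps; rewrite ?flen_ge0 // => e e0.
have := fsq_ge0 (fscale (cR (flen v + e)) u ++ fscale (cR (- (flen u + e))) v).
rewrite fsq_cat !fsq_scale (@eq_fev _ (fun j => cR (flen v + e) * fcomb u j + 0)); last first.
  by move=> j; rewrite fcomb_scale addr0.
rewrite fev_lin fev_scale /fev [X in _ * _ + X]big1 => [|p _]; last by rewrite mulr0.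
rewrite -/(fev _ _) addr0 mulrA cRJ -cRM ReM Re_cR Im_cR mul0r subr0.
rewrite !nm_cR !real_normK ?num_real // -!flen_sqr.
have := flen_ge0 u; have := flen_ge0 v; set a := flen u; set b := flen v => b0 a0 h.
have ab : 0 < (a + e) * (b + e) by rewrite mulr_gt0 // ltr_wpDl.
rewrite -(ler_pM2l ab).
have h1 : a ^+ 2 <= (a + e) ^+ 2 by rewrite lerXn2r ?nnegrE //; lra.
have h2 : b ^+ 2 <= (b + e) ^+ 2 by rewrite lerXn2r ?nnegrE //; lra.
have h3 : (b + e) ^+ 2 * a ^+ 2 <= (b + e) ^+ 2 * (a + e) ^+ 2 by rewrite ler_wpM2l ?exprn_ge0 //; lra.
have h4 : (a + e) ^+ 2 * b ^+ 2 <= (a + e) ^+ 2 * (b + e) ^+ 2 by rewrite ler_wpM2l ?exprn_ge0 //; lra.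
move: h; rewrite sqrrN; nra.
Qed.

(** Take v that maximizes [2 Re F(v) - |v|^2] up to d^2. Comparison with [v ++ w] for every w bounds
    the remainder [F - fcomb v] by d, so finite combinations are dense. *)
Lemma fbnd_approx F C (d : R) : 0 <= C -> fbnd F C -> 0 < d ->
  exists v, fbnd (fun j => F j - fcomb v j) d.
Proof.
move=> C0 hF d0.
pose Q v := 2 * complex.Re (fev F v) - fsq v.
pose A := range Q.
have QC v : Q v <= C ^+ 2.
  have := le_trans (Re_le_nm _) (hF v); have := sqr_ge0 (C - flen v).
  by rewrite /Q -flen_sqr sqrrB; lra.
have hA : has_sup A.
  by split; [exists (Q [::]); exists [::]|exists (C ^+ 2) => _ [v _ <-]].
have [_ [v _ <-] hv] := sup_adherent (exprn_gt0 2 d0) hA.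
exists v.
have step w : 2 * complex.Re (fev (fun j => F j - fcomb v j) w) <= d ^+ 2 + fsq w.
  have : Q (v ++ w) <= sup A by apply: ub_le_sup; [case: hA|exists (v ++ w)].
  by move: hv; rewrite /Q fev_cat fev_sub ReB ReD fsq_cat; lra.
apply: fbnd_Re => w; rewrite -[X in X * _]addr0 -[X in _ * X]addr0.
apply/ler_addgt0Pr => e e0.
pose e' := e / d; have e'0 : 0 < e' by rewrite divr_gt0.
have s0 : 0 < flen w + e' by rewrite ltr_wpDl ?flen_ge0.
(* The best scaling is d / |w|; the summand e' covers the case |w| = 0. *)
pose t := d / (flen w + e'); have t0 : 0 < t by rewrite divr_gt0.
have := step (fscale (cR t) w); rewrite fev_scale cRJ ReM Re_cR Im_cR mul0r subr0 fsq_scale.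
rewrite nm_cR0 ?(ltW t0) // -flen_sqr -exprMn.
have tw : t * flen w <= d.
  rewrite /t mulrAC ler_pdivrMr // ler_wpM2l ?(ltW d0) // lerDl ltW //.
have tw0 : 0 <= t * flen w by rewrite mulr_ge0 ?flen_ge0 ?ltW.
have : (t * flen w) ^+ 2 <= d ^+ 2 by rewrite lerXn2r ?nnegrE // ltW.
move=> h1 h2.
have : t * complex.Re (fev (fun j => F j - fcomb v j) w) <= t * (d * (flen w + e')).
  rewrite (_ : t * (d * (flen w + e')) = d ^+ 2); first by lra.
  by rewrite /t; field; rewrite gt_eqF.
rewrite ler_pM2l // => /le_trans; apply.
by rewrite mulrDr !addr0 lerD2l /e' mulrC divfK // gt_eqF.
Qed.

Lemma flen_le w (c : R) : 0 <= c -> fsq w <= c * flen w -> flen w <= c.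
Proof.
move=> c0; rewrite -flen_sqr; have [->//|w0] := eqVneq (flen w) 0.
by rewrite expr2 ler_pM2r // lt_def w0 flen_ge0.
Qed.

Lemma flen_cat_sub u v d d' F : 0 <= d -> 0 <= d' ->
  fbnd (fun j => F j - fcomb u j) d -> fbnd (fun j => F j - fcomb v j) d' ->
  flen (u ++ fscale (-1) v) <= d + d'.
Proof.
move=> d0 d'0 hu hv; set w := u ++ _; apply: flen_le; first by rewrite addr_ge0.
have := fsqE w; rewrite (@eq_fev _ (fun j => (F j - fcomb v j) - (F j - fcomb u j))).
  rewrite fev_sub => /(congr1 (@complex.Re R)); rewrite Re_cR => <-.
  apply: le_trans (Re_le_nm _) _; apply: le_trans (nmB _ _) _.
  by rewrite mulrDl addrC lerD.
by move=> j; rewrite fcomb_cat fcomb_scale; ring.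
Qed.

Lemma flen_near v d F C : 0 <= d -> 0 <= C ->
  fbnd F C -> fbnd (fun j => F j - fcomb v j) d -> flen v <= C + d.
Proof.
move=> d0 C0 hF hv; apply: flen_le; first by rewrite addr_ge0.
rewrite -[fsq v]Re_cR -fsqE (@eq_fev _ (fun j => F j - (F j - fcomb v j))).
  rewrite fev_sub; apply: le_trans (Re_le_nm _) _; apply: le_trans (nmB _ _) _.
  by rewrite mulrDl lerD.
by move=> j; rewrite opprB addrC subrK.
Qed.

Definition fbounded (F : J -> R[i]) := exists2 C : R, 0 <= C & fbnd F C.

Lemma fbounded_lin a F G : fbounded F -> fbounded G -> fbounded (fun j => a * F j + G j).
Proof.
move=> [C C0 hF] [D D0 hG]; exists (nm a * C + D); first by rewrite addr_ge0 // mulr_ge0 ?nm_ge0.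
move=> v; rewrite fev_lin; apply: le_trans (nmD _ _) _; rewrite mulrDl lerD //.
by rewrite nmM -mulrA ler_wpM2l ?nm_ge0.
Qed.

Lemma fbounded0 : fbounded (fun=> 0).
Proof.
by exists 0 => // v; rewrite /fev big1 ?nm0 ?mul0r // => p _; rewrite mulr0.
Qed.

Lemma fbounded_fcomb v : fbounded (fcomb v).
Proof. by exists (flen v); [exact: flen_ge0|exact: fcomb_bnd]. Qed.

(** Two approximations of G with errors d and d' change the value of F by at most [C * (d + d')], so
    the values are Cauchy. The limit is characterized by its distance to the value at every
    approximation, which frees [fip] from the chosen sequence. *)
Lemma ip_exists F G : fbounded F -> fbounded G ->
  exists l, forall C d v, 0 <= C -> 0 <= d -> fbnd F C ->
    fbnd (fun j => G j - fcomb v j) d -> nm (l - fev F v) <= C * d.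
Proof.
move=> [CF CF0 hF] [CG CG0 hG].
have /choice [u hu] n : exists v, fbnd (fun j => G j - fcomb v j) (1 / 2 ^+ n).
  by apply: (fbnd_approx CG0 hG); rewrite divr_gt0 // exprn_gt0.
have p0 n : 0 <= 1 / 2 ^+ n :> R by rewrite divr_ge0 // exprn_ge0.
have dist C v w d d' : 0 <= C -> 0 <= d -> 0 <= d' -> fbnd F C ->
    fbnd (fun j => G j - fcomb v j) d -> fbnd (fun j => G j - fcomb w j) d' ->
    nm (fev F v - fev F w) <= C * (d + d').
  move=> C0 d0 d'0 hC hv hw.
  have -> : fev F v - fev F w = fev F (v ++ fscale (-1) w).
    by rewrite fev_cat fev_scale rmorphN /= conjC1 mulN1r.
  apply: le_trans (hC _) _; rewrite ler_wpM2l //; exact: flen_cat_sub hv hw.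
have [|l hl] := @cauchyC_cvg R (fun n => fev F (u n)).
  apply: (@geo_cauchy _ _ _ (2 * CF)) => n.
  apply: le_trans (dist _ _ _ _ _ CF0 (p0 _) (p0 _) hF (hu _) (hu _)) _.
  rewrite exprS.
  rewrite (_ : CF * (1 / (2 * 2 ^+ n) + 1 / 2 ^+ n) = 3 / 2 * CF / 2 ^+ n); last first.
    by field; rewrite gt_eqF // exprn_gt0.
  by rewrite ler_wpM2r // ler_wpM2r //; lra.
exists l => C d v C0 d0 hC hv; apply/ler_addgt0Pr => e e0.
have [N hN] := hl _ (half_lt e0); have [N' hN'] := geo_small C (half_lt e0).
have h1 := hN _ (leq_maxl N N'); have h2 := hN' _ (leq_maxr N N').
apply: le_trans (nm_tri _ (fev F (u (maxn N N'))) _) _.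
have := dist _ _ _ _ _ C0 (p0 _) d0 hC (hu (maxn N N')) hv.
rewrite mulrDr mulrA mulr1; lra.
Qed.

Definition fip F G : R[i] := get [set l | forall C d v, 0 <= C -> 0 <= d -> fbnd F C ->
    fbnd (fun j => G j - fcomb v j) d -> nm (l - fev F v) <= C * d].

Lemma fipP F G C d v : fbounded F -> fbounded G -> 0 <= C -> 0 <= d -> fbnd F C ->
  fbnd (fun j => G j - fcomb v j) d -> nm (fip F G - fev F v) <= C * d.
Proof.
move=> bF bG; have [l hl] := ip_exists bF bG.
move=> C0 d0 hC hv; have h := @getPex _ [set l | forall C d v, 0 <= C -> 0 <= d -> fbnd F C ->
    fbnd (fun j => G j - fcomb v j) d -> nm (l - fev F v) <= C * d] (ex_intro _ l hl).
exact: h.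
Qed.

Lemma fip_comb F v : fbounded F -> fip F (fcomb v) = fev F v.
Proof.
move=> bF; have [C C0 hC] := bF; apply/eqP; rewrite -subr_eq0; apply/eqP/nm_eq0.
apply/eqP; rewrite eq_le nm_ge0 andbT -(mulr0 C).
apply: fipP => //; first exact: fbounded_fcomb.
by move=> w; rewrite fev_sub subrr nm0 mul0r.
Qed.

Lemma fapprox F : fbounded F -> forall d, 0 < d ->
  exists v, fbnd (fun j => F j - fcomb v j) d.
Proof. by move=> [C C0 hC] d d0; exact: fbnd_approx hC d0. Qed.

Lemma fip_lin a F G K : fbounded F -> fbounded G -> fbounded K ->
  fip (fun j => a * F j + G j) K = a * fip F K + fip G K.
Proof.
move=> bF bG bK; have bS := fbounded_lin a bF bG.
have [C C0 hC] := bF; have [D D0 hD] := bG; have [E E0 hE] := bS.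
apply/eqP; rewrite -subr_eq0; apply/eqP/nm_le_eq0 => e e0.
pose M := E + nm a * C + D + 1.
have aC : 0 <= nm a * C by rewrite mulr_ge0 ?nm_ge0.
have M0 : 0 < M by rewrite /M; lra.
have d0 : 0 < e / M by rewrite divr_gt0.
have [v hv] := fapprox bK d0; have d0' := ltW d0.
have h1 := fipP bS bK E0 d0' hE hv; have h2 := fipP bF bK C0 d0' hC hv.
have h3 := fipP bG bK D0 d0' hD hv; rewrite fev_lin in h1.
set X := fip _ _ in h1 *; set A := fip F K in h2 *; set B := fip G K in h3 *.
have -> : X - (a * A + B) = (X - (a * fev F v + fev G v)) - a * (A - fev F v) - (B - fev G v).
  by ring.
apply: le_trans (nmB _ _) _; apply: le_trans (lerD (nmB _ _) (lexx _)) _.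
rewrite nmM.
have h4 : nm a * nm (A - fev F v) <= nm a * (C * (e / M)) by rewrite ler_wpM2l ?nm_ge0.
have : M * (e / M) = e by field; rewrite gt_eqF.
rewrite {1}/M; move: (e / M) h1 h3 h4 d0 => q; lra.
Qed.

Lemma fip_approx F G u v C D d : fbounded F -> fbounded G -> 0 <= C -> 0 <= D -> 0 <= d ->
  fbnd F C -> fbnd G D ->
  fbnd (fun j => F j - fcomb u j) d -> fbnd (fun j => G j - fcomb v j) d ->
  nm (fip F G - fev (fcomb u) v) <= C * d + d * (D + d).
Proof.
move=> bF bG C0 D0 d0 hC hD hu hv.
apply: le_trans (nm_tri _ (fev F v) _) _; apply: lerD; first exact: fipP.
rewrite -fev_sub; apply: le_trans (hu _) _; rewrite ler_wpM2l //.
exact: flen_near hD hv.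
Qed.

Lemma quad_small (C D e : R) : 0 <= C -> 0 <= D -> 0 < e ->
  exists2 d, 0 < d & C * d + d * (D + d) <= e.
Proof.
move=> C0 D0 e0; exists (Num.min 1 (e / (C + D + 1))).
  by rewrite lt_min ltr01 divr_gt0 //; lra.
set d := Num.min _ _.
have q0 : 0 < C + D + 1 by lra.
have d0 : 0 < d by rewrite lt_min ltr01 divr_gt0.
have d1 : d <= 1 by rewrite ge_min lexx.
have : d * (C + D + 1) <= e by rewrite -ler_pdivlMr // ge_min lexx orbT.
nra.
Qed.

Lemma fip_herm F G : fbounded F -> fbounded G -> fip G F = (fip F G)^*.
Proof.
move=> bF bG; have [C C0 hC] := bF; have [D D0 hD] := bG.
apply/eqP; rewrite -subr_eq0; apply/eqP/nm_le_eq0 => e e0.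
have [d d0 hd] := quad_small C0 D0 (half_lt e0).
have [d' d'0 hd'] := quad_small D0 C0 (half_lt e0).
have m0 : 0 < Num.min d d' by rewrite lt_min d0.
have [u hu] := fapprox bF m0; have [v hv] := fapprox bG m0.
have h1 := fip_approx bF bG C0 D0 (ltW m0) hC hD hu hv.
have h2 := fip_approx bG bF D0 C0 (ltW m0) hD hC hv hu.
apply: le_trans (nm_tri _ (fev (fcomb v) u) _) _.
rewrite (nmC _ (_^*)) [X in _ + nm (_ - X)]fcomb_herm -rmorphB nmJ.
have md : Num.min d d' <= d by rewrite ge_min lexx.
have md' : Num.min d d' <= d' by rewrite ge_min lexx orbT.
move: m0 md md' h1 h2; set m := Num.min d d' => m0 md md' h1 h2.
have : C * m + m * (D + m) <= C * d + d * (D + d) by nra.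
have : D * m + m * (C + m) <= D * d' + d' * (C + d') by nra.
lra.
Qed.

Lemma fip_pos F : fbounded F -> 0 <= fip F F.
Proof.
move=> bF; have im : complex.Im (fip F F) = 0.
  by have /(congr1 (@complex.Im R)) := fip_herm bF bF; rewrite ImJ; lra.
rewrite lecE im eqxx /=; apply/ler_addgt0Pr => e e0.
have [C C0 hC] := bF; have [d d0 hd] := quad_small C0 C0 e0.
have [u hu] := fapprox bF d0.
have h1 := fip_approx bF bF C0 C0 (ltW d0) hC hC hu hu.
rewrite fsqE nmC in h1; have := le_trans (Re_le_nm _) h1.
by rewrite ReB Re_cR; have := fsq_ge0 u; lra.
Qed.

(** Together with [fip_le] this says that the square root of [fip F F] is the least constant in
    [fbnd], so norm estimates and bounds on [fev] can be exchanged. *)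
Lemma fbnd_sqrt F (C : R) : fbounded F -> complex.Re (fip F F) <= C ^+ 2 -> 0 <= C -> fbnd F C.
Proof.
move=> bF hq C0 w; have [D D0 hD] := bF.
rewrite -[X in X * _]addr0; apply/ler_addgt0Pr => e e0.
pose k := e / (2 * (flen w + 1)).
have k0 : 0 < k by rewrite divr_gt0 // mulr_gt0 // ltr_wpDl ?flen_ge0.
have [d d0 hd] := quad_small D0 D0 (exprn_gt0 2 k0).
pose m := Num.min k d.
have m0 : 0 < m by rewrite lt_min k0.
have mk : m <= k by rewrite ge_min lexx.
have md : m <= d by rewrite ge_min lexx orbT.
have [u hu] := fapprox bF m0.
have h1 := fip_approx bF bF D0 D0 (ltW m0) hD hD hu hu.
have h2 : fsq u <= C ^+ 2 + k ^+ 2.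
  rewrite fsqE nmC in h1; have := le_trans (Re_le_nm _) h1.
  rewrite ReB Re_cR => h3.
  have : D * m + m * (D + m) <= D * d + d * (D + d) by nra.
  lra.
have h3 : flen u <= C + k.
  rewrite -(@ler_pXn2r _ 2) ?nnegrE ?flen_ge0 ?addr_ge0 ?(ltW k0) // flen_sqr.
  by have := mulr_ge0 C0 (ltW k0); rewrite sqrrD; lra.
have -> : fev F w = fev (fun j => F j - fcomb u j) w + fev (fcomb u) w.
  by rewrite fev_sub subrK.
apply: le_trans (nmD _ _) _.
apply: le_trans (lerD (hu w) (fcomb_bnd u w)) _.
have w0 := flen_ge0 w.
have h4 : m * flen w + flen u * flen w <= k * flen w + (C + k) * flen w.
  by rewrite lerD // ler_wpM2r.
apply: le_trans h4 _.
have kw : 2 * (k * (flen w + 1)) = e by rewrite /k; field; rewrite gt_eqF // ltr_wpDl.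
nra.
Qed.

Lemma fip_le F (C : R) : 0 <= C -> fbnd F C -> complex.Re (fip F F) <= C ^+ 2.
Proof.
move=> C0 hC; have bF : fbounded F by exists C.
apply/ler_addgt0Pr => e e0.
have [d d0 hd] := quad_small (addr_ge0 C0 C0) (addr_ge0 C0 C0) (half_lt e0).
have [u hu] := fapprox bF d0.
have h1 := fip_approx bF bF C0 C0 (ltW d0) hC hC hu hu.
have h2 := flen_near (ltW d0) C0 hC hu.
rewrite fsqE in h1; have := le_trans (Re_le_nm _) h1; rewrite ReB Re_cR -flen_sqr.
have : flen u ^+ 2 <= (C + d) ^+ 2 by rewrite lerXn2r ?nnegrE ?flen_ge0 ?addr_ge0 ?(ltW d0).
have Cd : 0 <= C * d by rewrite mulr_ge0 // ltW.
by rewrite sqrrD mulr2n; move: hd; lra.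
Qed.

End GramSpace.

(** * The vector space of bounded functions *)

Section BoundedFunctions.
Variables (R : realType) (J : Type) (g : J -> J -> R[i]).

Definition bfun : {pred (J -> (R[i])^o)} := fun F => `[< fbounded g F >].

Lemma bfunP F : reflect (fbounded g F) (F \in bfun).
Proof. exact: asboolP. Qed.

Lemma bfun_submod : submod_closed bfun.
Proof.
split; first by apply/bfunP; exact: fbounded0.
by move=> a F G /bfunP bF /bfunP bG; apply/bfunP; exact: (fbounded_lin a bF bG).
Qed.

HB.instance Definition _ := GRing.isSubmodClosed.Build R[i] (J -> (R[i])^o) bfun bfun_submod.

Record bfun_sub := BFun { bfun_val :> J -> (R[i])^o; bfun_valP : bfun_val \in bfun }.
HB.instance Definition _ := [isSub for bfun_val].
HB.instance Definition _ := [Choice of bfun_sub by <:].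
HB.instance Definition _ := [SubChoice_isSubLmodule of bfun_sub by <:].

Lemma bfun_bounded (F : bfun_sub) : fbounded g F.
Proof. exact/bfunP/bfun_valP. Qed.

Lemma bfun_lin a (F G : bfun_sub) : (a *: F + G : bfun_sub) = (fun j => a * F j + G j) :> (J -> (R[i])^o).
Proof. by apply/funext => j. Qed.

Lemma bfun_eq (F G : bfun_sub) : F =1 G -> F = G.
Proof. by move=> FG; apply: val_inj; apply/funext. Qed.

End BoundedFunctions.

(** * Kolmogorov factorization of a positive Gram matrix *)

Section Kolmogorov.
Variables (R : realType) (J : Type) (g : J -> J -> R[i]).
Hypothesis g_herm : forall i j, g j i = (g i j)^*.
Hypothesis g_pos : forall v, 0 <= fev (fcomb g v) v.
Local Notation V := (bfun_sub g).

Definition bform (F G : V) : R[i] := fip g F G.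

Lemma bform_lin a (F G K : V) : bform (a *: F + G) K = a * bform F K + bform G K.
Proof. by rewrite /bform bfun_lin fip_lin //; apply: bfun_bounded. Qed.

Lemma bform_herm (F G : V) : bform G F = (bform F G)^*.
Proof. by apply: fip_herm => //; apply: bfun_bounded. Qed.

Lemma fev1 (F : J -> R[i]) j : fev F [:: (1, j)] = F j :> R[i].
Proof. by rewrite /fev big_seq1 conjC1 mul1r. Qed.

Lemma bform_pos (F : V) : F != 0 -> 0 < bform F F.
Proof.
move=> F0; rewrite lt_def fip_pos //; last exact: bfun_bounded.
rewrite andbT; apply: contra_neqN F0 => /eqP h.
have hb := fbnd_sqrt g_herm g_pos (bfun_bounded F) (C := 0).
apply: bfun_eq => j; apply: nm_eq0; apply/eqP; rewrite eq_le nm_ge0 andbT.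
by have := hb _ (lexx _) [:: (1, j)]; rewrite fev1 mul0r; apply; rewrite -/(bform F F) h expr0n.
Qed.

(** Evaluation at j is [fev] on a one-element list, hence bounded, so pointwise limits exist; the
    uniform bounds of the Cauchy condition then pass to the limit function. *)
Lemma bform_complete (u : nat -> V) :
  (forall e : R, 0 < e -> exists N, forall m n, (N <= m)%N -> (N <= n)%N ->
     complex.Re (bform (u m - u n) (u m - u n)) < e) ->
  exists l : V, forall e : R, 0 < e -> exists N, forall n, (N <= n)%N ->
     complex.Re (bform (l - u n) (l - u n)) < e.
Proof.
move=> uc.
have bnd e : 0 < e -> exists N, forall m n, (N <= m)%N -> (N <= n)%N ->
    fbnd g (fun j => u m j - u n j) e.
  move=> e0; have [N hN] := uc _ (exprn_gt0 2 e0); exists N => m n hm hn.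
  have := fbnd_sqrt g_herm g_pos (bfun_bounded (u m - u n)) (ltW (hN m n hm hn)) (ltW e0).
  by move=> h v; apply: le_trans (h v); rewrite /fev le_eqVlt; apply/orP; left.
have /choice [L hL] j : exists l : R[i], forall e : R, 0 < e -> exists N, forall n, (N <= n)%N -> nm (l - u n j) < e.
  apply: cauchyC_cvg => e e0; pose k := flen g [:: (1, j)] + 1.
  have k0 : 0 < k by rewrite ltr_wpDl ?flen_ge0.
  have [N hN] := bnd (e / k) (divr_gt0 e0 k0); exists N => m n hm hn.
  have := hN m n hm hn [:: (1, j)]; rewrite fev1 => /le_lt_trans; apply.
  by rewrite mulrAC ltr_pdivrMr // ltr_pM2l // /k ltrDl.
have fevlim v (e : R) : 0 < e -> exists N, forall n, (N <= n)%N ->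
    nm (fev (fun j => L j - u n j) v) < e.
  elim: v e => [|p v IH] e e0; first by exists 0%N => n _; rewrite /fev big_nil nm0.
  have k0 : 0 < nm p.1 + 1 by rewrite ltr_wpDl ?nm_ge0.
  have [N hN] := IH _ (half_lt e0); have [N' hN'] := hL p.2 _ (divr_gt0 (half_lt e0) k0).
  exists (maxn N N') => n; rewrite geq_max => /andP[/hN h1 /hN' h2].
  rewrite /fev big_cons; apply: le_lt_trans (nmD _ _) _; rewrite nmM nmJ.
  move: h2; rewrite ltr_pdivlMr // => h2; move: h1; rewrite /fev.
  have := nm_ge0 (L p.2 - u n p.2); nra.
have Lbnd e : 0 < e -> exists N, forall n, (N <= n)%N -> fbnd g (fun j => L j - u n j) e.
  move=> e0; have [N hN] := bnd e e0; exists N => n hn v.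
  apply/ler_addgt0Pr => d /(fevlim v)[N' hN'].
  have h1 := hN' _ (leq_maxr N N'); have h2 := hN _ n (leq_maxl N N') hn v.
  have -> : fev (fun j => L j - u n j) v =
      fev (fun j => L j - u (maxn N N') j) v + fev (fun j => u (maxn N N') j - u n j) v.
    by rewrite !fev_sub; ring.
  by apply: le_trans (nmD _ _) _; lra.
have LV : (L : J -> R[i]^o) \in bfun g.
  apply/bfunP; have [N hN] := Lbnd 1 ltr01; have := hN N (leqnn N) => h.
  have b1 : fbounded g (fun j => L j - u N j) by exists 1.
  have := fbounded_lin 1 b1 (bfun_bounded (u N)).
  by congr (fbounded g _); apply/funext => j; rewrite mul1r subrK.
exists (BFun LV) => e e0.
have s0 : 0 < Num.sqrt (e / 2) by rewrite sqrtr_gt0 divr_gt0.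
have [N hN] := Lbnd _ s0; exists N => n /hN h.
have e2 : e / 2 < e by lra.
apply: le_lt_trans e2; rewrite -[e / 2]sqr_sqrtr ?divr_ge0 ?(ltW e0) //.
apply: fip_le => //; exact: ltW.
Qed.

Definition gram_form := CompleteForm bform_lin bform_herm bform_pos bform_complete.
Definition gram_space : hilbertType R := form_space_of gram_form.

Lemma fcomb_in v : (fcomb g v : J -> R[i]^o) \in bfun g.
Proof. by apply/bfunP; exact: fbounded_fcomb. Qed.
Definition gram_vec (j : J) : gram_space := BFun (fcomb_in [:: (1, j)]).

Lemma gram_space_ip (F : gram_space) j : inner F (gram_vec j) = (F : V) j.
Proof.
rewrite -[RHS](fev1 (F : V)); apply: fip_comb => //; exact: bfun_bounded.
Qed.

Lemma gram_vec_ip i j : inner (gram_vec i) (gram_vec j) = g i j.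
Proof. by rewrite gram_space_ip /= /fcomb big_seq1 mul1r. Qed.

Lemma gram_vec_total : total gram_vec.
Proof.
by move=> F h; apply: bfun_eq => j; rewrite -gram_space_ip h.
Qed.

Lemma gram_realization : exists (H : hilbertType R) (e : J -> H),
  (forall i j, inner (e i) (e j) = g i j) /\ total e.
Proof.
by exists gram_space, gram_vec; split; [exact: gram_vec_ip|exact: gram_vec_total].
Qed.

End Kolmogorov.

(** * Existence of vector-valued reproducing kernel spaces *)

Section RKHS.
Variables (R : realType) (Y U : hilbertType R) (T : Type) (Omega : set T).
Variable K : T -> T -> Y * U -> Y * U.
Hypothesis K_herm : forall w z h k, Omega w -> Omega z ->
  dsum_inner (K w z h) k = (dsum_inner (K z w k) h)^*.
Hypothesis K_pos : positive_kernel Omega K.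

Hypothesis K_bnd : forall w, Omega w -> exists2 C : R, 0 <= C &
  forall h, nm (K w w h).1 <= C * (nm h.1 + nm h.2) /\
            nm (K w w h).2 <= C * (nm h.1 + nm h.2).

Lemma rkhs_exists : inhabited (rkhs Omega K).
Proof.
pose Om := {w : T | Omega w}.
pose g (i j : Om * (Y * U)) : R[i] := dsum_inner (K (sval j.1) (sval i.1) i.2) j.2.
(* Linearity of K in its vector follows from Hermitian symmetry, which moves this vector into a slot
   of the inner product. *)
have KD w z h h' k (a : R[i]) : Omega w -> Omega z ->
    dsum_inner (K w z (a *: h + h')) k = a * dsum_inner (K w z h) k + dsum_inner (K w z h') k.
  move=> Ow Oz; rewrite K_herm // -dsum_herm dsum_lin.
  by rewrite !(dsum_herm (K z w k)) -!K_herm.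
have g_herm i j : g j i = (g i j)^*.
  by rewrite /g K_herm //; [exact: (svalP i.1)|exact: (svalP j.1)].
have g_pos v : 0 <= fev (fcomb g v) v.
  case E : v => [|p0 v']; first by rewrite /fev big_nil.
  rewrite -E; have := @K_pos (size v) (fun k => sval (nth p0 v k).2.1)
      (fun k => (nth p0 v k).1 *: (nth p0 v k).2.2).
  rewrite /fev /fcomb (big_nth p0) big_mkord => h.
  have {}h := h (fun j => svalP (nth p0 v j).2.1); apply: le_trans h _.
  rewrite le_eqVlt; apply/orP; left; apply/eqP; apply: eq_bigr => j _.
  rewrite (big_nth p0) big_mkord mulr_sumr; apply: eq_bigr => k _; rewrite /g.
  set a := nth p0 v j; set b := nth p0 v k.
  rewrite -[b.1 *: b.2.2]addr0 KD; [|exact: (svalP a.2.1)|exact: (svalP b.2.1)].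
  have K0 : dsum_inner (K (sval a.2.1) (sval b.2.1) 0) (a.1 *: a.2.2) = 0.
    have := KD _ _ 0 0 (a.1 *: a.2.2) (-1) (svalP a.2.1) (svalP b.2.1).
    by rewrite scaler0 addr0 => ->; ring.
  rewrite K0 addr0 [X in _ * X]dsum_herm -[a.1 *: _]addr0 dsum_lin rmorphD rmorphM /= -dsum_herm.
  by rewrite /dsum_inner !ip0l addr0 conjC0 addr0; ring.
have [H [e' [e'_ip e'_tot]]] := gram_realization g_herm g_pos.
pose e (w : Om) (h : Y * U) : H := e' (w, h).
have e_ip w h w' h' : inner (e w h) (e w' h') = dsum_inner (K (sval w') (sval w) h) h'.
  exact: e'_ip.
have e_tot : forall x : H, (forall w h, inner x (e w h) = 0) -> x = 0.
  by move=> x h; apply: e'_tot => -[w k]; exact: h.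
have e_lin w a h h' : e w (a *: h + h') = a *: e w h + e w h'.
  apply/eqP; rewrite -subr_eq0; apply/eqP/e_tot => w' k.
  by rewrite ipBl ipDl ipZl !e_ip KD ?subrr //; apply: svalP.
have e_bnd w : exists2 C : R, 0 <= C & forall h, nm (e w h) <= C * (nm h.1 + nm h.2).
  have [C C0 hC] := K_bnd (svalP w); exists (Num.sqrt C); first exact: sqrtr_ge0.
  move=> h; have h0 : 0 <= nm h.1 + nm h.2 by rewrite addr_ge0 ?nm_ge0.
  rewrite -(@ler_pXn2r _ 2) ?nnegrE ?nm_ge0 ?mulr_ge0 ?sqrtr_ge0 //.
  rewrite exprMn sqr_sqrtr // -rip_nm /rip e_ip /dsum_inner ReD.
  have [h1 h2] := hC h.
  apply: le_trans (lerD (rip_CS _ _) (rip_CS _ _)) _.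
  have := ler_wpM2r (nm_ge0 h.1) h1; have := ler_wpM2r (nm_ge0 h.2) h2.
  by rewrite expr2; move=> a b; apply: le_trans (lerD b a) _; rewrite -mulrDr mulrA.
have pair_lin (a : R[i]) (p q : Y * U) : a *: p + q = (a *: p.1 + q.1, a *: p.2 + q.2).
  by [].
(* the value at [w] represents the functional [h |-> <e w h, x>] *)
have ev_ex (x : H) (w : Om) : exists y : Y * U, forall h, dsum_inner y h = inner x (e w h).
  have [C C0 hC] := e_bnd w.
  have [y1 h1] : exists v : Y, forall h, inner (e w (h, 0)) x = inner h v.
    apply: (@riesz _ _ _ (C * nm x)) => [a h h'|h].
      by rewrite -ipZl -ipDl -e_lin pair_lin /= scaler0 addr0.
    apply: le_trans (ip_CS _ _) _; rewrite mulrAC ler_wpM2r ?nm_ge0 //.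
    by apply: le_trans (hC _) _; rewrite /= nm0 addr0.
  have [y2 h2] : exists v : U, forall h, inner (e w (0, h)) x = inner h v.
    apply: (@riesz _ _ _ (C * nm x)) => [a h h'|h].
      by rewrite -ipZl -ipDl -e_lin pair_lin /= scaler0 addr0.
    apply: le_trans (ip_CS _ _) _; rewrite mulrAC ler_wpM2r ?nm_ge0 //.
    by apply: le_trans (hC _) _; rewrite /= nm0 add0r.
  exists (y1, y2) => -[k1 k2].
  have E : e w (k1, k2) = e w (k1, 0) + e w (0, k2).
    have := e_lin w 1 (k1, 0) (0, k2); rewrite pair_lin /= !scale1r addr0 add0r => ->.
    by [].
  by rewrite E ipDr (ipC (e w (k1, 0)) x) (ipC (e w (0, k2)) x) h1 h2 -!ipC.
have /choice [ev hev] (x : H) : exists f : Om -> Y * U, forall w h, dsum_inner (f w) h = inner x (e w h).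
  by have [f hf] := choice (ev_ex x); exists f.
(* [rk_fun] is a function on all of T; outside Omega the value 0 is a placeholder. *)
pose rf (x : H) (t : T) : Y * U :=
  if pselect (Omega t) is left Ot then ev x (exist _ t Ot) else 0.
have rfE x t (Ot : Omega t) : rf x t = ev x (exist _ t Ot).
  rewrite /rf; case: pselect => // Ot'; congr (ev x _); exact: eq_exist.
have dsum_ext (p q : Y * U) : (forall h, dsum_inner p h = dsum_inner q h) -> p = q.
  move=> h; apply/eqP; rewrite -subr_eq0; apply: contraT => /dsum_pos.
  have := dsum_lin (-1) q p (p - q); rewrite scaleN1r [- q + p]addrC h mulN1r addNr => ->.
  by rewrite ltxx.
constructor; exists H rf.
- move=> t Ot a x x'; rewrite !(rfE _ _ Ot); apply: dsum_ext => h.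
  by rewrite dsum_lin !hev ipDl ipZl.
- move=> x h; apply: e_tot => -[w Ow] k; rewrite -hev -rfE h //.
  by rewrite /dsum_inner !ip0l addr0.
- move=> t Ot h; exists (e (exist _ t Ot) h); split => [t' Ot'|x].
    by rewrite (rfE _ _ Ot'); apply: dsum_ext => k; rewrite hev e_ip.
  by rewrite (rfE _ _ Ot) hev.
Qed.

End RKHS.

(** * Residues for integrals over vertical lines *)

Section ComplexDifferentiability.
Variable R : realType.
Implicit Types (f g h : R[i] -> R[i]) (z w : R[i]).

Definition ccont f z := forall e : R, 0 < e ->
  exists2 d : R, 0 < d & forall w, nm (w - z) < d -> nm (f w - f z) < e.

Lemma ccontP f z : ccont f z <-> (f : (R[i])^o -> (R[i])^o) @ (z : (R[i])^o) --> (f z : (R[i])^o).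
Proof.
have P := @cvg_nm R (R[i])^o (R[i])^o (nbhs (z : (R[i])^o)) _ f (f z).
split=> [h|/P h].
  apply/P => e /h[d d0 hd]; apply/nbhs_nm; exists d => // w.
  by rewrite nmC => /hd; rewrite nmC.
move=> e e0; have /nbhs_nm[d d0 hd] := h e e0; exists d => // w.
by rewrite nmC => /hd; rewrite nmC.
Qed.

(* Caratheodory's form of differentiability. *)
Definition cdiff f z := exists2 h, ccont h z &
  exists2 d : R, 0 < d & forall w, nm (w - z) < d -> f w = f z + h w * (w - z).

Lemma ccont_cst c z : ccont (fun=> c) z.
Proof. by move=> e e0; exists 1 => // w _; rewrite subrr nm0. Qed.
Lemma ccont_id z : ccont id z.
Proof. by move=> e e0; exists e. Qed.
Lemma ccontD f g z : ccont f z -> ccont g z -> ccont (fun w => f w + g w) z.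
Proof. by move=> /ccontP hf /ccontP hg; apply/ccontP; exact: (cvgD hf hg). Qed.
Lemma ccontM f g z : ccont f z -> ccont g z -> ccont (fun w => f w * g w) z.
Proof. by move=> /ccontP hf /ccontP hg; apply/ccontP; exact: (cvgM hf hg). Qed.
Lemma ccontV f z : f z != 0 -> ccont f z -> ccont (fun w => (f w)^-1) z.
Proof. by move=> f0 /ccontP hf; apply/ccontP; exact: (cvgV f0 hf). Qed.

Lemma near_and (P Q : R[i] -> Prop) z :
  (exists2 d : R, 0 < d & forall w, nm (w - z) < d -> P w) ->
  (exists2 d : R, 0 < d & forall w, nm (w - z) < d -> Q w) ->
  exists2 d : R, 0 < d & forall w, nm (w - z) < d -> P w /\ Q w.
Proof.
move=> [d d0 hd] [d' d'0 hd']; exists (Num.min d d'); first by rewrite lt_min d0.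
by move=> w; rewrite lt_min => /andP[/hd ? /hd'].
Qed.

Lemma ccont_near f g z : (exists2 d : R, 0 < d & forall w, nm (w - z) < d -> f w = g w) ->
  ccont f z -> ccont g z.
Proof.
move=> [d d0 hd] hf e /hf[d' d'0 hd'].
exists (Num.min d d'); first by rewrite lt_min d0.
move=> w; rewrite lt_min => /andP[/hd <- /hd']; rewrite -hd // subrr nm0 //.
Qed.

Lemma cdiff_cont f z : cdiff f z -> ccont f z.
Proof.
move=> [h hc [d d0 hd]]; apply: (@ccont_near (fun w => f z + h w * (w - z))).
  by exists d => // w /hd ->.
apply: ccontD; first exact: ccont_cst.
by apply: ccontM => //; apply: ccontD; [exact: ccont_id|exact: ccont_cst].
Qed.

Lemma cdiff_cst c z : cdiff (fun=> c) z.
Proof. by exists (fun=> 0); [exact: ccont_cst|exists 1 => // w _; ring]. Qed.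
Lemma cdiff_id z : cdiff id z.
Proof. by exists (fun=> 1); [exact: ccont_cst|exists 1 => // w _; ring]. Qed.
Lemma cdiffD f g z : cdiff f z -> cdiff g z -> cdiff (fun w => f w + g w) z.
Proof.
move=> [h hc hd] [k kc kd]; exists (fun w => h w + k w); first exact: ccontD.
have [d d0 H] := near_and hd kd; exists d => // w /H[-> ->]; ring.
Qed.
Lemma cdiffM f g z : cdiff f z -> cdiff g z -> cdiff (fun w => f w * g w) z.
Proof.
move=> df dg; have gc := cdiff_cont dg; move: df dg => [h hc hd] [k kc kd].
exists (fun w => h w * g w + f z * k w).
  by apply: ccontD; apply: ccontM => //; exact: ccont_cst.
have [d d0 H] := near_and hd kd; exists d => // w /H[-> ->]; ring.
Qed.
Lemma ccont_neq0 f z : f z != 0 -> ccont f z ->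
  exists2 d : R, 0 < d & forall w, nm (w - z) < d -> f w != 0.
Proof.
move=> f0 fc; have n0 : 0 < nm (f z) by rewrite nm_gt0.
have [d d0 hd] := fc _ n0; exists d => // w /hd h; apply: contraTneq h => ->.
by rewrite sub0r nmN ltxx.
Qed.
Lemma cdiffV f z : f z != 0 -> cdiff f z -> cdiff (fun w => (f w)^-1) z.
Proof.
move=> f0 df; have fc := cdiff_cont df; move: df => [h hc hd].
exists (fun w => - h w * ((f w)^-1 * (f z)^-1)).
  apply: ccontM; last by apply: ccontM; [exact: ccontV|exact: ccont_cst].
  by apply: (@ccont_near (fun w => (-1) * h w)); [exists 1 => // w _; ring|apply: ccontM => //; exact: ccont_cst].
have [d d0 H] := near_and hd (ccont_neq0 f0 fc); exists d => // w /H[E fw0].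
have E' : h w * (w - z) = f w - f z by rewrite E addrAC subrr add0r.
have -> : - h w * ((f w)^-1 * (f z)^-1) * (w - z) = - (h w * (w - z)) * ((f w)^-1 * (f z)^-1) by ring.
by rewrite E'; field; rewrite f0 fw0.
Qed.
Lemma cdiff_bounded f z : cdiff f z -> exists2 M : R, 0 <= M &
  exists2 d : R, 0 < d & forall w, nm (w - z) < d -> nm (f w) <= M.
Proof.
move=> /cdiff_cont /(_ 1 ltr01)[d d0 hd]; exists (1 + nm (f z)); first by rewrite addr_ge0 ?nm_ge0.
exists d => // w /hd h; apply: le_trans (nm_distl _ (f z)) _; rewrite lerD2r; exact: ltW.
Qed.
End ComplexDifferentiability.

(** * Trapezoidal sums and Goursat's theorem *)

Section TrapezoidSums.
Variable R : realType.
Implicit Types (f g h : R[i] -> R[i]) (a b c z w : R[i]) (n : nat).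

Definition mid a b : R[i] := (a + b) / 2.

(* Trapezoidal sums on dyadic subdivisions of the segment from a to b; unlike
   Riemann sums they are exact on affine functions and exactly antisymmetric. *)
Fixpoint trap n g a b : R[i] :=
  if n is n'.+1 then trap n' g a (mid a b) + trap n' g (mid a b) b
  else (b - a) * ((g a + g b) / 2).

(** Dyadic sums evaluate g only at iterated midpoints, so this is the form of convexity that fits
    them. *)
Definition midconvex (D : set R[i]) := forall a b, D a -> D b -> D (mid a b).

Lemma midC a b : mid a b = mid b a. Proof. by rewrite /mid addrC. Qed.

Lemma trapD n f g a b : trap n (fun z => f z + g z) a b = trap n f a b + trap n g a b.
Proof. by elim: n a b => [|n IH] a b /=; rewrite ?IH; ring. Qed.
Lemma trapZ n u f a b : trap n (fun z => u * f z) a b = u * trap n f a b.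
Proof. by elim: n a b => [|n IH] a b /=; rewrite ?IH; ring. Qed.
Lemma trap_rev n g a b : trap n g b a = - trap n g a b.
Proof.
elim: n a b => [|n IH] a b /=; first by ring.
by rewrite (midC b a) (IH (mid a b) b) (IH a (mid a b)); ring.
Qed.
Lemma trap_affine n u v a b :
  trap n (fun z => u * z + v) a b = u * (b ^+ 2 - a ^+ 2) / 2 + v * (b - a).
Proof. by elim: n a b => [|n IH] a b /=; rewrite ?IH /mid; field. Qed.
Lemma trap_ext n (D : set R[i]) f g a b : midconvex D -> D a -> D b ->
  (forall z, D z -> f z = g z) -> trap n f a b = trap n g a b.
Proof.
move=> mD + + fg; elim: n a b => [|n IH] a b Da Db /=; first by rewrite !fg.
by rewrite !IH //; exact: mD.
Qed.
Lemma nm2 : nm (2 : R[i]) = 2.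
Proof. by rewrite (_ : 2 = cR 2) ?nm_cR0 // /cR rmorphMn rmorph1. Qed.
Lemma nm_half a : nm (a / 2) = nm a / 2. Proof. by rewrite nmM nmV nm2. Qed.
Lemma trap_bound n (D : set R[i]) g a b (M : R) : midconvex D -> D a -> D b ->
  (forall z, D z -> nm (g z) <= M) -> nm (trap n g a b) <= M * nm (b - a).
Proof.
move=> mD + + gM; elim: n a b => [|n IH] a b Da Db /=.
  rewrite nmM mulrC ler_wpM2r ?nm_ge0 // nm_half ler_pdivrMr //.
  by apply: le_trans (nmD _ _) _; have := gM a Da; have := gM b Db; lra.
apply: le_trans (nmD _ _) _.
apply: le_trans (lerD (IH _ _ Da (mD _ _ Da Db)) (IH _ _ (mD _ _ Da Db) Db)) _.
have -> : mid a b - a = (b - a) / 2 by rewrite /mid; field.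
have -> : b - mid a b = (b - a) / 2 by rewrite /mid; field.
by rewrite nm_half; lra.
Qed.

Definition tri n g a b c := trap n g a b + trap n g b c + trap n g c a.

Lemma tri_split n g a b c : tri n.+1 g a b c =
  tri n g a (mid a b) (mid c a) + tri n g (mid a b) b (mid b c) +
  tri n g (mid c a) (mid b c) c + tri n g (mid a b) (mid b c) (mid c a).
Proof.
rewrite /tri /= (trap_rev n g (mid c a) (mid a b)) (trap_rev n g (mid b c) (mid c a)).
by rewrite (trap_rev n g (mid a b) (mid b c)); ring.
Qed.

Definition vanishing (s : nat -> R[i]) := forall e : R, 0 < e ->
  exists N, forall n, (N <= n)%N -> nm (s n) <= e.

Lemma vanishingD (s t : nat -> R[i]) : vanishing s -> vanishing t -> vanishing (fun n => s n + t n).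
Proof.
move=> hs ht e e0; have [N hN] := hs _ (half_lt e0); have [N' hN'] := ht _ (half_lt e0).
exists (maxn N N') => n; rewrite geq_max => /andP[/hN h1 /hN' h2].
by apply: le_trans (nmD _ _) _; lra.
Qed.

Definition seq_closed (D : set R[i]) := forall (u : nat -> R[i]) l, (forall n, D (u n)) ->
  (forall e : R, 0 < e -> exists N, forall n, (N <= n)%N -> nm (l - u n) < e) -> D l.

Lemma ball_midconvex (p : R[i]) (r : R) : midconvex [set z | nm (z - p) <= r].
Proof.
move=> a b /= ha hb; have -> : mid a b - p = ((a - p) + (b - p)) / 2 by rewrite /mid; field.
by rewrite nm_half ler_pdivrMr //; apply: le_trans (nmD _ _) _; lra.
Qed.

(** If the sums around a triangle exceed e for arbitrarily large n, those around one of its four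
    parts exceed e / 4 for arbitrarily large n. Near the common point of the nested triangles g is
    affine up to a small relative error, and the sums of an affine function around a triangle are
    exactly 0. *)
Lemma goursat (D : set R[i]) g a b c : midconvex D -> seq_closed D ->
  (forall z, D z -> cdiff g z) -> D a -> D b -> D c -> vanishing (fun n => tri n g a b c).
Proof.
move=> mD cD dg Da Db Dc; apply: contrapT => nv.
pose bad (e : R) (t : R[i] * R[i] * R[i]) :=
  forall N, exists2 n, (N <= n)%N & e < nm (tri n g t.1.1 t.1.2 t.2).
have [e e0 bade] : exists2 e, 0 < e & bad e (a, b, c).
  apply: contrapT => h; apply: nv => e e0.
  apply: contrapT => h'; apply: h; exists e => // N; apply: contrapT => h''.
  apply: h'; exists N => n hn; rewrite leNgt; apply/negP => hlt; apply: h''.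
  by exists n.
have nbad e' t : ~ bad e' t -> exists N, forall n, (N <= n)%N -> nm (tri n g t.1.1 t.1.2 t.2) <= e'.
  move=> h; apply: contrapT => h'; apply: h => N; apply: contrapT => h''; apply: h'.
  exists N => n hn; rewrite leNgt; apply/negP => hlt; apply: h''; by exists n.
pose M := nm (a - b) + nm (b - c) + nm (c - a).
pose inv k (t : R[i] * R[i] * R[i]) :=
  [/\ D t.1.1 /\ D t.1.2, D t.2, nm (t.1.1 - t.1.2) <= M / 2 ^+ k,
      nm (t.1.2 - t.2) <= M / 2 ^+ k /\ nm (t.2 - t.1.1) <= M / 2 ^+ k & bad (e / 4 ^+ k) t].
have inv0 : inv 0%N (a, b, c).
  rewrite /inv /M !expr0 !divr1 /=; have := nm_ge0 (a - b); have := nm_ge0 (b - c).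
  by have := nm_ge0 (c - a); split => //; try split; lra.
have step k t : exists t', inv k t -> inv k.+1 t' /\ nm (t'.1.1 - t.1.1) <= M / 2 ^+ k.
  have [ht|nt] := pselect (inv k t); last by exists t.
  case: t ht => -[x y] z [/= [Dx Dy] Dz h1 [h2 h3] hb].
  have M0 : 0 <= M / 2 ^+ k by apply: le_trans h1; exact: nm_ge0.
  have half p q (r : R) : nm (p - q) <= r -> nm ((p - q) / 2) <= r / 2.
    by move=> hh; rewrite nm_half ler_pM2r // invr_gt0.
  have E : M / 2 ^+ k.+1 = M / 2 ^+ k / 2 by rewrite exprS; field; rewrite gt_eqF // exprn_gt0.
  have E4 : e / 4 ^+ k.+1 = e / 4 ^+ k / 4 by rewrite exprS; field; rewrite gt_eqF // exprn_gt0.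
  have h1' := half _ _ _ h1; have h2' := half _ _ _ h2; have h3' := half _ _ _ h3.
  have [b1|/nbad[N1 hN1]] := pselect (bad (e / 4 ^+ k.+1) (x, mid x y, mid z x)).
    exists (x, mid x y, mid z x) => _; rewrite /inv E /=; split; last by rewrite subrr nm0.
    split => //; try split => //; try exact: mD; rewrite /mid.
    - by have -> : x - (x + y) / 2 = (x - y) / 2 by field.
    - by have -> : (x + y) / 2 - (z + x) / 2 = (y - z) / 2 by field.
    - by have -> : (z + x) / 2 - x = (z - x) / 2 by field.
  have [b2|/nbad[N2 hN2]] := pselect (bad (e / 4 ^+ k.+1) (mid x y, y, mid y z)).
    exists (mid x y, y, mid y z) => _; rewrite /inv E /=; split; last first.
      have -> : mid x y - x = - ((x - y) / 2) by rewrite /mid; field.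
      by rewrite nmN; lra.
    split => //; try split => //; try exact: mD; rewrite /mid.
    - by have -> : (x + y) / 2 - y = (x - y) / 2 by field.
    - by have -> : y - (y + z) / 2 = (y - z) / 2 by field.
    - by have -> : (y + z) / 2 - (x + y) / 2 = (z - x) / 2 by field.
  have [b3|/nbad[N3 hN3]] := pselect (bad (e / 4 ^+ k.+1) (mid z x, mid y z, z)).
    exists (mid z x, mid y z, z) => _; rewrite /inv E /=; split; last first.
      have -> : mid z x - x = (z - x) / 2 by rewrite /mid; field.
      by lra.
    split => //; try split => //; try exact: mD; rewrite /mid.
    - by have -> : (z + x) / 2 - (y + z) / 2 = (x - y) / 2 by field.
    - by have -> : (y + z) / 2 - z = (y - z) / 2 by field.
    - by have -> : z - (z + x) / 2 = (z - x) / 2 by field.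
  have [b4|/nbad[N4 hN4]] := pselect (bad (e / 4 ^+ k.+1) (mid x y, mid y z, mid z x)).
    exists (mid x y, mid y z, mid z x) => _; rewrite /inv E /=; split; last first.
      have -> : mid x y - x = - ((x - y) / 2) by rewrite /mid; field.
      by rewrite nmN; lra.
    split => //; try split => //; try exact: mD; rewrite /mid.
    - by rewrite -nmN; have -> : - ((x + y) / 2 - (y + z) / 2) = (z - x) / 2 by field.
    - by rewrite -nmN; have -> : - ((y + z) / 2 - (z + x) / 2) = (x - y) / 2 by field.
    - by rewrite -nmN; have -> : - ((z + x) / 2 - (x + y) / 2) = (y - z) / 2 by field.
  (* A sum of level n + 1 splits into four sums of level n, hence the successor. *)
  exfalso; have [[//|n] hn] := hb (maxn (maxn N1 N2) (maxn N3 N4)).+1.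
  move: hn; rewrite ltnS !geq_max => /andP[/andP[/hN1 g1 /hN2 g2] /andP[/hN3 g3 /hN4 g4]].
  rewrite /= in g1 g2 g3 g4 *; rewrite tri_split ltNge => /negP; apply.
  rewrite E4 in g1 g2 g3 g4.
  apply: le_trans (nmD _ _) _; apply: le_trans (lerD (nmD _ _) (lexx _)) _.
  apply: le_trans (lerD (lerD (nmD _ _) (lexx _)) (lexx _)) _; lra.
have [F hF] := choice (fun kt : nat * (R[i] * R[i] * R[i]) => step kt.1 kt.2).
pose t := nat_rect (fun=> (R[i] * R[i] * R[i])%type) (a, b, c) (fun k s => F (k, s)).
have tinv k : inv k (t k) by elim: k => // k IH; have [] := hF (k, t k) IH.
have tdist k : nm ((t k.+1).1.1 - (t k).1.1) <= M / 2 ^+ k.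
  by have [] := hF (k, t k) (tinv k).
have [l hl] := cauchyC_cvg (geo_cauchy tdist).
have Dl : D l by apply: cD hl => n; have [[]] := tinv n.
have M0 : 0 <= M by rewrite !addr_ge0 ?nm_ge0.
have ldist k : nm (l - (t k).1.1) <= 2 * M / 2 ^+ k.
  apply/ler_addgt0Pr => d /hl[N hN].
  apply: le_trans (nm_tri _ (t (maxn N k)).1.1 _) _; rewrite addrC; apply: lerD.
    exact: (geo_tail tdist (leq_maxr N k)).
  by apply: ltW; apply: hN; exact: leq_maxl.
have [h hc [d d0 hd]] := dg l Dl.
(* The final estimate is 9 e' M^2 / 4^k, to be at most e / 4^k; the summand 1 keeps the denominator
   positive. *)
pose e' := e / (10 * M ^+ 2 + 1).
have q0 : 0 < 10 * M ^+ 2 + 1 by rewrite ltr_wpDl // mulr_ge0 // exprn_ge0.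
have e'0 : 0 < e' by rewrite divr_gt0.
have [d' d'0 hd'] := hc _ e'0.
have m0 : 0 < Num.min d d' by rewrite lt_min d0.
have [k hk] := geo_small (3 * M) m0; have {hk}hk := hk k (leqnn k).
have [[Da' Db'] Dc' h1 [h2 h3] hb] := tinv k.
move: Da' Db' Dc' h1 h2 h3 hb (ldist k); case: (t k) => -[x y] z /=.
move=> Dx Dy Dz h1 h2 h3 hb hx.
pose r := M / 2 ^+ k.
have r0 : 0 <= r by rewrite divr_ge0 // exprn_ge0.
pose B := [set w | nm (w - l) <= 3 * r].
have hr : 3 * r < Num.min d d' by rewrite /r mulrA.
have hx' : nm (x - l) <= 2 * r by rewrite nmC /r mulrA.
have Bx : B x by rewrite /B /=; lra.
have By : B y.
  by rewrite /B /=; apply: le_trans (nm_tri _ x _) _; rewrite (nmC y); move: h1; rewrite -/r; lra.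
have Bz : B z.
  by rewrite /B /=; apply: le_trans (nm_tri _ x _) _; move: h3; rewrite -/r; lra.
(* g minus its affine approximation at the limit point l: the sums around the triangle do not
   change, and the values become small. *)
pose H w := g w + (- h l * w + (h l * l - g l)).
have mB : midconvex B by exact: ball_midconvex.
have HB w : B w -> nm (H w) <= e' * (3 * r).
  rewrite /B /= => hw; have := le_lt_trans hw hr; rewrite lt_min => /andP[/hd E /hd' h'].
  have -> : H w = (h w - h l) * (w - l) by rewrite /H E; ring.
  by rewrite nmM ler_pM ?nm_ge0 // ltW.
have HT n : tri n g x y z = tri n H x y z.
  have TH u v : trap n H u v = trap n g u v + (- h l * (v ^+ 2 - u ^+ 2) / 2 + (h l * l - g l) * (v - u)).
    by rewrite /H trapD trap_affine.
  by rewrite /tri !TH; field.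
have [n _] := hb 0%N; rewrite /= HT; apply/negP; rewrite -leNgt.
apply: le_trans (nmD _ _) _; apply: le_trans (lerD (nmD _ _) (lexx _)) _.
apply: le_trans (lerD (lerD (trap_bound n mB Bx By HB) (trap_bound n mB By Bz HB)) (trap_bound n mB Bz Bx HB)) _.
rewrite (nmC y x) (nmC z y) (nmC x z).
have er : 0 <= e' * (3 * r) by apply: mulr_ge0; [exact: ltW|exact: mulr_ge0].
have := ler_wpM2l er h1; have := ler_wpM2l er h2; have := ler_wpM2l er h3.
rewrite -/r => g1 g2 g3.
have : e' * (3 * r) * nm (x - y) + e' * (3 * r) * nm (y - z) + e' * (3 * r) * nm (z - x) <= 9 * (e' * r ^+ 2).
  have -> : 9 * (e' * r ^+ 2) = 3 * (e' * (3 * r) * r) by ring.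
  by lra.
move=> hle; apply: le_trans hle _.
have -> : 9 * (e' * r ^+ 2) = e' * (9 * M ^+ 2) / 4 ^+ k.
  rewrite /r expr_div_n -!exprM muln2 -addnn exprD -exprMn (_ : 2 * 2 = 4 :> R); last by ring.
  by ring.
rewrite ler_pM2r ?invr_gt0 ?exprn_gt0 // /e' mulrAC ler_pdivrMr // ler_pM2l //.
by have := sqr_ge0 M; lra.
Qed.

End TrapezoidSums.

(** * Goursat's theorem with an exceptional vertex *)

Section GoursatVertex.
Variable R : realType.
Implicit Types (f g h : R[i] -> R[i]) (a b c p z w : R[i]) (n : nat).

Lemma Re_mid a b : complex.Re (mid a b) = (complex.Re a + complex.Re b) / 2.
Proof.
by rewrite /mid mulrC (_ : 2^-1 = cR 2^-1) ?ReM ?Re_cR ?Im_cR ?ReD; [lra|rewrite cRV /cR rmorphMn rmorph1].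
Qed.

Lemma mid_mulr u a b : u * mid a b = mid (u * a) (u * b).
Proof. by rewrite /mid; field. Qed.

Lemma halfplane_mid u (m : R) : midconvex [set z | m <= complex.Re (u * z)].
Proof. by move=> a b /= ha hb; rewrite mid_mulr Re_mid; lra. Qed.

Lemma halfplane_closed u (m : R) : seq_closed [set z : R[i] | m <= complex.Re (u * z)].
Proof.
move=> s l /= hs hl; apply/ler_addgt0Pr => e e0.
have k0 : 0 < nm u + 1 by rewrite ltr_wpDl ?nm_ge0.
have [N hN] := hl _ (divr_gt0 e0 k0); have := hN N (leqnn N); have := hs N.
rewrite ltr_pdivlMr // => h1 h2.
have : complex.Re (u * (s N - l)) <= nm u * nm (l - s N).
  by rewrite (nmC l) -nmM; exact: Re_le_nm.
rewrite mulrBr ReB; have := nm_ge0 (l - s N); have := nm_ge0 u; nra.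
Qed.

Lemma setI_mid (D E : set R[i]) : midconvex D -> midconvex E -> midconvex (D `&` E).
Proof. by move=> hD hE a b [? ?] [? ?]; split; [exact: hD|exact: hE]. Qed.
Lemma setI_closed (D E : set R[i]) : seq_closed D -> seq_closed E -> seq_closed (D `&` E).
Proof.
by move=> hD hE u l hu hl; split; [apply: hD hl|apply: hE hl] => n; case: (hu n).
Qed.

(** The linear functional Re (u z) separates p from three of the four parts of the triangle, where
    plain Goursat applies. The fourth part keeps the vertex p; after k halvings it has size at most
    r, and there the bound M on g controls the sum by 4 M r. *)
Lemma goursat_vertex (D : set R[i]) g p u : midconvex D -> seq_closed D ->
  (forall z, D z -> z != p -> cdiff g z) ->
  (exists2 M : R, 0 <= M & exists2 d : R, 0 < d & forall w, nm (w - p) < d -> nm (g w) <= M) ->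
  D p -> forall a b, D a -> D b ->
  complex.Re (u * p) < complex.Re (u * a) -> complex.Re (u * p) < complex.Re (u * b) ->
  vanishing (fun n => tri n g p a b).
Proof.
move=> mD cD dg [M M0 [d d0 gM]] Dp.
pose l z := complex.Re (u * (z - p)).
have lmid x y : l (mid x y) = (l x + l y) / 2.
  have -> : l (mid x y) = complex.Re (mid (u * (x - p)) (u * (y - p))).
    by rewrite /l; congr complex.Re; rewrite /mid; field.
  by rewrite Re_mid.
have lp : l p = 0 by rewrite /l subrr mulr0.
have off a b : D a -> D b -> 0 < l a -> 0 < l b ->
    [/\ vanishing (fun n => tri n g (mid p a) a (mid a b)),
        vanishing (fun n => tri n g (mid b p) (mid a b) b)
      & vanishing (fun n => tri n g (mid p a) (mid a b) (mid b p))].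
  move=> Da Db la lb; pose m := Num.min (l a) (l b) / 2.
  have m0 : 0 < m by rewrite divr_gt0 // lt_min la.
  have ma : m <= l a / 2 by rewrite ler_pM2r ?invr_gt0 // ge_min lexx.
  have mb : m <= l b / 2 by rewrite ler_pM2r ?invr_gt0 // ge_min lexx orbT.
  pose E := D `&` [set z | m + complex.Re (u * p) <= complex.Re (u * z)].
  have El z : D z -> m <= l z -> E z.
    by move=> Dz; rewrite /l mulrBr ReB => h; split => //=; lra.
  have mE : midconvex E by apply: setI_mid => //; exact: halfplane_mid.
  have cE : seq_closed E by apply: setI_closed => //; exact: halfplane_closed.
  have dE z : E z -> cdiff g z.
    by move=> [Dz /= hz]; apply: dg => //; apply: contraTneq hz => ->; rewrite -ltNge; lra.
  have Ea : E a by apply: El => //; lra.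
  have Eb : E b by apply: El => //; lra.
  have Eab : E (mid a b) by exact: mE.
  have Epa : E (mid p a) by apply: El; [exact: mD|rewrite lmid lp; lra].
  have Ebp : E (mid b p) by apply: El; [exact: mD|rewrite lmid lp; lra].
  by split; apply: (goursat mE cE dE).
have corner k r a b : D a -> D b -> 0 < l a -> 0 < l b -> 0 <= r -> r < d ->
    nm (a - p) <= r * 2 ^+ k -> nm (b - p) <= r * 2 ^+ k ->
    forall e : R, 0 < e -> exists N, forall n, (N <= n)%N -> nm (tri n g p a b) <= 4 * M * r + e.
  elim: k a b => [|k IH] a b Da Db la lb r0 rd.
    rewrite expr0 mulr1 => ha hb e e0; exists 0%N => n _.
    have mB := @ball_midconvex R p r.
    have gB z : [set z | nm (z - p) <= r] z -> nm (g z) <= M.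
      by move=> /= h; apply: gM; exact: le_lt_trans rd.
    have Bp : [set z | nm (z - p) <= r] p by rewrite /= subrr nm0.
    apply: le_trans (nmD _ _) _; apply: le_trans (lerD (nmD _ _) (lexx _)) _.
    apply: le_trans (lerD (lerD (trap_bound n mB Bp ha gB) (trap_bound n mB ha hb gB)) (trap_bound n mB hb Bp gB)) _.
    have hab : nm (b - a) <= 2 * r.
      by apply: le_trans (nm_tri _ p _) _; rewrite (nmC p); lra.
    rewrite (nmC p b).
    have := ler_wpM2l M0 ha; have := ler_wpM2l M0 hb; have := ler_wpM2l M0 hab; lra.
  rewrite exprS => ha hb e e0.
  have [v1 v2 v3] := off a b Da Db la lb.
  have q0 : 0 < e / 4 by rewrite divr_gt0.
  have hpa : nm (mid p a - p) <= r * 2 ^+ k.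
    have -> : mid p a - p = (a - p) / 2 by rewrite /mid; field.
    by rewrite nm_half; lra.
  have hbp : nm (mid b p - p) <= r * 2 ^+ k.
    have -> : mid b p - p = (b - p) / 2 by rewrite /mid; field.
    by rewrite nm_half; lra.
  have lpa : 0 < l (mid p a) by rewrite lmid lp; lra.
  have lbp : 0 < l (mid b p) by rewrite lmid lp; lra.
  have [N0 h0] := IH _ _ (mD _ _ Dp Da) (mD _ _ Db Dp) lpa lbp r0 rd hpa hbp _ q0.
  have [N1 h1] := v1 _ q0; have [N2 h2] := v2 _ q0; have [N3 h3] := v3 _ q0.
  exists (maxn (maxn N0 N1) (maxn N2 N3)).+1 => -[//|n].
  rewrite ltnS !geq_max => /andP[/andP[/h0 {}h0 /h1 {}h1] /andP[/h2 {}h2 /h3 {}h3]].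
  rewrite tri_split.
  apply: le_trans (nmD _ _) _; apply: le_trans (lerD (nmD _ _) (lexx _)) _.
  apply: le_trans (lerD (lerD (nmD _ _) (lexx _)) (lexx _)) _; lra.
move=> a b Da Db la lb e e0.
have la' : 0 < l a by rewrite /l mulrBr ReB subr_gt0.
have lb' : 0 < l b by rewrite /l mulrBr ReB subr_gt0.
(* Small enough for g to be bounded by M within distance r of p, and for 4 M r to be at most e /
   2. *)
pose r := Num.min (d / 2) (e / (8 * (M + 1))).
have M1 : 0 < 8 * (M + 1) by rewrite mulr_gt0 // ltr_wpDl.
have r0 : 0 < r by rewrite lt_min !divr_gt0.
have rd : r < d by apply: (@le_lt_trans _ _ (d / 2)); [rewrite ge_min lexx|lra].
have rM : r * (8 * (M + 1)) <= e by rewrite -ler_pdivlMr // ge_min lexx orbT.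
have [k hk] := bound_lt_exp2 ((nm (a - p) + nm (b - p)) / r).
have := hk k (leqnn k); rewrite ltr_pdivrMr // mulrC => {}hk.
have := nm_ge0 (a - p); have := nm_ge0 (b - p) => nb na.
have ha : nm (a - p) <= r * 2 ^+ k by lra.
have hb : nm (b - p) <= r * 2 ^+ k by lra.
have [N hN] := corner k r a b Da Db la' lb' (ltW r0) rd ha hb _ (half_lt e0).
exists N => n /hN h; apply: le_trans h _; nra.
Qed.

End GoursatVertex.

(** * Integrals along a vertical line *)

Section VerticalLine.
Variables (R : realType) (t : R).
Implicit Types (f g : R[i] -> R[i]) (c d p z w : R[i]) (n : nat).

Definition vlow (T : R) : R[i] := (t -i* T)%C.
Definition vhigh (T : R) : R[i] := (t +i* T)%C.

Lemma line_mid : midconvex [set z : R[i] | complex.Re z = t].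
Proof. by move=> a b /= ha hb; rewrite Re_mid ha hb; lra. Qed.

Definition rightof : set R[i] := [set z | t <= complex.Re z].

Lemma rightofE : rightof = [set z | t <= complex.Re (1 * z)].
Proof. by apply/seteqP; split => z /=; rewrite mul1r. Qed.
Lemma rightof_mid : midconvex rightof.
Proof. by rewrite rightofE; exact: halfplane_mid. Qed.
Lemma rightof_closed : seq_closed rightof.
Proof. by rewrite rightofE; exact: halfplane_closed. Qed.

(* The segment is closed up by the two sides from [t + T] of a triangle, on
   which [g] is [O(T^-2)]. *)
Lemma line_vanishing g p (C T1 : R) : t < complex.Re p -> 0 <= C ->
  (forall z, rightof z -> z != p -> cdiff g z) ->
  (exists2 M : R, 0 <= M & exists2 d : R, 0 < d & forall w, nm (w - p) < d -> nm (g w) <= M) ->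
  (forall z, rightof z -> T1 <= nm (z - cR t) -> nm (g z) <= C / nm (z - cR t) ^+ 2) ->
  forall e : R, 0 < e -> exists T0, forall T, T0 <= T ->
    exists N, forall n, (N <= n)%N -> nm (trap n g (vlow T) (vhigh T)) <= e.
Proof.
move=> tp C0 dg bg gC e e0.
(* In this order the summands give T > 0, the decay estimate at distance T / 2, p inside the
   triangle, and a contribution of at most e / 4 from each of the two outer sides. *)
pose T0 := 1 + 2 * `|T1| + 2 * nm (p - cR t) + 32 * C / e.
have q1 := normr_ge0 T1; have q2 := nm_ge0 (p - cR t).
have q3 : 0 <= 32 * C / e by rewrite divr_ge0 ?(ltW e0) // mulr_ge0.
exists T0 => T hT; rewrite /T0 in hT.
have T00 : 0 < T by lra.
pose A := vlow T; pose B := vhigh T; pose W := cR (t + T).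
have DA : rightof A by rewrite /rightof /A /=.
have DB : rightof B by rewrite /rightof /B /=.
have DW : rightof W by rewrite /rightof /W /=; lra.
have Dp : rightof p by rewrite /rightof /=; lra.
have hRe : `|complex.Re (p - cR t)| <= nm (p - cR t) := ler_Re_nm _.
have hIm : `|complex.Im (p - cR t)| <= nm (p - cR t) := ler_Im_nm _.
rewrite ReB ImB Re_cR Im_cR subr0 in hRe hIm.
move: hRe hIm; rewrite !ler_norml => /andP[hRe1 hRe2] /andP[hIm1 hIm2].
(* Joining p to the three corners cuts the triangle into three with vertex p; in each, the normal u
   to the opposite side separates p from the other two corners. *)
have v1 : vanishing (fun n => tri n g p A B).
  by apply: (@goursat_vertex _ rightof _ _ (-1) rightof_mid rightof_closed dg bg) => //;
    rewrite !mulN1r !ReN ltrN2 /=.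
have v2 : vanishing (fun n => tri n g p B W).
  apply: (@goursat_vertex _ rightof _ _ (1 -i* 1)%C rightof_mid rightof_closed dg bg) => //;
    rewrite !ReM /=; lra.
have v3 : vanishing (fun n => tri n g p W A).
  apply: (@goursat_vertex _ rightof _ _ (1 +i* 1)%C rightof_mid rightof_closed dg bg) => //;
    rewrite !ReM /=; lra.
have [N hN] := vanishingD (vanishingD v1 v2) v3 (half_lt e0).
exists N => n /hN {}hN.
(* The slanted sides are estimated in the parts of the right half plane beyond them, which are
   midpoint-convex and at distance at least T / 2 from t. *)
have far (s : R) : s ^+ 2 = 1 -> forall z, (rightof `&` [set z | t + T <= complex.Re ((1 +i* s)%C * z)]) z ->
    nm (g z) <= 4 * C / T ^+ 2.
  move=> s1 z [Dz /=]; rewrite ReM /= => hz.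
  have n2 : T ^+ 2 / 4 <= nm (z - cR t) ^+ 2.
    rewrite nm_sqr ReB ImB Re_cR Im_cR subr0.
    have : T <= (complex.Re z - t) - s * complex.Im z by lra.
    have h0 : 0 <= complex.Re z - t by rewrite subr_ge0.
    move: (complex.Re z - t) h0 => x h0 hx.
    have h3 : (s * complex.Im z) ^+ 2 = complex.Im z ^+ 2 by rewrite exprMn s1 mul1r.
    rewrite -h3; move: (s * complex.Im z) hx => y hx.
    have := sqr_ge0 (x + y); have : T ^+ 2 <= (x - y) ^+ 2.
      by rewrite lerXn2r ?nnegrE //; lra.
    rewrite !expr2; nra.
  have n1 : T / 2 <= nm (z - cR t).
    have T2 : 0 <= T / 2 by lra.
    rewrite -(@ler_pXn2r _ 2) ?nnegrE ?nm_ge0 //.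
    by have -> : (T / 2) ^+ 2 = T ^+ 2 / 4 by field.
  have T1n : T1 <= nm (z - cR t) by have := ler_norm T1; lra.
  apply: le_trans (gC z Dz T1n) _.
  have Tp : 0 < T ^+ 2 by rewrite exprn_gt0.
  have np : 0 < nm (z - cR t) ^+ 2 by rewrite exprn_gt0 //; lra.
  rewrite ler_pdivrMr // mulrAC ler_pdivlMr //.
  have := ler_wpM2l C0 n2; lra.
have mF (s : R) : midconvex (rightof `&` [set z | t + T <= complex.Re ((1 +i* s)%C * z)]).
  by apply: setI_mid; [exact: rightof_mid|exact: halfplane_mid].
have mem (s : R) z : rightof z -> t + T <= complex.Re z - s * complex.Im z ->
    (rightof `&` [set z | t + T <= complex.Re ((1 +i* s)%C * z)]) z.
  by move=> Dz h; split => //=; rewrite ReM /= mul1r.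
have e1 : nm (trap n g B W) <= 4 * C / T ^+ 2 * nm (W - B).
  apply: (trap_bound n (mF (-1)) _ _ (far (-1) _)); [apply: mem => //=; lra|apply: mem => //=; lra|].
  by rewrite sqrrN expr1n.
have e2 : nm (trap n g W A) <= 4 * C / T ^+ 2 * nm (A - W).
  apply: (trap_bound n (mF 1) _ _ (far 1 _)); [apply: mem => //=; lra|apply: mem => //=; lra|].
  by rewrite expr1n.
have l1 : nm (W - B) <= 2 * T.
  by apply: le_trans (nm_le_ReIm _) _; rewrite ReB ImB /= sub0r normrN addrAC subrr add0r !ger0_norm ?(ltW T00) //; lra.
have l2 : nm (A - W) <= 2 * T.
  rewrite nmC; apply: le_trans (nm_le_ReIm _) _; rewrite ReB ImB /= sub0r opprK addrAC subrr add0r !ger0_norm ?(ltW T00) //; lra.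
have k0 : 0 <= 4 * C / T ^+ 2 by rewrite divr_ge0 ?exprn_ge0 ?(ltW T00) // mulr_ge0.
have kT : 4 * C / T ^+ 2 * (2 * T) <= e / 4.
  rewrite (_ : 4 * C / T ^+ 2 * (2 * T) = 8 * C / T); last by field; rewrite gt_eqF.
  rewrite ler_pdivrMr //.
  have : 32 * C <= e * T.
    by rewrite -ler_pdivrMl // mulrC; lra.
  lra.
have := ler_wpM2l k0 l1; have := ler_wpM2l k0 l2 => g1 g2.
have -> : trap n g A B = (tri n g p A B + tri n g p B W + tri n g p W A) - trap n g B W - trap n g W A.
  by rewrite /tri (trap_rev n g p A) (trap_rev n g p B) (trap_rev n g p W); ring.
apply: le_trans (nmB _ _) _; apply: le_trans (lerD (nmB _ _) (lexx _)) _; lra.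
Qed.

End VerticalLine.

(** * Residues relative to a reference integrand *)

Section Residues.
Variables (R : realType) (t : R).
Hypothesis t0 : 0 < t.
Implicit Types (g h : R[i] -> R[i]) (c d p z w v : R[i]) (n : nat).

Let A := vlow t.
Let B := vhigh t.

Definition pole2 c d z : R[i] := ((z - c) * (z - d))^-1.

(** The reference poles lie at distance 1 on either side of the line. The integral of [rho] replaces
    the factor 2 pi i of the residue theorem; since these poles are 2 apart, the coefficient v in
    [approx] is twice the residue. *)
Definition cref : R[i] := cR (t + 1).
Definition dref : R[i] := cR (t - 1).
Definition rho := pole2 cref dref.

(* On the line [Re z = t] the integral of [g] is asymptotically [v] times the
   integral of [rho], up to the constant the residue of [g] in the right half plane. *)
Definition approx g v := forall e : R, 0 < e -> exists T0, forall T, T0 <= T ->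
  exists N, forall n, (N <= n)%N ->
    nm (trap n g (A T) (B T) - v * trap n rho (A T) (B T)) <= e.

Lemma approx_ext g h v : (forall z, complex.Re z = t -> g z = h z) -> approx g v -> approx h v.
Proof.
move=> gh H e /H[T0 hT]; exists T0 => T /hT[N hN]; exists N => n /hN.
by rewrite (trap_ext n (@line_mid _ t) _ _ gh).
Qed.

Lemma approxD g h v w : approx g v -> approx h w -> approx (fun z => g z + h z) (v + w).
Proof.
move=> H K e e0; have [T0 hT] := H _ (half_lt e0); have [T1 kT] := K _ (half_lt e0).
exists (Num.max T0 T1) => T; rewrite ge_max => /andP[/hT[N hN] /kT[N' kN]].
exists (maxn N N') => n; rewrite geq_max => /andP[/hN h1 /kN h2].
rewrite trapD mulrDl opprD addrACA; apply: le_trans (nmD _ _) _; lra.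
Qed.

Lemma approxZ c g v : approx g v -> approx (fun z => c * g z) (c * v).
Proof.
move=> H e e0; have k0 : 0 < nm c + 1 by rewrite ltr_wpDl ?nm_ge0.
have [T0 hT] := H _ (divr_gt0 e0 k0); exists T0 => T /hT[N hN]; exists N => n /hN.
rewrite trapZ -mulrA -mulrBr nmM ler_pdivlMr // => h; apply: le_trans h.
by rewrite mulrC ler_wpM2l ?nm_ge0 // lerDl.
Qed.

Lemma approx0 : approx (fun=> 0) 0.
Proof.
move=> e e0; exists 0 => T _; exists 0%N => n _.
have E : trap n (fun=> 0) (A T) (B T) = 0 * trap n (fun=> 0) (A T) (B T).
  by rewrite -trapZ; congr (trap n _ _ _); apply/funext => z; rewrite mul0r.
by rewrite E !mul0r subrr nm0 ltW.
Qed.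

Lemma approx_sum (I : Type) (r : seq I) (P : pred I) (G : I -> R[i] -> R[i]) (V : I -> R[i]) :
  (forall i, approx (G i) (V i)) ->
  approx (fun z => \sum_(i <- r | P i) G i z) (\sum_(i <- r | P i) V i).
Proof.
move=> H; elim: r => [|i r IH].
  rewrite big_nil; apply: approx_ext approx0 => z _; by rewrite big_nil.
rewrite big_cons; case Pi : (P i); last first.
  by apply: approx_ext IH => z _; rewrite big_cons Pi.
by apply: approx_ext (approxD (H i) IH) => z _; rewrite big_cons Pi.
Qed.

Lemma nm_pole c z : 2 * nm (c - cR t) <= nm (z - cR t) -> nm (z - cR t) <= 2 * nm (z - c).
Proof. by move=> h; have := nm_tri z c (cR t); lra. Qed.

Lemma pole2_decay c d : exists T1, forall z, T1 <= nm (z - cR t) ->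
  nm (pole2 c d z) <= 4 / nm (z - cR t) ^+ 2.
Proof.
have q1 := nm_ge0 (c - cR t); have q2 := nm_ge0 (d - cR t).
exists (2 * nm (c - cR t) + 2 * nm (d - cR t) + 1) => z hz.
have h1 : nm (z - cR t) <= 2 * nm (z - c) by apply: nm_pole; lra.
have h2 : nm (z - cR t) <= 2 * nm (z - d) by apply: nm_pole; lra.
have n0 : 0 < nm (z - cR t) by lra.
rewrite /pole2 nmV nmM ler_pdivlMr ?exprn_gt0 // ler_pdivrMl; last by rewrite mulr_gt0 //; lra.
by rewrite expr2; nra.
Qed.

Lemma pole_cdiff c z : z != c -> cdiff (fun w => (w - c)^-1) z.
Proof.
move=> zc; apply: cdiffV; first by rewrite subr_eq0.
by apply: cdiffD; [exact: cdiff_id|exact: cdiff_cst].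
Qed.

Lemma pole2_cdiff c d z : z != c -> z != d -> cdiff (pole2 c d) z.
Proof.
move=> zc zd; have -> : pole2 c d = fun w => (w - c)^-1 * (w - d)^-1.
  by apply/funext => w; rewrite /pole2 invfM.
by apply: cdiffM; exact: pole_cdiff.
Qed.

Lemma Re_neq z w : complex.Re z != complex.Re w -> z != w.
Proof. by apply: contra_neq => ->. Qed.

Lemma line_approx0 g p (C T1 : R) : t < complex.Re p -> 0 <= C ->
  (forall z, rightof t z -> z != p -> cdiff g z) ->
  (exists2 M : R, 0 <= M & exists2 d : R, 0 < d & forall w, nm (w - p) < d -> nm (g w) <= M) ->
  (forall z, rightof t z -> T1 <= nm (z - cR t) -> nm (g z) <= C / nm (z - cR t) ^+ 2) ->
  approx g 0.
Proof.
move=> tp C0 dg bg gC e e0; have [T0 hT] := line_vanishing tp C0 dg bg gC e0.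
by exists T0 => T /hT[N hN]; exists N => n /hN; rewrite mul0r subr0.
Qed.

Section BoundedFunction.
Variables (f : R[i] -> R[i]) (M : R).
Hypothesis f_cdiff : forall z, 0 < complex.Re z -> cdiff f z.
Hypothesis f_bnd : forall z, 0 < complex.Re z -> nm (f z) <= M.

Let M0 : 0 <= M.
Proof. by apply: le_trans (nm_ge0 (f 1)) (f_bnd _); rewrite /= ltr01. Qed.

Lemma residue_LL c d : complex.Re c < t -> complex.Re d < t ->
  approx (fun z => f z * pole2 c d z) 0.
Proof.
move=> ct dt; have [T1 hT1] := pole2_decay c d.
have dg z : rightof t z -> cdiff (fun z => f z * pole2 c d z) z.
  rewrite /rightof /= => hz; apply: cdiffM; first by apply: f_cdiff; exact: lt_le_trans t0 hz.
  by apply: pole2_cdiff; apply: Re_neq; rewrite gt_eqF //; lra.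
(* There is no singularity to the right of the line; any point there may play the exceptional
   one. *)
apply: (@line_approx0 _ (cR (t + 1)) (M * 4) T1).
- by rewrite Re_cR ltrDl.
- by rewrite mulr_ge0.
- by move=> z /dg.
- by apply: cdiff_bounded; apply: dg; rewrite /rightof /= lerDl.
- move=> z Dz hz; rewrite nmM -mulrA ler_pM ?nm_ge0 ?hT1 //.
  by apply: f_bnd; apply: lt_le_trans t0 Dz.
Qed.

(** Subtracting [f c] cancels the pole at c: the quotient stays bounded there, as an exceptional
    point requires. *)
Lemma residue_RL0 c d : t < complex.Re c -> complex.Re d < t ->
  approx (fun z => (f z - f c) * pole2 c d z) 0.
Proof.
move=> ct dt; have [T1 hT1] := pole2_decay c d.
have fc : 0 < complex.Re c by exact: lt_trans ct.
apply: (@line_approx0 _ c (2 * M * 4) T1) => //.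
- by rewrite !mulr_ge0.
- move=> z; rewrite /rightof /= => hz zc; apply: cdiffM.
    by apply: cdiffD; [apply: f_cdiff; exact: lt_le_trans t0 hz|exact: cdiff_cst].
  by apply: pole2_cdiff => //; apply: Re_neq; rewrite gt_eqF //; lra.
- have [h hc [r r0 hr]] := f_cdiff fc.
  have cd : c != d by apply: Re_neq; rewrite gt_eqF //; lra.
  have [M2 M20 [r2 r20 hM2]] := cdiff_bounded (pole_cdiff cd).
  have [r1 r10 hM1] := hc 1 ltr01.
  exists ((nm (h c) + 1) * M2); first by rewrite mulr_ge0 // addr_ge0 ?nm_ge0.
  exists (Num.min r (Num.min r1 r2)); first by rewrite !lt_min r0 r10.
  move=> w; rewrite !lt_min => /and3P[/hr E /hM1 h1 /hM2 h2].
  have p0 : 0 <= (nm (h c) + 1) * M2 by rewrite mulr_ge0 // addr_ge0 ?nm_ge0.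
  have [->|wc] := eqVneq w c; first by rewrite subrr mul0r nm0.
  have -> : (f w - f c) * pole2 c d w = h w * (w - d)^-1.
    rewrite E addrAC subrr add0r /pole2 invfM -mulrA mulVKf // ?subr_eq0 //.
  rewrite nmM ler_pM ?nm_ge0 //; apply: le_trans (nm_distl _ (h c)) _; lra.
- move=> z Dz hz; rewrite nmM -mulrA ler_pM ?nm_ge0 ?hT1 //.
  have := f_bnd fc; have : nm (f z) <= M by apply: f_bnd; apply: lt_le_trans t0 Dz.
  by have := nmB (f z) (f c); lra.
Qed.
End BoundedFunction.

Lemma one_bnd z : 0 < complex.Re z -> nm ((fun=> 1) z : R[i]) <= 1.
Proof. by rewrite nm1. Qed.

Lemma pole2_LL c d : complex.Re c < t -> complex.Re d < t -> approx (pole2 c d) 0.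
Proof.
move=> ct dt; apply: approx_ext (residue_LL (f := fun=> 1) (fun z _ => cdiff_cst 1 z) one_bnd ct dt).
by move=> z _; rewrite mul1r.
Qed.

Lemma conj_line z : complex.Re z = t -> z^* = cR (2 * t) - z.
Proof. by move=> h; apply: ceqP; rewrite ?ReJ ?ImJ ?ReB ?ImB ?Re_cR ?Im_cR ?h; lra. Qed.

(** On the line, conjugation is z -> 2 t - z, so it reverses the increments b - a; hence the
    sign. *)
Lemma trap_conj n g a b : complex.Re a = t -> complex.Re b = t ->
  trap n (fun z => (g z)^*) a b = - (trap n g a b)^*.
Proof.
elim: n a b => [|n IH] a b ha hb /=.
  have e2 : (2^-1 : R[i])^* = 2^-1 by rewrite fmorphV /= conjC_nat.
  rewrite !rmorphM rmorphB rmorphD /= (conj_line ha) (conj_line hb) e2.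
  ring.
have hm : complex.Re (mid a b) = t by exact: line_mid.
by rewrite !IH // rmorphD opprD.
Qed.

(** Reflection in the line exchanges its two sides, and on the line it amounts to complex
    conjugation; this reduces the claim to [pole2_LL]. *)
Lemma pole2_RR c d : t < complex.Re c -> t < complex.Re d -> approx (pole2 c d) 0.
Proof.
move=> ct dt; pose c' := cR (2 * t) - c^*; pose d' := cR (2 * t) - d^*.
have c't : complex.Re c' < t by rewrite /c' ReB Re_cR ReJ; lra.
have d't : complex.Re d' < t by rewrite /d' ReB Re_cR ReJ; lra.
apply: (@approx_ext (fun z => (pole2 c' d' z)^*)).
  move=> z hz; rewrite /pole2 /c' /d' fmorphV rmorphM !rmorphB /= !conjCK cRJ (conj_line hz).
  by congr (_^-1); ring.
move=> e /(pole2_LL c't d't)[T0 hT]; exists T0 => T /hT[N hN]; exists N => n /hN.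
by rewrite !mul0r !subr0 trap_conj // nmN nmJ.
Qed.

Lemma line_neq z c : complex.Re z = t -> complex.Re c != t -> z - c != 0.
Proof. by move=> <- h; rewrite subr_eq0; apply: Re_neq; rewrite eq_sym. Qed.

Lemma Re_cref : complex.Re cref = t + 1. Proof. by []. Qed.
Lemma Re_dref : complex.Re dref = t - 1. Proof. by []. Qed.
Lemma cref_neq : complex.Re cref != t. Proof. by rewrite Re_cref gt_eqF // ltrDl. Qed.
Lemma dref_neq : complex.Re dref != t. Proof. by rewrite Re_dref lt_eqF // ltrBlDr ltrDl. Qed.

Lemma approx_rho : approx rho 1.
Proof. by move=> e e0; exists 0 => T _; exists 0%N => n _; rewrite mul1r subrr nm0 ltW. Qed.

(** Partial fractions: (c - d) times the integrand is 2 [rho] plus a multiple of [pole2 c cref],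
    with both poles on the right, minus a multiple of [pole2 d dref], with both on the left. *)
Lemma pole2_RL c d : t < complex.Re c -> complex.Re d < t -> approx (pole2 c d) (2 / (c - d)).
Proof.
move=> ct dt.
have cd : c - d != 0 by rewrite subr_eq0; apply: Re_neq; rewrite gt_eqF //; lra.
have h1 := pole2_RR ct (_ : t < complex.Re cref); have {}h1 := h1 ltac:(by rewrite Re_cref ltrDl).
have h2 := pole2_LL dt (_ : complex.Re dref < t); have {}h2 := h2 ltac:(by rewrite Re_dref; lra).
have := approxZ (c - d)^-1 (approxD (approxD (approxZ 2 approx_rho) (approxZ (c - cref) h1)) (approxZ (- (d - dref)) h2)).
rewrite !mulr0 !addr0 mulr1 mulrC; apply: approx_ext => z hz.
have z1 := line_neq hz (negbT (gt_eqF ct)); have z2 := line_neq hz (negbT (lt_eqF dt)).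
have z3 := line_neq hz cref_neq; have z4 := line_neq hz dref_neq.
have E : (2 : R[i]) = cref - dref.
  by rewrite /cref /dref -cRB (_ : t + 1 - (t - 1) = 2) ?[RHS]rmorphMn ?rmorph1 //; ring.
rewrite /rho /pole2; move: E z3 z4; move: cref dref => x y E z3 z4.
rewrite E; field; by rewrite z1 z2 z3 z4 cd.
Qed.

Section BoundedFunctionResidues.
Variables (f : R[i] -> R[i]) (M : R).
Hypothesis f_cdiff : forall z, 0 < complex.Re z -> cdiff f z.
Hypothesis f_bnd : forall z, 0 < complex.Re z -> nm (f z) <= M.

Lemma residue_RL c d : t < complex.Re c -> complex.Re d < t ->
  approx (fun z => f z * pole2 c d z) (2 * f c / (c - d)).
Proof.
move=> ct dt; have := approxD (residue_RL0 f_cdiff f_bnd ct dt) (approxZ (f c) (pole2_RL ct dt)).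
rewrite add0r (_ : f c * (2 / (c - d)) = 2 * f c / (c - d)); last by ring.
by apply: approx_ext => z _; ring.
Qed.

(** Partial fractions through the left pole [dref] reduce this to two instances of [residue_RL];
    distinct poles are what makes the decomposition possible. *)
Lemma residue_RR c d : t < complex.Re c -> t < complex.Re d -> c != d ->
  approx (fun z => f z * pole2 c d z) (2 * (f c - f d) / (c - d)).
Proof.
move=> ct dt cd; have cd0 : c - d != 0 by rewrite subr_eq0.
have rt : complex.Re dref < t by rewrite Re_dref; lra.
have h1 := approxZ (c - dref) (residue_RL ct rt).
have h2 := approxZ (- (d - dref)) (residue_RL dt rt).
have := approxZ (c - d)^-1 (approxD h1 h2).
have n1 : c - dref != 0 by rewrite subr_eq0; apply: Re_neq; rewrite gt_eqF //; lra.
have n2 : d - dref != 0 by rewrite subr_eq0; apply: Re_neq; rewrite gt_eqF //; lra.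
rewrite (_ : (c - d)^-1 * _ = 2 * (f c - f d) / (c - d)); last first.
  by move: n1 n2; move: dref => x n1 n2; field; rewrite cd0 n1 n2.
apply: approx_ext => z hz.
have z1 := line_neq hz (negbT (gt_eqF ct)); have z2 := line_neq hz (negbT (gt_eqF dt)).
have z4 := line_neq hz dref_neq.
move: z4 n1 n2; move: dref => x z4 n1 n2.
by rewrite /pole2; field; rewrite z1 z2 z4 cd0.
Qed.
End BoundedFunctionResidues.

Lemma trap_pos n (D : set R[i]) g a b : midconvex D -> (forall z, D z -> complex.Re z = t) ->
  D a -> D b -> complex.Im a <= complex.Im b -> (forall z, D z -> 0 <= g z) ->
  exists2 r : R, 0 <= r & trap n g a b = 'i%C * cR r.
Proof.
move=> mD Dt + + + gp; elim: n a b => [|n IH] a b Da Db ab /=.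
  have := gp a Da; have := gp b Db.
  rewrite !lecE /= => /andP[/eqP ib rb] /andP[/eqP ia ra].
  exists ((complex.Im b - complex.Im a) * ((complex.Re (g a) + complex.Re (g b)) / 2)).
    by apply: mulr_ge0; [rewrite subr_ge0|rewrite divr_ge0 ?addr_ge0].
  have -> : b - a = 'i%C * cR (complex.Im b - complex.Im a).
    by apply: ceqP; rewrite ?ReB ?ImB ?ReM ?ImM /= ?(Dt a Da) ?(Dt b Db); lra.
  have -> : (g a + g b) / 2 = cR ((complex.Re (g a) + complex.Re (g b)) / 2).
    rewrite cRM cRD; congr (_ * _); last by rewrite cRV /cR rmorphMn rmorph1.
    by apply: ceqP; rewrite ?ReD ?ImD ?Re_cR ?Im_cR //= ia ib addr0.
  by rewrite -mulrA -cRM.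
have Dm := mD _ _ Da Db.
have im : complex.Im (mid a b) = (complex.Im a + complex.Im b) / 2.
  have -> : mid a b = cR 2^-1 * (a + b).
    by rewrite /mid mulrC cRV /cR rmorphMn rmorph1.
  by rewrite ImM Re_cR Im_cR ImD; lra.
have [r r0 ->] := IH a (mid a b) Da Dm ltac:(rewrite im; lra).
have [s s0 ->] := IH (mid a b) b Dm Db ltac:(rewrite im; lra).
by exists (r + s); rewrite ?addr_ge0 // cRD mulrDr.
Qed.

Definition vline : set R[i] := [set z | complex.Re z = t].
Lemma vlineE z : vline z -> complex.Re z = t. Proof. by []. Qed.
Lemma vline_high T : vline (vhigh t T). Proof. by []. Qed.
Lemma vline_low T : vline (vlow t T). Proof. by []. Qed.
Lemma vline_real : vline (cR t). Proof. by []. Qed.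
Lemma vline_mid : midconvex vline. Proof. exact: line_mid. Qed.

(* On the line, [dz = i dy] and [- rho] is the positive function [1/(1+y^2)]. *)
Lemma rho_line z : vline z -> - rho z = cR (1 + complex.Im z ^+ 2)^-1.
Proof.
move=> hz; rewrite /rho /pole2 -invrN cRV; congr (_^-1).
by apply: ceqP; rewrite ?ReN ?ImN ?ReM ?ImM ?ReB ?ImB /= hz; ring.
Qed.

Lemma rho_pos z : vline z -> 0 <= - rho z.
Proof.
move=> /rho_line ->; rewrite -(cR0 R) cR_le invr_ge0 addr_ge0 // sqr_ge0 //.
Qed.

(** On the first unit of the line [- rho] is at least 1/2. Doubling the segment makes the old
    endpoint its midpoint and costs one level of subdivision, whence the level n + m. *)
Lemma rho_lower m n : exists2 r : R, 2^-1 <= r &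
  trap (n + m) (fun z => - rho z) (cR t) (vhigh t (2 ^+ m)) = 'i%C * cR r.
Proof.
elim: m => [|m [r r2 IH]].
  rewrite expr0 addn0.
  pose D := vline `&` [set z | 0 <= complex.Im z <= 1].
  have mD : midconvex D.
    apply: setI_mid; first exact: vline_mid.
    move=> a b /= /andP[a0 a1] /andP[b0 b1].
    have -> : complex.Im (mid a b) = (complex.Im a + complex.Im b) / 2.
      have -> : mid a b = cR 2^-1 * (a + b).
        by rewrite /mid mulrC cRV /cR rmorphMn rmorph1.
      by rewrite ImM Re_cR Im_cR ImD; lra.
    by apply/andP; split; lra.
  have Da : D (cR t) by split => //=; rewrite lexx ler01.
  have Db : D (vhigh t 1) by split => //=; rewrite lexx ler01.
  have gp z : D z -> 0 <= - rho z + - cR 2^-1.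
    move=> [hz /= /andP[z0 z1]]; rewrite rho_line // -cRN -cRD -(cR0 R) cR_le subr_ge0.
    rewrite lef_pV2 ?posrE // ?ltr_pwDl ?sqr_ge0 //.
    by rewrite expr2; nra.
  have [r r0 hr] := trap_pos n mD (fun z Dz => proj1 Dz) Da Db ler01 gp.
  exists (r + 2^-1); first by rewrite lerDr.
  have E : trap n (fun z => - rho z + - cR 2^-1) (cR t) (vhigh t 1) =
     trap n (fun z => - rho z) (cR t) (vhigh t 1) - 'i%C * cR 2^-1.
    rewrite trapD; congr (_ + _).
    have -> : (fun _ : R[i] => - cR 2^-1) = (fun z => 0 * z + - cR 2^-1).
      by apply/funext => z; rewrite mul0r add0r.
    rewrite trap_affine mul0r mul0r add0r; apply: ceqP; rewrite ?ReM ?ImM ?ReN ?ImN ?ReM ?ImM ?ReB ?ImB /=; ring.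
  by move: hr; rewrite E cRD mulrDr => <-; rewrite subrK.
rewrite addnS /=.
have -> : mid (cR t) (vhigh t (2 ^+ m.+1)) = vhigh t (2 ^+ m).
  have -> : mid (cR t) (vhigh t (2 ^+ m.+1)) = cR 2^-1 * (cR t + vhigh t (2 ^+ m.+1)).
    by rewrite /mid mulrC cRV /cR rmorphMn rmorph1.
  by apply: ceqP; rewrite ?ReM ?ImM /= exprS; field.
rewrite IH.
have [|s s0 ->] := trap_pos (n + m) vline_mid vlineE (vline_high (2 ^+ m)) (vline_high (2 ^+ m.+1)) _ rho_pos.
  by rewrite /= exprS ler_peMl ?exprn_ge0 // ler1n.
by exists (r + s); [rewrite ler_wpDr|rewrite cRD mulrDr].
Qed.

(** The sums of g are i r with r >= 0 and those of [- rho] are i s with s >= 1/2. Since they differ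
    from the relation r + v s = 0 by arbitrarily little, v is real and nonpositive. *)
Lemma approx_pos g v : (forall z, vline z -> 0 <= g z) -> approx g v -> 0 <= - v.
Proof.
move=> gp ga.
have key e : 0 < e -> `|complex.Im v| <= e /\ complex.Re v <= e.
  move=> e0; have [T0 hT] := ga _ (half_lt e0).
  have [m hm] := bound_lt_exp2 T0; have [N hN] := hT _ (ltW (hm m (leqnn m))).
  (* The additional level splits the segment at its midpoint t, so that [rho_lower] applies to the
     upper half. *)
  have := hN (N + m).+1; rewrite (leq_trans (leq_addr m N)) // => /(_ isT).
  have AB : complex.Im (A (2 ^+ m)) <= complex.Im (B (2 ^+ m)).
    by rewrite /= -subr_ge0 opprK addr_ge0 // exprn_ge0.
  have [r r0 ->] := trap_pos (N + m).+1 vline_mid vlineE (vline_low (2 ^+ m)) (vline_high (2 ^+ m)) AB gp.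
  have -> : trap (N + m).+1 rho (A (2 ^+ m)) (B (2 ^+ m)) = - trap (N + m).+1 (fun z => - rho z) (A (2 ^+ m)) (B (2 ^+ m)).
    have -> : (fun z => - rho z) = (fun z => (-1) * rho z) by apply/funext => z; rewrite mulN1r.
    by rewrite trapZ mulN1r opprK.
  have E : mid (A (2 ^+ m)) (B (2 ^+ m)) = cR t.
    have -> : mid (A (2 ^+ m)) (B (2 ^+ m)) = cR 2^-1 * (A (2 ^+ m) + B (2 ^+ m)).
      by rewrite /mid mulrC cRV /cR rmorphMn rmorph1.
    by apply: ceqP; rewrite ?ReM ?ImM /=; field.
  rewrite /= E; have [s s2 ->] := rho_lower m N.
  have [|q q0 ->] := trap_pos (N + m) vline_mid vlineE (vline_low (2 ^+ m)) vline_real _ rho_pos.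
    by rewrite /= oppr_le0 exprn_ge0.
  rewrite mulrN opprK -mulrDr -cRD (mulrCA v) -mulrDr nmM.
  have -> : nm ('i%C : R[i]) = 1 by apply/eqP; rewrite -(@eqrXn2 _ 2) ?nm_ge0 // nm_sqr /= expr0n add0r.
  rewrite mul1r => h; have qs : 2^-1 <= q + s by lra.
  have := ler_Im_nm (cR r + v * cR (q + s)); have := Re_le_nm (cR r + v * cR (q + s)).
  rewrite ReD ImD ReM ImM !Re_cR !Im_cR mulr0 mulr0 subr0 !add0r => h1 h2.
  have i1 : `|complex.Im v * (q + s)| <= e / 2 by lra.
  have qs0 : 0 <= q + s by lra.
  split.
    move: i1; rewrite normrM (ger0_norm qs0); have := normr_ge0 (complex.Im v); nra.
  by nra.
have im0 : complex.Im v = 0.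
  apply/eqP; rewrite -normr_eq0 eq_le normr_ge0 andbT; apply/ler_addgt0Pr => e /key[+ _].
  by rewrite add0r.
have re0 : complex.Re v <= 0 by apply/ler_addgt0Pr => e /key[_]; rewrite add0r.
by rewrite lecE ImN ReN im0 oppr0 eqxx /= oppr_ge0.
Qed.

End Residues.

(** * Positivity of the kernel *)

Section DividedDifferences.
Variables (R : realType) (U Y : hilbertType R) (phi : R[i] -> {linear U -> Y}).
Hypothesis phi_schur : operator_schur phi.

Lemma schur_bnd z : cplus z -> bounded_by (phi z) 1.
Proof.
move=> hz u; rewrite mul1r -cR_le -!nmE; by case: phi_schur => _ /(_ z hz).
Qed.

Lemma schur_diff z : cplus z -> exists2 D : {linear U -> Y}, (exists2 C, 0 <= C & bounded_by D C) &
  forall e : R, 0 < e -> exists2 d : R, 0 < d & forall w, nm (w - z) < d -> w != z ->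
    forall u, nm ((w - z)^-1 *: (phi w u - phi z u) - D u) <= e * nm u.
Proof.
case: phi_schur => [h _] hz; have [D [Dc hD]] := h z hz.
exists D; first by have [C C0 hC] := continuous_bounded Dc; exists C.
move=> e e0; have /dnbhsC_nm [d d0 hd] := hD e e0; exists d => // w wz nwz u.
have := hd (w - z); rewrite sub0r nmN subr_eq0 => /(_ wz nwz u).
by rewrite [z + _]addrC subrK nmE (nmE u) -cRM cR_le.
Qed.

(** Divided differences, completed on the diagonal by the operator derivative. As bounded operators
    they give the off-diagonal entries of the kernel one formula, without case distinction at the
    removable singularities. *)
Lemma dq_exists : exists dq : R[i] -> R[i] -> {linear U -> Y}, forall a, cplus a ->
  [/\ forall b u, b != a -> dq b a u = (b - a)^-1 *: (phi b u - phi a u),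
      forall b, cplus b -> exists2 C, 0 <= C & bounded_by (dq b a) C
    & forall e : R, 0 < e -> exists2 d : R, 0 < d & forall w, nm (w - a) < d ->
        forall u, nm (dq w a u - dq a a u) <= e * nm u].
Proof.
have /choice[D hD] : forall a, exists D : {linear U -> Y}, cplus a ->
    (exists2 C, 0 <= C & bounded_by D C) /\
    forall e : R, 0 < e -> exists2 d : R, 0 < d & forall w, nm (w - a) < d -> w != a ->
      forall u, nm ((w - a)^-1 *: (phi w u - phi a u) - D u) <= e * nm u.
  move=> a; have [ha|na] := pselect (cplus a); last by exists (phi a).
  by have [D h1 h2] := schur_diff ha; exists D.
have /choice[dq hdq] : forall p : R[i] * R[i], exists T : {linear U -> Y},
    forall u, T u = if p.1 == p.2 then D p.2 u else (p.1 - p.2)^-1 *: (phi p.1 u - phi p.2 u).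
  move=> p; apply: mk_linear => a x y; case: ifP => _; first by rewrite linearP.
  rewrite (linearP (phi p.1)) (linearP (phi p.2)) opprD addrACA -scalerBr scalerDr.
  by rewrite !scalerA mulrC.
exists (fun b a => dq (b, a)) => a ha; have [hC hl] := hD a ha; split.
- by move=> b u ba; rewrite hdq /= (negbTE ba).
- move=> b hb; have [ba|ba] := eqVneq b a.
    by have [C C0 h] := hC; exists C => // u; rewrite hdq /= ba eqxx; exact: h.
  exists (nm (b - a)^-1 * 2); first by rewrite mulr_ge0 ?nm_ge0.
  move=> u; rewrite hdq /= (negbTE ba) nmZ -mulrA ler_wpM2l ?nm_ge0 //.
  apply: le_trans (nmB _ _) _; have := schur_bnd hb u; have := schur_bnd ha u; lra.
- move=> e e0; have [d d0 hd] := hl e e0; exists d => // w wa u; rewrite !hdq /= eqxx.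
  have [_|nwa] := eqVneq w a; last exact: hd.
  by rewrite subrr nm0 mulr_ge0 ?nm_ge0 // ltW.
Qed.

Definition dq : R[i] -> R[i] -> {linear U -> Y} := projT1 (cid dq_exists).

Lemma dqE a b u : cplus a -> b != a -> dq b a u = (b - a)^-1 *: (phi b u - phi a u).
Proof. by move=> ha; have [h _ _] := projT2 (cid dq_exists) a ha; exact: h. Qed.
Lemma dq_bnd a b : cplus a -> cplus b -> exists2 C, 0 <= C & bounded_by (dq b a) C.
Proof. by move=> ha; have [_ h _] := projT2 (cid dq_exists) a ha; exact: h. Qed.
Lemma dq_lim a e : cplus a -> 0 < e -> exists2 d : R, 0 < d & forall w, nm (w - a) < d ->
        forall u, nm (dq w a u - dq a a u) <= e * nm u.
Proof. by move=> ha; have [_ _ h] := projT2 (cid dq_exists) a ha; exact: h. Qed.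

Lemma dq_mul a b u : cplus a -> (b - a) *: dq b a u = phi b u - phi a u.
Proof.
move=> ha; have [->|ba] := eqVneq b a; first by rewrite !subrr scale0r.
by rewrite dqE // scalerA mulfV ?scale1r // subr_eq0.
Qed.

Lemma dq_sym a b u : cplus a -> cplus b -> dq a b u = dq b a u.
Proof.
move=> ha hb; have [->//|ba] := eqVneq b a.
rewrite !dqE // 1?eq_sym // -(opprB b a) invrN scaleNr -scalerN opprB //.
Qed.

Lemma schur_cont a e : cplus a -> 0 < e -> exists2 d : R, 0 < d & forall w, nm (w - a) < d ->
  forall u, nm (phi w u - phi a u) <= e * nm u.
Proof.
move=> ha e0; have [C C0 hC] := dq_bnd ha ha; have [d d0 hd] := dq_lim ha ltr01.
have k0 : 0 < C + 1 by rewrite ltr_wpDl.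
exists (Num.min d (e / (C + 1))); first by rewrite lt_min d0 divr_gt0.
move=> w; rewrite lt_min ltr_pdivlMr // => /andP[/hd h1 h2] u.
rewrite -(dq_mul w u ha) nmZ.
have : nm (dq w a u) <= (C + 1) * nm u.
  by apply: le_trans (nm_distl _ (dq a a u)) _; have := h1 u; have := hC u; lra.
move=> /(ler_wpM2l (nm_ge0 (w - a))) /le_trans; apply.
by rewrite mulrA ler_wpM2r ?nm_ge0 // ltW.
Qed.

Lemma remove_sing_eq (V : hilbertType R) (a : R[i]) (f : R[i] -> V) (l : V) :
  (forall e : R, 0 < e -> exists2 d : R, 0 < d & forall w, nm (w - a) < d -> w != a ->
     nm (f w - l) <= e) -> remove_sing a f a = l.
Proof.
move=> h; rewrite /remove_sing eqxx.
apply: (@cvg_lim _ (@norm_hausdorff _ V)) => //.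
apply: (cvg_nm _ _).2 => e e0.
have [d d0 hd] := h _ (half_lt e0); apply/dnbhsC_nm; exists d => // w; rewrite nmC => h1 h2.
by rewrite nmC; apply: le_lt_trans (hd w h1 h2) _; lra.
Qed.

Lemma adjoint_sub_bound (S T : {linear U -> Y}) (C D c : R) y : 0 <= c ->
  bounded_by S C -> bounded_by T D -> (forall u, nm (S u - T u) <= c * nm u) ->
  nm (adjoint S y - adjoint T y) <= c * nm y.
Proof.
move=> c0 hS hT h; apply: nm_ip_bound => [|u]; first by rewrite mulr_ge0 ?nm_ge0.
rewrite ipC nmJ ipBr -(adjointE hS) -(adjointE hT) -ipBl.
by apply: le_trans (ip_CS _ _) _; rewrite mulrAC ler_wpM2r ?nm_ge0.
Qed.

Lemma adjointEl (T : {linear U -> Y}) C : bounded_by T C ->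
  forall y u, inner (adjoint T y) u = inner y (T u).
Proof. by move=> hT y u; rewrite ipC -(adjointE hT) -ipC. Qed.

Lemma adjoint_phi_cont a e : cplus a -> 0 < e -> exists2 d : R, 0 < d & forall w,
  nm (w - a) < d -> cplus w -> forall y, nm (adjoint (phi w) y - adjoint (phi a) y) <= e * nm y.
Proof.
move=> ha e0; have [d d0 hd] := schur_cont ha e0; exists d => // w wa hw y.
by apply: (adjoint_sub_bound _ (ltW e0) (schur_bnd hw) (schur_bnd ha)) => u; exact: hd.
Qed.

Lemma cplus_near (a : R[i]) : cplus a -> exists2 d : R, 0 < d & forall w, nm (w - a) < d -> cplus w.
Proof.
rewrite /cplus /= => a0; exists (complex.Re a) => // w h.
have := le_lt_trans (ler_Re_nm (w - a)) h; rewrite ReB ltr_norml => /andP[h1 _]; lra.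
Qed.

Lemma cplusJ (a : R[i]) : cplus a -> cplus (a^*).
Proof. by rewrite /cplus /= ReJ. Qed.

Lemma K12_dq lams mu v : cplus lams -> cplus mu ->
  remove_sing (lams^*) (fun m => (m - lams^*)^-1 *: (phi (lams^*) v - phi m v)) mu =
  - dq mu (lams^*) v.
Proof.
move=> /cplusJ; move: (lams^*) => a ha hmu.
have E m : m != a -> (m - a)^-1 *: (phi a v - phi m v) = - dq m a v.
  by move=> ma; rewrite dqE // -scalerN opprB.
have [->|ma] := eqVneq mu a; last by rewrite /remove_sing (negbTE ma) E.
apply: remove_sing_eq => e e0; have k0 : 0 < nm v + 1 by rewrite ltr_wpDl ?nm_ge0.
have [d d0 hd] := dq_lim ha (divr_gt0 e0 k0); exists d => // w /hd h wa.
rewrite E // -opprD nmN; apply: le_trans (h v) _.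
by rewrite mulrAC ler_pdivrMr // ler_pM2l // lerDl.
Qed.

Lemma adjoint_dq a b y : cplus a -> cplus b -> b != a ->
  adjoint (dq b a) y = ((b - a)^-1)^* *: (adjoint (phi b) y - adjoint (phi a) y).
Proof.
move=> ha hb ba; have [C _ hC] := dq_bnd ha hb; apply: (adjoint_uniq hC) => u.
by rewrite dqE // ipZl ipBl !ipZr conjCK ipBr (adjointE (schur_bnd hb)) (adjointE (schur_bnd ha)).
Qed.

(** [dq_lim] lets the first argument of [dq] vary, so [dq_sym] first moves the varying point there;
    an operator-norm limit then passes to the adjoints. *)
Lemma K21_dq lam mus y : cplus lam -> cplus mus ->
  remove_sing (lam^*) (fun m => (m - lam^*)^-1 *:
     (adjoint (phi lam) y - adjoint (phi (m^*)) y)) mus = - adjoint (dq lam (mus^*)) y.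
Proof.
move=> hl hm.
have E m : cplus m -> m != lam^* -> (m - lam^*)^-1 *: (adjoint (phi lam) y - adjoint (phi (m^*)) y) =
    - adjoint (dq lam (m^*)) y.
  move=> hm' ml; rewrite adjoint_dq //; last 2 first.
  - exact: cplusJ.
  - by apply: contra_neq ml => ->; rewrite conjCK.
  rewrite -scaleNr fmorphV rmorphB /= conjCK -invrN opprB //.
have [ml|ml] := eqVneq mus (lam^*); last by rewrite /remove_sing (negbTE ml) E.
rewrite ml conjCK; apply: remove_sing_eq => e e0.
have k0 : 0 < nm y + 1 by rewrite ltr_wpDl ?nm_ge0.
have q0 := divr_gt0 e0 k0.
have [d d0 hd] := dq_lim hl q0.
have [d' d'0 hd'] := cplus_near (cplusJ hl).
exists (Num.min d d'); first by rewrite lt_min d0.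
move=> w; rewrite lt_min => /andP[h1 /hd' hw] wl.
rewrite E // -opprD nmN.
have hw' := cplusJ hw; have [C C0 hC] := dq_bnd hw' hl; have [C1 C10 hC1] := dq_bnd hl hl.
have h2 : nm (w^* - lam) < d by rewrite -nmJ rmorphB /= conjCK.
apply: le_trans (adjoint_sub_bound y (ltW q0) hC hC1 _) _.
  by move=> u; rewrite dq_sym //; exact: hd.
by rewrite mulrAC ler_pdivrMr // ler_pM2l // lerDl.
Qed.

Definition Kdq (mu mus lam lams : R[i]) (h : Y * U) : Y * U :=
  ((mu + lam^*)^-1 *: (h.1 - phi mu (adjoint (phi lam) h.1)) - dq mu (lams^*) h.2,
   - adjoint (dq lam (mus^*)) h.1
   + (mus + lams^*)^-1 *: (h.2 - adjoint (phi (mus^*)) (phi (lams^*) h.2))).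

Lemma Ks_dq mu mus lam lams h : cplus mu -> cplus mus -> cplus lam -> cplus lams ->
  Ks phi (mu, mus) (lam, lams) h = Kdq mu mus lam lams h.
Proof. by move=> h1 h2 h3 h4; rewrite /Ks /Kdq K12_dq // K21_dq. Qed.

(* The kernel as a sesquilinear form, with [a = lams^*] and [b = mus^*]. *)
Definition kform (mu b lam a : R[i]) (h k : Y * U) : R[i] :=
  (mu + lam^*)^-1 * (inner h.1 k.1 - inner (adjoint (phi lam) h.1) (adjoint (phi mu) k.1))
  - inner (dq mu a h.2) k.1 - (inner (dq lam b k.2) h.1)^*
  + (b^* + a)^-1 * (inner h.2 k.2 - inner (phi a h.2) (phi b k.2)).

Lemma Ks_kform mu mus lam lams h k : cplus mu -> cplus mus -> cplus lam -> cplus lams ->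
  dsum_inner (Ks phi (mu, mus) (lam, lams) h) k = kform mu (mus^*) lam (lams^*) h k.
Proof.
move=> h1 h2 h3 h4; rewrite Ks_dq // /Kdq /dsum_inner /= /kform conjCK.
have [C _ hC] := dq_bnd (cplusJ h2) h3.
rewrite ipBl ipDl !ipZl !ipBl ipNl (adjointE (schur_bnd h1)) (adjointEl hC).
rewrite (adjointEl (schur_bnd (cplusJ h2))) -ipC; ring.
Qed.

Lemma kform_herm mu b lam a h k : cplus mu -> cplus b -> cplus lam -> cplus a ->
  kform mu b lam a h k = (kform lam a mu b k h)^*.
Proof.
move=> h1 h2 h3 h4; rewrite /kform !(rmorphD, rmorphN, rmorphM) /= -!ipC !fmorphV !rmorphD /= !conjCK.
by rewrite !(addrC _^*); ring.
Qed.

End DividedDifferences.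

(** * Positivity of the shifted kernel *)

Section PositivityOnLine.
Variables (R : realType) (U Y : hilbertType R) (phi : R[i] -> {linear U -> Y}).
Hypothesis phi_schur : operator_schur phi.
Local Notation dq := (dq phi_schur).
Variable (t : R).
Hypothesis t0 : 0 < t.
Local Notation approx := (approx t).

Lemma approx_conj g v : approx g v -> approx (fun z => (g z)^*) (v^*).
Proof.
move=> h e /h[T0 hT]; exists T0 => T /hT[N hN]; exists N => n /hN.
have rr : trap n (rho t) (vlow t T) (vhigh t T) = - (trap n (rho t) (vlow t T) (vhigh t T))^*.
  rewrite -(trap_conj n (rho t) (a := vlow t T) (b := vhigh t T) (t := t)) //.
  apply: (trap_ext n (@line_mid _ t)) => // z hz.
  have := rho_line hz => E; apply: oppr_inj; by rewrite -rmorphN E /= cRJ.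
rewrite (trap_conj n g (a := vlow t T) (b := vhigh t T) (t := t)) //.
move: rr; set a := trap n g _ _; set b := trap n (rho t) _ _ => rr hh.
by rewrite rr mulrN opprK -nmN opprD opprK -rmorphM -rmorphB nmJ.
Qed.

Lemma inner_cdiff u y z : cplus z -> cdiff (fun w => inner (phi w u) y) z.
Proof.
move=> hz; exists (fun w => inner (dq w z u) y); last first.
  exists 1 => // w _; have := dq_mul phi_schur w u hz => E.
  by rewrite mulrC -ipZl E ipBl; ring.
move=> e e0; have k0 : 0 < nm u * nm y + 1 by rewrite ltr_wpDl ?mulr_ge0 ?nm_ge0.
have [d d0 hd] := dq_lim phi_schur hz (divr_gt0 e0 k0); exists d => // w /hd h.
rewrite -ipBl; apply: le_lt_trans (ip_CS _ _) _.
apply: le_lt_trans (ler_wpM2r (nm_ge0 y) (h u)) _.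
rewrite -mulrA mulrAC ltr_pdivrMr // ltr_pM2l //; lra.
Qed.

Lemma inner_bnd u y z : cplus z -> nm (inner (phi z u) y) <= nm u * nm y.
Proof.
move=> hz; apply: le_trans (ip_CS _ _) _; rewrite ler_wpM2r ?nm_ge0 //.
by have := schur_bnd phi_schur hz u; rewrite mul1r.
Qed.

(** Reflection in the line Re z = t. *)
Definition refl (c : R[i]) : R[i] := cR (2 * t) - c^*.

Lemma refl_Re c : t < complex.Re c -> complex.Re (refl c) < t.
Proof. by rewrite /refl ReB Re_cR ReJ => h; lra. Qed.

Lemma line_conj_pole c z : complex.Re z = t -> ((z - c)^-1)^* = - (z - refl c)^-1.
Proof.
move=> hz; rewrite fmorphV rmorphB /= (conj_line hz) -invrN /refl; congr (_^-1).
by ring.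
Qed.

(* As a function of [z] on the line [Re z = t], the first term lies in the Hardy
   space of the half plane to the right of the line, the second in that to its left. *)
Definition bvec (V : hilbertType R) (l a z : R[i]) (x y : V) : V :=
  (z - refl l)^-1 *: x + (z - a)^-1 *: y.

Definition ldist (l l' : R[i]) : R[i] := l + l'^* - cR (2 * t).

Lemma ldistE l l' : l - refl l' = ldist l l'.
Proof. by rewrite /refl /ldist; ring. Qed.

Section TwoPoints.
Variables (l a l' a' : R[i]).
Hypotheses (lt1 : t < complex.Re l) (at1 : t < complex.Re a)
  (lt2 : t < complex.Re l') (at2 : t < complex.Re a').

(** Of the four products of fractions, those with both poles on one side integrate to 0: the two
    Hardy spaces are orthogonal. *)
Lemma approx_bvec (V : hilbertType R) (x y x' y' : V) :
  approx (fun z => inner (bvec l a z x y) (bvec l' a' z x' y'))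
    (- 2 * (inner x x' / ldist l' l + inner y y' / ldist a a')).
Proof.
have rl := refl_Re lt1; have ra := refl_Re at2.
have h1 := approxZ (- inner x x') (pole2_RL t0 lt2 rl).
have h2 := approxZ (- inner y y') (pole2_RL t0 at1 ra).
have h3 := approxZ (- inner x y') (pole2_LL t0 rl ra).
have h4 := approxZ (- inner y x') (pole2_RR t0 at1 lt2).
have := approxD (approxD h1 h2) (approxD h3 h4).
rewrite !mulr0 !addr0 !ldistE.
rewrite (_ : _ + _ = - 2 * (inner x x' / ldist l' l + inner y y' / ldist a a')); last by ring.
apply: approx_ext => z hz.
rewrite /bvec !ipDl !ipDr !ipZl !ipZr !(line_conj_pole _ hz) /pole2 !invfM.
have -> : refl (refl l') = l' by rewrite /refl rmorphB /= conjCK cRJ; ring.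
ring.
Qed.

(** Products with one pole on each side give the values of [phi] at [l'] and [a], the product with
    both of these poles gives the divided difference, and two poles on the left give 0. The
    condition [l' != a] keeps the poles simple. *)
Lemma approx_phi_bvec (x : U) (y : U) (x' y' : Y) : l' != a ->
  approx (fun z => inner (phi z (bvec l a z x y)) (bvec l' a' z x' y'))
    (- 2 * (inner (phi l' x) x' / ldist l' l + inner (phi a y) y' / ldist a a'
       + inner (dq l' a y) x')).
Proof.
move=> la.
have rl := refl_Re lt1; have ra := refl_Re at2.
have c0 c : t < complex.Re c -> cplus c by move=> h; exact: lt_trans h.
have F1 u v := @residue_RL _ _ t0 (fun w => inner (phi w u) v) (nm u * nm v)
  (fun z => @inner_cdiff u v z) (fun z => @inner_bnd u v z).
have F2 u v := @residue_RR _ _ t0 (fun w => inner (phi w u) v) (nm u * nm v)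
  (fun z => @inner_cdiff u v z) (fun z => @inner_bnd u v z).
have F3 u v := @residue_LL _ _ t0 (fun w => inner (phi w u) v) (nm u * nm v)
  (fun z => @inner_cdiff u v z) (fun z => @inner_bnd u v z).
have h1 := approxZ (-1) (F1 x x' _ _ lt2 rl).
have h2 := approxZ (-1) (F1 y y' _ _ at1 ra).
have h3 := approxZ (-1) (F3 x y' _ _ rl ra).
have h4 := approxZ (-1) (F2 y x' _ _ lt2 at1 la).
have := approxD (approxD h1 h2) (approxD h3 h4).
have E : 2 * (inner (phi l' y) x' - inner (phi a y) x') / (l' - a) = 2 * inner (dq l' a y) x'.
  by rewrite -mulrA (dqE phi_schur y (c0 _ at1) la) ipZl ipBl; ring.
rewrite E mulr0 add0r !ldistE.
rewrite (_ : _ + _ = - 2 * (inner (phi l' x) x' / ldist l' l + inner (phi a y) y' / ldist a a' + inner (dq l' a y) x')); last by ring.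
apply: approx_ext => z hz.
rewrite /bvec (linearD (phi z)) !(linearZ_LR (phi z)) !ipDl !ipDr !ipZl !ipZr !(line_conj_pole _ hz) /pole2 !invfM.
have -> : refl (refl l') = l' by rewrite /refl rmorphB /= conjCK cRJ; ring.
ring.
Qed.

End TwoPoints.

(* The kernel with all points shifted by [- t]. *)
Definition kform_shift (mu b lam a : R[i]) (h k : Y * U) : R[i] :=
  (inner h.1 k.1 - inner (adjoint (phi lam) h.1) (adjoint (phi mu) k.1)) / ldist mu lam
  - inner (dq mu a h.2) k.1 - (inner (dq lam b k.2) h.1)^*
  + (inner h.2 k.2 - inner (phi a h.2) (phi b k.2)) / ldist a b.

(* The integral over the line of [|F|^2 + |E|^2 - 2 Re <phi E, F>] is nonnegative,
   since [phi] is contractive; the residue theorem turns it into the double sum. *)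
Lemma kform_shift_pos (N : nat) (l a : 'I_N -> R[i]) (h : 'I_N -> Y * U) :
  (forall j, t < complex.Re (l j)) -> (forall j, t < complex.Re (a j)) ->
  (forall j k, l j != a k) ->
  0 <= \sum_(j < N) \sum_(k < N) kform_shift (l j) (a j) (l k) (a k) (h k) (h j).
Proof.
move=> lt at_ la.
have c0 c : t < complex.Re c -> cplus c by move=> hc; exact: lt_trans hc.
(* With these coefficients each diagonal product of [phi] occurs once with a plus sign, from |F|^2
   or |E|^2, and twice with a minus sign, from the cross terms; this leaves the numerators of the
   kernel. *)
pose F k z := bvec (l k) (a k) z (h k).1 (phi (a k) (h k).2).
pose E k z := bvec (l k) (a k) z (adjoint (phi (l k)) (h k).1) (h k).2.
pose Q z := \sum_(j < N) \sum_(k < N) (inner (F k z) (F j z) + inner (E k z) (E j z)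
   - inner (phi z (E k z)) (F j z) - (inner (phi z (E j z)) (F k z))^*).
have Q0 z : vline t z -> 0 <= Q z.
  move=> hz; have hz0 : cplus z by rewrite /cplus /= hz.
  pose FF := \sum_(k < N) F k z; pose EE := \sum_(k < N) E k z.
  have -> : Q z = inner FF FF + inner EE EE - inner (phi z EE) FF - (inner (phi z EE) FF)^*.
    have sw (V : hilbertType R) (G H : 'I_N -> V) : inner (\sum_k G k) (\sum_j H j) =
        \sum_(j < N) \sum_(k < N) inner (G k) (H j).
      by rewrite ip_sumr; apply: eq_bigr => j _; rewrite ip_suml.
    rewrite /FF /EE (linear_sum (phi z)) !sw rmorph_sum /=.
    have -> : \sum_(j < N) (\sum_(k < N) inner (phi z (E k z)) (F j z))^* =
       \sum_(j < N) \sum_(k < N) (inner (phi z (E j z)) (F k z))^*.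
      rewrite exchange_big /=; apply: eq_bigr => j _; rewrite rmorph_sum //.
    rewrite -!big_split /= -!sumrB; apply: eq_bigr => j _.
    by rewrite -!big_split /= -!sumrB.
  (* The expression equals |F - phi E|^2 + |E|^2 - |phi E|^2. *)
  have := sqr_ge0 (nm (FF - phi z EE)); rewrite nm_sqrB /rip.
  have h1 := schur_bnd phi_schur hz0 EE; rewrite mul1r in h1.
  have h2 : nm (phi z EE) ^+ 2 <= nm EE ^+ 2 by rewrite lerXn2r ?nnegrE ?nm_ge0.
  rewrite !ip_nm (ipC (phi z EE)) ReJ; move: (inner (phi z EE) FF) => x hx.
  have -> : cR (nm FF ^+ 2) + cR (nm EE ^+ 2) - x - x^* =
      cR (nm FF ^+ 2) + cR (nm EE ^+ 2) - (x + x^*) by ring.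
  by rewrite addJ -cRD -cRB -(cR0 R) cR_le; lra.
have Qa : approx Q (- 2 * \sum_(j < N) \sum_(k < N) kform_shift (l j) (a j) (l k) (a k) (h k) (h j)).
  rewrite mulr_sumr; apply: approx_sum => j; rewrite mulr_sumr; apply: approx_sum => k.
  have A1 := approx_bvec (lt k) (at_ k) (lt j) (at_ j) (h k).1 (phi (a k) (h k).2) (h j).1 (phi (a j) (h j).2).
  have A2 := approx_bvec (lt k) (at_ k) (lt j) (at_ j) (adjoint (phi (l k)) (h k).1) (h k).2 (adjoint (phi (l j)) (h j).1) (h j).2.
  have A3 := approx_phi_bvec (lt k) (at_ k) (lt j) (at_ j) (adjoint (phi (l k)) (h k).1) (h k).2 (h j).1 (phi (a j) (h j).2) (la j k).
  have A4 := approx_conj (approx_phi_bvec (lt j) (at_ j) (lt k) (at_ k) (adjoint (phi (l j)) (h j).1) (h j).2 (h k).1 (phi (a k) (h k).2) (la k j)).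
  have := approxD (approxD (approxD A1 A2) (approxZ (-1) A3)) (approxZ (-1) A4).
  rewrite (_ : _ + _ = - 2 * kform_shift (l j) (a j) (l k) (a k) (h k) (h j)).
    by apply: approx_ext => z hz; rewrite /F /E; ring.
  have conjE (p q r d e : R[i]) : (- 2 * (p / d + q / e + r))^* = - 2 * (p^* / d^* + q^* / e^* + r^*).
    by rewrite rmorphM rmorphN /= conjC_nat !rmorphD !rmorphM /= !fmorphV.
  rewrite /kform_shift conjE.
  have ld c d : (ldist c d)^* = ldist d c.
    by rewrite /ldist rmorphB rmorphD /= conjCK cRJ; ring.
  rewrite !ld -!ipC.
  rewrite (adjointE (schur_bnd phi_schur (c0 _ (lt j)))).
  rewrite -(adjointEl (schur_bnd phi_schur (c0 _ (lt k)))) .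
  ring.
have := approx_pos Q0 Qa; rewrite mulNr opprK.
by rewrite pmulr_rge0 // ltr0n.
Qed.

End PositivityOnLine.

(** * Passage to the imaginary axis *)

Section KernelPositivity.
Variables (R : realType) (U Y : hilbertType R) (phi : R[i] -> {linear U -> Y}).
Hypothesis phi_schur : operator_schur phi.
Local Notation dq := (dq phi_schur).

Lemma ccont_sum (I : Type) (r : seq I) (P : pred I) (f : I -> R[i] -> R[i]) z :
  (forall i, ccont (f i) z) -> ccont (fun w => \sum_(i <- r | P i) f i w) z.
Proof.
move=> h; elim: r => [|i r IH].
  by apply: (@ccont_near _ (fun=> 0)); [exists 1 => // w _; rewrite big_nil|exact: ccont_cst].
case Pi : (P i).
  apply: (@ccont_near _ (fun w => f i w + \sum_(i <- r | P i) f i w)); last exact: ccontD.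
  by exists 1 => // w _; rewrite big_cons Pi.
apply: (@ccont_near _ (fun w => \sum_(i <- r | P i) f i w)); last exact: IH.
by exists 1 => // w _; rewrite big_cons Pi.
Qed.

Lemma ccont_conj (f : R[i] -> R[i]) z : ccont f z -> ccont (fun w => (f w)^*) z.
Proof. by move=> h e /h[d d0 hd]; exists d => // w /hd; rewrite -rmorphB nmJ. Qed.

Lemma ccontN (f : R[i] -> R[i]) z : ccont f z -> ccont (fun w => - f w) z.
Proof. by move=> h e /h[d d0 hd]; exists d => // w /hd; rewrite -opprD nmN. Qed.

Lemma ccont_shift (f : R[i] -> R[i]) z : ccont f z -> ccont (fun w => f (z + w)) 0.
Proof.
move=> h e /h[d d0 hd]; exists d => // w; rewrite subr0 addr0 => hw; apply: hd.
by rewrite addrAC subrr add0r.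
Qed.

Lemma ccont_ge0 (s : R[i] -> R[i]) (d : R) : ccont s 0 -> 0 < d ->
  (forall r, 0 < r -> r < d -> 0 <= s (cR r)) -> 0 <= s 0.
Proof.
move=> sc d0 sp.
have key e : 0 < e -> `|complex.Im (s 0)| <= e /\ - e <= complex.Re (s 0).
  move=> e0; have [d' d'0 hd'] := sc e e0.
  pose r := Num.min d d' / 2.
  have m0 : 0 < Num.min d d' by rewrite lt_min d0.
  have r0 : 0 < r by rewrite divr_gt0.
  have rm : r < Num.min d d' by rewrite /r; lra.
  move: rm; rewrite lt_min => /andP[rd rd'].
  have := hd' (cR r); rewrite subr0 nm_cR0 ?(ltW r0) // => /(_ rd') h.
  have := sp r r0 rd; rewrite lecE => /andP[/eqP i0 re0].
  have := ler_Im_nm (s (cR r) - s 0); have := ler_Re_nm (s (cR r) - s 0).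
  rewrite ReB ImB i0 /= sub0r normrN ler_norml => /andP[h1 h2] h3.
  move: re0 => /= re0; split; lra.
have im0 : complex.Im (s 0) = 0.
  apply/eqP; rewrite -normr_eq0 eq_le normr_ge0 andbT; apply/ler_addgt0Pr => e /key[+ _].
  by rewrite add0r.
rewrite lecE im0 eqxx /= -oppr_le0; apply/ler_addgt0Pr => e /key[_]; lra.
Qed.

Lemma adjoint_ip_cont l l' y y' : cplus l -> cplus l' ->
  ccont (fun w => inner (adjoint (phi (l + w)) y) (adjoint (phi (l' + w)) y')) 0.
Proof.
move=> hl hl' e e0.
pose q := e / (2 * (nm y * nm y' + 1)).
have yy : 0 <= nm y * nm y' by rewrite mulr_ge0 ?nm_ge0.
have q0 : 0 < q by rewrite divr_gt0 // mulr_gt0 // ltr_wpDl.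
have [d1 d10 h1] := adjoint_phi_cont phi_schur hl q0.
have [d2 d20 h2] := adjoint_phi_cont phi_schur hl' q0.
have [d3 d30 h3] := cplus_near hl; have [d4 d40 h4] := cplus_near hl'.
exists (Num.min (Num.min d1 d2) (Num.min d3 d4)); first by rewrite !lt_min d10 d20 d30.
move=> w; rewrite subr0 !addr0 !lt_min => /andP[/andP[w1 w2] /andP[w3 w4]].
have E c : c + w - c = w by rewrite addrAC subrr add0r.
have c1 : cplus (l + w) by apply: h3; rewrite E.
have c2 : cplus (l' + w) by apply: h4; rewrite E.
have {}h1 := h1 (l + w) (ltac:(by rewrite E)) c1 y.
have {}h2 := h2 (l' + w) (ltac:(by rewrite E)) c2 y'.
have a1 := adjoint_bounded ler01 (schur_bnd phi_schur hl) y.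
have a2 := adjoint_bounded ler01 (schur_bnd phi_schur c2) y'.
rewrite mul1r in a1; rewrite mul1r in a2.
set A := adjoint (phi (l + w)) y in h1 *; set B := adjoint (phi (l' + w)) y' in h2 a2 *.
set A0 := adjoint (phi l) y in h1 a1 *; set B0 := adjoint (phi l') y' in h2 *.
have -> : inner A B - inner A0 B0 = inner (A - A0) B + inner A0 (B - B0).
  by rewrite ipBl ipBr addrA subrK.
apply: le_lt_trans (nmD _ _) _.
have g1 : nm (inner (A - A0) B) <= q * nm y * nm y'.
  by apply: le_trans (ip_CS _ _) _; rewrite ler_pM ?nm_ge0.
have g2 : nm (inner A0 (B - B0)) <= nm y * (q * nm y').
  by apply: le_trans (ip_CS _ _) _; rewrite ler_pM ?nm_ge0.
apply: le_lt_trans (lerD g1 g2) _.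
rewrite (_ : q * nm y * nm y' + nm y * (q * nm y') = q * (2 * (nm y * nm y'))); last by ring.
have -> : e = q * (2 * (nm y * nm y' + 1)) by rewrite /q; field; rewrite gt_eqF // ltr_wpDl.
rewrite ltr_pM2l //; lra.
Qed.

Lemma dq_ip_cont l a u y : cplus l -> cplus a -> ccont (fun w => inner (dq (l + w) a u) y) 0.
Proof.
move=> hl ha; apply: (@ccont_shift (fun w => inner (dq w a u) y)).
have [->|la] := eqVneq l a.
  move=> e e0; have k0 : 0 < nm u * nm y + 1 by rewrite ltr_wpDl ?mulr_ge0 ?nm_ge0.
  have [d d0 hd] := dq_lim phi_schur ha (divr_gt0 e0 k0); exists d => // w /hd h.
  rewrite -ipBl; apply: le_lt_trans (ip_CS _ _) _.
  apply: le_lt_trans (ler_wpM2r (nm_ge0 y) (h u)) _.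
  rewrite -mulrA mulrAC ltr_pdivrMr // ltr_pM2l //; lra.
apply: (@ccont_near _ (fun w => (w - a)^-1 * (inner (phi w u) y + - inner (phi a u) y))).
  have [d d0 hd] := @ccont_neq0 _ (fun w => w - a) l (ltac:(by rewrite subr_eq0))
    (ccontD (@ccont_id _ l) (ccont_cst _ _)).
  by exists d => // w /hd; rewrite subr_eq0 => wa; rewrite (dqE _ _ ha wa) ipZl ipBl.
apply: ccontM; first exact: (cdiff_cont (pole_cdiff la)).
by apply: ccontD; [exact: (cdiff_cont (inner_cdiff phi_schur u y hl))|exact: ccont_cst].
Qed.

Lemma small_bound (N : nat) (x : 'I_N -> R) : (forall i, 0 < x i) ->
  exists2 d : R, 0 < d & forall i, d <= x i.
Proof.
move=> x0; exists (\big[Num.min/1]_i x i).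
  by elim/big_ind: _ => // a b a0 b0; rewrite lt_min a0.
by move=> i; rewrite (bigD1 i) //= ge_min lexx.
Qed.

(** The double sum is continuous in the shift even where points coincide, because [dq] has absorbed
    the singularity; [kform_shift_pos] covers all small positive shifts. *)
Lemma kform_pos (N : nat) (l a : 'I_N -> R[i]) (h : 'I_N -> Y * U) :
  (forall j, cplus (l j)) -> (forall j, cplus (a j)) ->
  0 <= \sum_(j < N) \sum_(k < N) kform phi_schur (l j) (a j) (l k) (a k) (h k) (h j).
Proof.
move=> hl ha.
(* With the line [Re z = w] and the points [l j + w], the first diagonal block has denominators free of [w]. *)
pose K w j k := (inner (h k).1 (h j).1 - inner (adjoint (phi (l k + w)) (h k).1) (adjoint (phi (l j + w)) (h j).1))
     * (l j + (l k)^*)^-1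
  - inner (dq (l j + w) (a k) (h k).2) (h j).1 - (inner (dq (l k + w) (a j) (h j).2) (h k).1)^*
  + (inner (h k).2 (h j).2 - inner (phi (a k) (h k).2) (phi (a j) (h j).2)) * (a k + (a j)^* + - (2 * w))^-1.
have -> : \sum_(j < N) \sum_(k < N) kform phi_schur (l j) (a j) (l k) (a k) (h k) (h j) =
    \sum_(j < N) \sum_(k < N) K 0 j k.
  apply: eq_bigr => j _; apply: eq_bigr => k _.
  by rewrite /K /kform !addr0 mulr0 subr0 (addrC (a k)); ring.
have Kc j k : ccont (fun w => K w j k) 0.
  rewrite /K; apply: ccontD.
    apply: ccontD; last by apply: ccontN; apply: ccont_conj; exact: dq_ip_cont.
    apply: ccontD; last by apply: ccontN; exact: dq_ip_cont.
    apply: ccontM; last exact: ccont_cst.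
    by apply: ccontD; [exact: ccont_cst|apply: ccontN; exact: adjoint_ip_cont].
  apply: ccontM; first exact: ccont_cst.
  apply: ccontV.
    rewrite mulr0 subr0; apply/eqP => /(congr1 (@complex.Re R)); rewrite ReD ReJ /=.
    by have := ha j; have := ha k; rewrite /cplus /=; lra.
  apply: ccontD; first exact: ccont_cst.
  by apply: ccontN; apply: ccontM; [exact: ccont_cst|exact: ccont_id].
have [d1 d10 h1] := small_bound ha.
(* For each pair at most one real shift makes the points coincide; d stays below all the positive
   ones. *)
have [d2 d20 h2] : exists2 d : R, 0 < d & forall j k r, 0 < r -> r < d -> l j + cR r != a k.
  pose x (p : 'I_N * 'I_N) := let s := complex.Re (a p.2 - l p.1) in if 0 < s then s else 1.
  have [|d d0 hd] := @small_bound #|{: 'I_N * 'I_N}| (fun i => x (enum_val i)).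
    by move=> i; rewrite /x; case: ifP.
  exists d => // j k r r0 rd; apply/eqP => E.
  have := hd (enum_rank (j, k)); rewrite enum_rankK /x /= -E addrAC subrr add0r Re_cR r0.
  by rewrite leNgt rd.
apply: (@ccont_ge0 (fun w => \sum_(j < N) \sum_(k < N) K w j k) (Num.min d1 d2)).
- by apply: ccont_sum => j; apply: ccont_sum => k; exact: Kc.
- by rewrite lt_min d10.
move=> r r0; rewrite lt_min => /andP[rd1 rd2].
have := @kform_shift_pos _ _ _ _ phi_schur r r0 N (fun j => l j + cR r) a h.
have -> : \sum_(j < N) \sum_(k < N) kform_shift phi_schur r (l j + cR r) (a j) (l k + cR r) (a k) (h k) (h j) =
    \sum_(j < N) \sum_(k < N) K (cR r) j k.
  apply: eq_bigr => j _; apply: eq_bigr => k _; rewrite /K /kform_shift /ldist.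
  have E2 : cR (2 * r) = 2 * cR r by rewrite cRM; congr (_ * _); rewrite /cR rmorphMn rmorph1.
  rewrite rmorphD /= cRJ E2; congr (_ * _^-1 - _ - _ + _ * _^-1); ring.
apply => [j|j|j k].
- by rewrite ReD Re_cR; have := hl j; rewrite /cplus /=; lra.
- exact: lt_le_trans (h1 j).
- exact: h2.
Qed.

Lemma Ks_positive : positive_kernel (@cplus2 R) (Ks phi).
Proof.
move=> N w h hw.
have := @kform_pos N (fun j => (w j).1) (fun j => ((w j).2)^*) h
  (fun j => (hw j).1) (fun j => cplusJ (hw j).2).
congr (0 <= _); apply: eq_bigr => j _; apply: eq_bigr => k _.
have [h1 h2] := hw j; have [h3 h4] := hw k.
by rewrite -Ks_kform // -!surjective_pairing.
Qed.

Lemma Ks_herm w z h k : cplus2 w -> cplus2 z ->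
  dsum_inner (Ks phi w z h) k = (dsum_inner (Ks phi z w k) h)^*.
Proof.
case: w z => [mu mus] [lam lams] [/= h1 h2] [/= h3 h4].
by rewrite !(Ks_kform phi_schur) // (kform_herm phi_schur) //; exact: cplusJ.
Qed.

Lemma Ks_bound w : cplus2 w -> exists2 C : R, 0 <= C & forall h,
  nm (Ks phi w w h).1 <= C * (nm h.1 + nm h.2) /\ nm (Ks phi w w h).2 <= C * (nm h.1 + nm h.2).
Proof.
case: w => mu mus [h1 h2]; rewrite /fst in h1; rewrite /snd in h2.
have c2 := cplusJ h2.
have [C C0 hC] := dq_bnd phi_schur c2 h1.
pose A := nm (mu + mu^*)^-1 * 2; pose B := nm (mus + mus^*)^-1 * 2.
have A0 : 0 <= A by rewrite mulr_ge0 ?nm_ge0.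
have B0 : 0 <= B by rewrite mulr_ge0 ?nm_ge0.
exists (A + B + C); first by rewrite !addr_ge0.
move=> h; rewrite (Ks_dq phi_schur) // /Kdq /=.
have n1 := nm_ge0 h.1; have n2 := nm_ge0 h.2.
have p1 := schur_bnd phi_schur h1; have p2 := schur_bnd phi_schur c2.
have q1 := adjoint_bounded ler01 p1; have q2 := adjoint_bounded ler01 p2.
have q3 := adjoint_bounded C0 hC.
have e1 : nm (h.1 - phi mu (adjoint (phi mu) h.1)) <= 2 * nm h.1.
  apply: le_trans (nmB _ _) _; have := p1 (adjoint (phi mu) h.1); have := q1 h.1; lra.
have e2 : nm (h.2 - adjoint (phi mus^*) (phi mus^* h.2)) <= 2 * nm h.2.
  apply: le_trans (nmB _ _) _; have := q2 (phi mus^* h.2); have := p2 h.2; lra.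
have f1 : nm ((mu + mu^*)^-1 *: (h.1 - phi mu (adjoint (phi mu) h.1))) <= A * nm h.1.
  by rewrite nmZ /A -mulrA ler_wpM2l ?nm_ge0.
have f2 : nm ((mus + mus^*)^-1 *: (h.2 - adjoint (phi mus^*) (phi mus^* h.2))) <= B * nm h.2.
  by rewrite nmZ /B -mulrA ler_wpM2l ?nm_ge0.
have g1 := hC h.2; have g2 := q3 h.1.
have := mulr_ge0 A0 n1; have := mulr_ge0 A0 n2; have := mulr_ge0 B0 n1; have := mulr_ge0 B0 n2.
have := mulr_ge0 C0 n1; have := mulr_ge0 C0 n2 => *; split.
  by apply: le_trans (nmB _ _) _; lra.
by apply: le_trans (nmD _ _) _; rewrite nmN; lra.
Qed.

Lemma Ks_rkhs : inhabited (rkhs (@cplus2 R) (Ks phi)).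
Proof. exact: (rkhs_exists Ks_herm Ks_positive Ks_bound). Qed.

End KernelPositivity.

(** * Generation of contraction semigroups *)

(** Pairing with an arbitrary vector turns an identity between vectors into a ring identity between
    scalars. *)
Ltac vring := apply: ip_eq => ?; rewrite ?(ipDl, ipNl, ipZl, ip0l); ring.

(** Let v be orthogonal to the domain and v = lam x' - z' with (x', z') in A. Pairing with x' gives
    Re lam |x'|^2 = Re <z', x'> <= 0, so x' = 0, z' = 0 and v = 0. *)
Lemma dissipative_dense (R : realType) (X : hilbertType R) (A : set (X * X)) (lam : R[i]) :
  linear_operator A -> (forall x z, A (x, z) -> rip z x <= 0) -> cplus lam ->
  (forall f, exists x z, A (x, z) /\ lam *: x - z = f) ->
  forall x (e : R), 0 < e -> exists x' z', A (x', z') /\ nm (x - x') < e.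
Proof.
move=> A_lin A_diss lam0 A_range x e e0.
have : closure (lin_span [set x | exists z, A (x, z)]) x.
  rewrite total_dense // => v hv.
  have [x' [z' [Ax' E']]] := A_range v.
  have := hv x' (ex_intro _ z' Ax'); rewrite -E' ipBl ipZl ip_nm => /(congr1 (@complex.Re R)).
  rewrite ReB ReM Re_cR Im_cR mulr0 subr0 -/(rip _ _) => h.
  have := A_diss _ _ Ax'; have := sqr_ge0 (nm x') => h1 h2.
  have : complex.Re lam * nm x' ^+ 2 <= 0 by move: h => /=; lra.
  rewrite pmulr_rle0 // => h3; have /eqP : nm x' ^+ 2 = 0 by apply/eqP; rewrite eq_le h3.
  rewrite sqrf_eq0 => /eqP/nm_eq0 x'0; move: Ax'; rewrite x'0.
  by case: A_lin => A0 _ Af => /Af /(_ A0) z0; rewrite ?x'0 z0 scaler0 subr0.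
move=> /closure_nm /(_ e e0)[x' [n [c [v [hv ->]]]] hx].
have /choice[w hw] := hv.
exists (\sum_i c i *: v i), (\sum_i c i *: w i); split => //.
elim/big_rec2: _ => [|i p q _ h]; first by case: A_lin.
by case: A_lin => _ /(_ (c i) (v i, w i) (q, p)) + _; apply.
Qed.

Section LumerPhillips.
Variables (R : realType) (X : hilbertType R) (A : set (X * X)).
Hypothesis A_lin : linear_operator A.
Hypothesis A_diss : forall x z, A (x, z) -> rip z x <= 0.
Hypothesis A_range : forall (r : R) f, 0 < r -> exists x z, A (x, z) /\ cR r *: x - z = f.
Implicit Types (x y z f : X) (a b h s t : R) (n m : nat).

Lemma A_comb (a : R[i]) x z x' z' : A (x, z) -> A (x', z') -> A (a *: x + x', a *: z + z').
Proof. by case: A_lin => _ /(_ a (x, z) (x', z')) h _; exact: h. Qed.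
Lemma A_sub x z x' z' : A (x, z) -> A (x', z') -> A (x - x', z - z').
Proof.
move=> h h'; have := A_comb (-1) h' h.
by rewrite !scaleN1r [- x' + _]addrC [- z' + _]addrC.
Qed.

Lemma A_range1 h f : 0 < h -> exists p : X * X, A p /\ p.1 - cR h *: p.2 = f.
Proof.
move=> h0; have hi : 0 < h^-1 by rewrite invr_gt0.
have [x [z [Axz E]]] := A_range (cR h^-1 *: f) hi.
exists (x, z); split=> //=.
have := congr1 (fun u => cR h *: u) E; rewrite scalerBr !scalerA -!cRM mulfV ?gt_eqF //.
by rewrite !scale1r.
Qed.

(* [J h] is [(1 - h A)^-1]; [JZ h f] also records [A (J h f)]. *)
Definition JZ h f : X * X := get [set p : X * X | A p /\ p.1 - cR h *: p.2 = f].
Definition J h f : X := (JZ h f).1.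

Lemma JZ_spec h f : 0 < h -> A (JZ h f) /\ (JZ h f).1 - cR h *: (JZ h f).2 = f.
Proof.
move=> h0; have [p hp] := A_range1 f h0.
exact: (@getPex _ [set p : X * X | A p /\ p.1 - cR h *: p.2 = f] (ex_intro _ p hp)).
Qed.

Lemma A_contr h x z : 0 < h -> A (x, z) -> nm x <= nm (x - cR h *: z).
Proof.
move=> h0 /A_diss d.
have h1 : nm x ^+ 2 <= nm (x - cR h *: z) * nm x.
  apply: le_trans (rip_CS _ _); rewrite ripBl rip_nm ripZl.
  have : h * rip z x <= 0 by rewrite pmulr_rle0.
  by rewrite expr2; lra.
have [->|x0] := eqVneq x 0; first by rewrite nm0 nm_ge0.
by rewrite -(ler_pM2r (nm_pos x0)) -expr2.
Qed.

Lemma subr4 (V : zmodType) (a b c d : V) : a - b - (c - d) = (a - c) - (b - d).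
Proof. by rewrite !opprB [d - c]addrC addrACA [- b + d]addrC. Qed.

Lemma J_uniq h x z : 0 < h -> A (x, z) -> J h (x - cR h *: z) = x.
Proof.
move=> h0 Axz; have [AJ EJ] := JZ_spec (x - cR h *: z) h0.
apply/eqP; rewrite -subr_eq0; apply/eqP/nm_eq0/eqP.
rewrite eq_le nm_ge0 andbT /J; move: AJ EJ; case: (JZ _ _) => x' z' /= AJ EJ.
have := A_contr h0 (A_sub AJ Axz); rewrite scalerBr subr4.
by rewrite EJ subrr nm0.
Qed.

Lemma J_contr h f : 0 < h -> nm (J h f) <= nm f.
Proof.
move=> h0; have [AJ EJ] := JZ_spec f h0; rewrite -[X in _ <= nm X]EJ.
by apply: A_contr => //; rewrite -surjective_pairing.
Qed.

Lemma J_lin h (a : R[i]) f g : 0 < h -> J h (a *: f + g) = a *: J h f + J h g.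
Proof.
move=> h0; have [AJ EJ] := JZ_spec f h0; have [AJ' EJ'] := JZ_spec g h0.
rewrite /J; move: AJ EJ AJ' EJ'; case: (JZ h f) => x z; case: (JZ h g) => x' z' /=.
move=> AJ <- AJ' <-; have := J_uniq h0 (A_comb a AJ AJ'); rewrite /J => <-.
congr (JZ h _).1; rewrite scalerBr [cR h *: (_ + _)]scalerDr opprD addrACA.
by rewrite !scalerA (mulrC (cR h)).
Qed.

Lemma JB h f g : 0 < h -> J h (f - g) = J h f - J h g.
Proof.
by move=> h0; have := J_lin (-1) g f h0; rewrite !scaleN1r [- g + _]addrC => ->; rewrite addrC.
Qed.
Lemma JZs h (a : R[i]) f : 0 < h -> J h (a *: f) = a *: J h f.
Proof.
move=> h0; have J0 : J h 0 = 0 by rewrite -(subrr f) JB // !subrr.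
by have := J_lin a f 0 h0; rewrite J0 !addr0.
Qed.

Lemma J_eq h f x z : 0 < h -> A (x, z) -> x - cR h *: z = f -> J h f = x.
Proof. by move=> h0 Axz <-; exact: J_uniq. Qed.

Lemma J_dom h f : 0 < h -> exists2 z, A (J h f, z) & J h f - cR h *: z = f.
Proof.
move=> h0; have [AJ EJ] := JZ_spec f h0; exists (JZ h f).2 => //.
by rewrite /J -surjective_pairing.
Qed.

Lemma J_A h x z : 0 < h -> A (x, z) -> A (J h x, J h z).
Proof.
move=> h0 Axz; have [w Aw Ew] := J_dom x h0; suff -> : J h z = w by [].
have hn : cR h != 0 by rewrite cR_eq0 gt_eqF.
have E1 : J h (x - cR h *: z) = x by exact: J_uniq.
rewrite JB // JZs // in E1.
have E2 : cR h *: w = cR h *: J h z.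
  by apply: oppr_inj; apply: (addrI (J h x)); rewrite Ew E1.
by have := congr1 (fun u => (cR h)^-1 *: u) E2; rewrite !scalerA mulVf // !scale1r.
Qed.

Lemma J_sub h x z : 0 < h -> A (x, z) -> J h x - x = cR h *: J h z.
Proof.
move=> h0 Axz; have E1 := J_uniq h0 Axz; rewrite JB // JZs // in E1.
by rewrite -[X in _ - X]E1 subKr.
Qed.

Lemma J_near h x z : 0 < h -> A (x, z) -> nm (J h x - x) <= h * nm z.
Proof.
move=> h0 Axz; rewrite (J_sub h0 Axz) nmZ nm_cR0 ?(ltW h0) // ler_pM2l //.
exact: J_contr.
Qed.

Lemma J_comm a b f : 0 < a -> 0 < b -> J a (J b f) = J b (J a f).
Proof.
move=> a0 b0; have [z Az Ez] := J_dom f a0.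
apply: (J_eq a0 (J_A b0 Az)); by rewrite -JZs // -JB // Ez.
Qed.

Definition dom2 x y := exists2 z, A (x, z) & A (z, y).

Lemma J_dom2 h x y : 0 < h -> dom2 x y -> dom2 (J h x) (J h y).
Proof. by move=> h0 [z h1 h2]; exists (J h z); exact: J_A. Qed.

(** (1 - a A) (1 - b A) = 1 - (a + b) A + a b A^2, so on the domain of A^2 the two resolvents agree
    to second order. *)
Lemma J_add a b x y : 0 < a -> 0 < b -> dom2 x y ->
  nm (J a (J b x) - J (a + b) x) <= a * b * nm y.
Proof.
move=> a0 b0 [z Axz Azy]; have ab0 : 0 < a + b by rewrite addr_gt0.
have p1 := J_A a0 (J_A b0 Axz); have p2 := J_A a0 (J_A b0 Azy).
have e1 := J_sub a0 (J_A b0 Axz); have e2 := J_sub a0 (J_A b0 Azy).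
have e3 := J_sub b0 Axz.
set p := J a (J b x) in p1 e1 *; set q := J a (J b z) in p1 p2 e1 e2.
set r := J a (J b y) in p2 e2.
have E : p - cR (a + b) *: q = x - cR (a * b) *: r.
  have E1 u v : x = u - cR b *: v -> u = p - cR a *: q -> v = q - cR a *: r ->
      p - cR (a + b) *: q = x - cR (a * b) *: r.
    move=> -> -> ->; rewrite scalerBr scalerA -cRM (mulrC b) cRD scalerDl opprD addrA.
    rewrite opprB; move: (p - _) (cR b *: q) (cR _ *: r) => P Q S.
    by rewrite -[RHS]addrA [S - Q - S]addrAC subrr add0r.
  apply: (E1 (J b x) (J b z)); by rewrite -?e1 -?e2 -?e3 subKr.
have E2 := J_uniq ab0 p1; rewrite E JB // JZs // in E2.
rewrite -E2 addrAC subrr add0r nmN nmZ nm_cR0 ?mulr_ge0 ?(ltW a0) ?(ltW b0) //.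
rewrite ler_pM2l ?mulr_gt0 //; apply: le_trans (J_contr _ ab0) _.
by apply: le_trans (J_contr _ a0) _; exact: J_contr.
Qed.

(** Telescoping: each of the m replacements of T by S costs c |y|, because S is additive and
    contractive and T preserves the domain of A^2 without enlarging the bound. *)
Lemma iter_near (S T : X -> X) (c : R) : 0 <= c ->
  (forall f g, S (f - g) = S f - S g) -> (forall f, nm (S f) <= nm f) ->
  (forall x y, dom2 x y -> nm (S x - T x) <= c * nm y) ->
  (forall x y, dom2 x y -> exists2 y', dom2 (T x) y' & nm y' <= nm y) ->
  forall m x y, dom2 x y -> nm (iter m S x - iter m T x) <= m%:R * c * nm y.
Proof.
move=> c0 Sl Sc ST Td; elim=> [|m IH] x y d; first by rewrite /= subrr nm0 !mul0r.
rewrite !iterSr.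
have iS f g : iter m S (f - g) = iter m S f - iter m S g.
  by elim: m {IH} => //= k ->; rewrite Sl.
have iC f : nm (iter m S f) <= nm f.
  by elim: m {IH iS} => //= k IHk; exact: le_trans (Sc _) IHk.
apply: le_trans (nm_tri _ (iter m S (T x)) _) _; rewrite -iS.
have [y' d' ny] := Td _ _ d.
apply: le_trans (lerD (le_trans (iC _) (ST _ _ d)) (IH _ _ d')) _.
rewrite -addn1 natrD !mulrDl mul1r addrC lerD2r.
by rewrite ler_wpM2l // mulr_ge0.
Qed.

(* Euler approximation of [exp (t A)]. *)
Definition E n t f := iter (2 ^ n) (J (t / 2 ^+ n)) f.

Lemma step_gt0 n t : 0 < t -> 0 < t / 2 ^+ n.
Proof. by move=> h; rewrite divr_gt0 // exprn_gt0. Qed.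

Lemma E_contr n t f : 0 < t -> nm (E n t f) <= nm f.
Proof.
move=> h; rewrite /E; elim: (2 ^ n)%N => //= k IH.
exact: le_trans (J_contr _ (step_gt0 n h)) IH.
Qed.

Lemma E_lin n t (a : R[i]) f g : 0 < t -> E n t (a *: f + g) = a *: E n t f + E n t g.
Proof.
move=> h; rewrite /E; elim: (2 ^ n)%N => //= k ->; exact: (J_lin _ _ _ (step_gt0 n h)).
Qed.
Lemma EB n t f g : 0 < t -> E n t (f - g) = E n t f - E n t g.
Proof.
by move=> h; have := E_lin n (-1) g f h; rewrite !scaleN1r [- g + _]addrC => ->; rewrite addrC.
Qed.

(** Each of the 2^n coarse steps is replaced by two steps of half its length h, at cost h^2 |y|; the
    total is geometrically small in n. *)
Lemma E_step n t x y : 0 < t -> dom2 x y -> nm (E n.+1 t x - E n t x) <= t ^+ 2 / 4 * nm y / 2 ^+ n.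
Proof.
move=> t0 d; have h0 := step_gt0 n.+1 t0; set h := t / 2 ^+ n.+1 in h0.
have hh : t / 2 ^+ n = h + h by rewrite /h exprS; field; rewrite gt_eqF // exprn_gt0.
have -> : E n.+1 t x = iter (2 ^ n) (fun f => J h (J h f)) x.
  by rewrite /E -/h expnS; elim: (2 ^ n)%N => [|k IH]; rewrite ?muln0 // mulnS !iterS /= IH.
have := @iter_near (fun f => J h (J h f)) (J (h + h)) (h * h) _ _ _ _ _ (2 ^ n)%N x y d.
rewrite /E hh => /(_ _ _ _ _ _)/le_trans; apply.
- by rewrite mulr_ge0 // ltW.
- by move=> f g; rewrite !JB.
- by move=> f; apply: le_trans (J_contr _ h0) _; exact: J_contr.
- by move=> x' y'; exact: J_add.
- move=> x' y' d'; exists (J (h + h) y'); first by apply: J_dom2 => //; rewrite addr_gt0.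
  by apply: J_contr; rewrite addr_gt0.
- rewrite natrX le_eqVlt; apply/orP; left; apply/eqP; rewrite /h exprS; field.
  by rewrite gt_eqF // exprn_gt0.
Qed.

Lemma domA_dense x e : 0 < e -> exists x' z', A (x', z') /\ nm (x - x') < e.
Proof.
have A_range' y : exists x z, A (x, z) /\ cR 1 *: x - z = y by exact: A_range.
by move=> e0; apply: (dissipative_dense A_lin A_diss _ A_range') => //; exact: ltr01.
Qed.

Lemma J_cvg f e : 0 < e -> exists2 d : R, 0 < d & forall h, 0 < h -> h < d -> nm (J h f - f) < e.
Proof.
move=> e0; have e3 : 0 < e / 3 by rewrite divr_gt0.
have [x [z [Axz hx]]] := domA_dense f e3.
have k0 : 0 < nm z + 1 by rewrite ltr_wpDl ?nm_ge0.
exists (e / 3 / (nm z + 1)); first by rewrite divr_gt0.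
move=> h h0; rewrite ltr_pdivlMr // => hd.
have -> : J h f - f = J h (f - x) + (J h x - x) - (f - x).
  by rewrite JB // addrA subrK opprB addrA subrK.
apply: le_lt_trans (nmB _ _) _.
have := nmD (J h (f - x)) (J h x - x); have := J_contr (f - x) h0.
have := J_near h0 Axz; have := nm_ge0 z; nra.
Qed.

Lemma dom2_dense f e : 0 < e -> exists x y, dom2 x y /\ nm (f - x) < e.
Proof.
move=> e0; have [x [z [Axz hx]]] := domA_dense f (half_lt e0).
have k0 : 0 < nm z + 1 by rewrite ltr_wpDl ?nm_ge0.
pose h := e / 2 / (nm z + 1); have h0 : 0 < h by rewrite !divr_gt0.
have [y Ay _] := J_dom z h0.
exists (J h x), y; split; first by exists (J h z) => //; exact: J_A.
apply: le_lt_trans (nm_tri _ x _) _; rewrite (nmC x).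
have := J_near h0 Axz; have : h * (nm z + 1) = e / 2 by rewrite /h; field; rewrite gt_eqF.
have := nm_ge0 z; nra.
Qed.

Lemma E_cauchy t f : 0 < t -> cauchy_nm (fun n => E n t f).
Proof.
move=> t0 e e0; have e3 : 0 < e / 3 by rewrite divr_gt0.
have [x [y [d hx]]] := dom2_dense f e3.
have [N hN] := geo_cauchy (fun n => E_step n t0 d) e3.
exists N => m n hm hn; have h := hN m n hm hn.
have -> : E m t f - E n t f = E m t (f - x) + (E m t x - E n t x) - E n t (f - x).
  by rewrite !EB // opprB !addrA subrK subrK.
apply: le_lt_trans (nmB _ _) _.
have := nmD (E m t (f - x)) (E m t x - E n t x).
have := E_contr m (f - x) t0; have := E_contr n (f - x) t0; lra.
Qed.

Lemma T_exists : exists T : R -> {linear X -> X},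
  (forall x, T 0 x = x) /\ forall t x, 0 < t -> (fun n => E n t x) @ \oo --> T t x.
Proof.
have /choice[T hT] : forall t, exists T : {linear X -> X},
    (t = 0 -> forall x, T x = x) /\ (0 < t -> forall x, (fun n => E n t x) @ \oo --> T x).
  move=> t; have [t0|t0] := ltP 0 t; last first.
    have [T hT] := @mk_linear R X X id (fun c x y => erefl).
    exists T; split => [_ x|]; first exact: hT.
    by [].
  have /choice[f hf] : forall x, exists l : X, (fun n => E n t x) @ \oo --> l.
    by move=> x; apply: cauchy_nm_cvg; exact: E_cauchy.
  have fl (c : R[i]) x y : f (c *: x + y) = c *: f x + f y.
    apply: (seq_lim_uniq (hf _)).
    have -> : (fun n => E n t (c *: x + y)) = (fun n => c *: E n t x + E n t y).
      by apply/funext => n; exact: E_lin.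
    exact: seqD (seqZ (hf x)) (hf y).
  have [T hT] := mk_linear fl.
  by exists T; split => [t00|_ x]; [move: t0; rewrite t00 ltxx|rewrite hT].
exists T; split => [x|t x t0]; first by have [h _] := hT 0; exact: h.
by have [_ h] := hT t; exact: h.
Qed.

Section Generation.
Variable T : R -> {linear X -> X}.
Hypothesis T0 : forall x, T 0 x = x.
Hypothesis Tlim : forall t x, 0 < t -> (fun n => E n t x) @ \oo --> T t x.

Lemma T_contr t x : 0 <= t -> nm (T t x) <= nm x.
Proof.
rewrite le_eqVlt => /predU1P[<-|t0]; first by rewrite T0.
rewrite -[T t x]opprK nmN -[- _]sub0r; apply: (nm_lim_le (N := 0%N) (u := fun n => E n t x)).
  exact: Tlim.
by move=> n _; rewrite sub0r nmN; exact: E_contr.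
Qed.

Lemma E_near n t x z : 0 < t -> A (x, z) -> nm (E n t x - x) <= t * nm z.
Proof.
move=> t0 Axz; have h0 := step_gt0 n t0.
have key k : nm (iter k (J (t / 2 ^+ n)) x - x) <= k%:R * (t / 2 ^+ n) * nm z.
  elim: k => [|k IH]; first by rewrite /= subrr nm0 !mul0r.
  rewrite iterS; apply: le_trans (nm_tri _ (J (t / 2 ^+ n) x) _) _.
  rewrite -JB //; apply: le_trans (lerD (le_trans (J_contr _ h0) IH) (J_near h0 Axz)) _.
  by rewrite -[X in _ <= X * _ * _]natr1 !mulrDl mul1r.
apply: le_trans (key _) _; rewrite natrX mulrCA mulfV ?mulr1 // gt_eqF // exprn_gt0 //.
Qed.

Lemma T_near t x z : 0 < t -> A (x, z) -> nm (T t x - x) <= t * nm z.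
Proof.
move=> t0 Axz; rewrite nmC; apply: (nm_lim_le (N := 0%N) (u := fun n => E n t x)).
  exact: Tlim.
by move=> n _; rewrite nmC; exact: E_near.
Qed.

(** Comparison with a single Euler step: [J t x - x - t z] equals [t^2 J t y], and the geometric
    tail bounds [J t x - T t x] by t^2 / 2 times |y|. *)
Lemma T_taylor t x z y : 0 < t -> A (x, z) -> A (z, y) ->
  nm (T t x - x - cR t *: z) <= 2 * t ^+ 2 * nm y.
Proof.
move=> t0 Axz Azy; have d : dom2 x y by exists z.
have E0 : E 0 t x = J t x by rewrite /E expn0 /= expr0 divr1.
have h1 : nm (J t x - T t x) <= t ^+ 2 / 2 * nm y.
  rewrite -E0; apply: (nm_lim_le (N := 0%N) (u := fun n => E n t x)); first exact: Tlim.
  move=> n _; rewrite nmC.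
  apply: le_trans (geo_tail (fun n => E_step n t0 d) (leq0n n)) _.
  by rewrite expr0 divr1 le_eqVlt; apply/orP; left; apply/eqP; field.
have e1 := J_sub t0 Axz; have e2 := J_sub t0 Azy.
set w := (X in nm X).
have -> : w = (J t x - x - cR t *: z) - (J t x - T t x) by rewrite /w; vring.
apply: le_trans (nmB _ _) _; rewrite e1 -scalerBr e2 scalerA -cRM nmZ nm_cR0 ?mulr_ge0 ?(ltW t0) //.
have := ler_wpM2l (sqr_ge0 t) (J_contr y t0); rewrite -expr2.
have := mulr_ge0 (sqr_ge0 t) (nm_ge0 y); lra.
Qed.

(** The resolvents commute, so the approximations at s and t can be paired step by step; by [J_add]
    each pair is close to one step for s + t, with total error s t |y| / 2^n. *)
Lemma T_add s t x : 0 <= s -> 0 <= t -> T (s + t) x = T s (T t x).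
Proof.
rewrite le_eqVlt => /predU1P[<-|s0]; first by rewrite add0r T0.
rewrite le_eqVlt => /predU1P[<-|t0]; first by rewrite addr0 T0.
have st0 : 0 < s + t by rewrite addr_gt0.
have onD x' y : dom2 x' y -> T (s + t) x' = T s (T t x').
  move=> d; apply/eqP; rewrite -subr_eq0; apply/eqP/nm_le_eq0 => e e0.
  have e4 : 0 < e / 4 by rewrite divr_gt0.
  have [N1 h1] := (cvg_seq_nm _ _).1 (@Tlim _ x' st0) _ e4.
  have [N2 h2] := (cvg_seq_nm _ _).1 (@Tlim _ x' t0) _ e4.
  have [N3 h3] := (cvg_seq_nm _ _).1 (@Tlim _ (T t x') s0) _ e4.
  have [N4 h4] := geo_small (s * t * nm y) e4.
  pose n := maxn (maxn N1 N2) (maxn N3 N4).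
  have := leqnn n; rewrite {1}/n !geq_max => /andP[/andP[/h1 {}h1 /h2 {}h2] /andP[/h3 {}h3 /h4 {}h4]].
  have a0 := step_gt0 n s0; have b0 := step_gt0 n t0.
  have key : nm (E n s (E n t x') - E n (s + t) x') <= s * t * nm y / 2 ^+ n.
    have -> : E n s (E n t x') = iter (2 ^ n) (fun f => J (s / 2 ^+ n) (J (t / 2 ^+ n) f)) x'.
      have swap k f : iter k (J (s / 2 ^+ n)) (J (t / 2 ^+ n) f) = J (t / 2 ^+ n) (iter k (J (s / 2 ^+ n)) f).
        by elim: k => //= k ->; rewrite J_comm.
      rewrite /E; elim: (2 ^ n)%N => // k IH; rewrite [in RHS]iterS -IH.
      by rewrite [iter k.+1 _ (iter k.+1 _ _)]iterS [iter k.+1 (J (t / _)) _]iterS swap.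
    have := @iter_near (fun f => J (s / 2 ^+ n) (J (t / 2 ^+ n) f)) (J (s / 2 ^+ n + t / 2 ^+ n))
      (s / 2 ^+ n * (t / 2 ^+ n)) _ _ _ _ _ (2 ^ n)%N x' y d.
    rewrite /E mulrDl => /(_ _ _ _ _ _)/le_trans; apply.
    - by rewrite mulr_ge0 // ltW.
    - by move=> f g; rewrite !JB.
    - by move=> f; apply: le_trans (J_contr _ a0) _; exact: J_contr.
    - by move=> u v; exact: J_add.
    - move=> u v d'; exists (J (s / 2 ^+ n + t / 2 ^+ n) v); first by apply: J_dom2 => //; rewrite addr_gt0.
      by apply: J_contr; rewrite addr_gt0.
    - rewrite natrX le_eqVlt; apply/orP; left; apply/eqP; field.
      by rewrite gt_eqF // exprn_gt0.
  have -> : T (s + t) x' - T s (T t x') = (T (s + t) x' - E n (s + t) x')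
      - (E n s (E n t x') - E n (s + t) x') - (T s (T t x') - E n s (T t x')) - E n s (T t x' - E n t x').
    by rewrite EB //; vring.
  apply: le_trans (nmB _ _) _; apply: le_trans (lerD (nmB _ _) (lexx _)) _.
  apply: le_trans (lerD (lerD (nmB _ _) (lexx _)) (lexx _)) _.
  have := E_contr n (T t x' - E n t x') s0; lra.
apply/eqP; rewrite -subr_eq0; apply/eqP/nm_le_eq0 => e e0.
have [x' [y [d hx]]] := dom2_dense x (half_lt e0).
have -> : T (s + t) x - T s (T t x) = T (s + t) (x - x') - T s (T t (x - x')).
  by rewrite (linearB (T (s + t))) (linearB (T t)) (linearB (T s)) (onD _ _ d); vring.
apply: le_trans (nmB _ _) _.
have := T_contr (x - x') (ltW st0); have := T_contr (T t (x - x')) (ltW s0).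
have := T_contr (x - x') (ltW t0); lra.
Qed.

Lemma at_right_nm (P : R -> Prop) : (\forall t \near 0^'+, P t) <->
  exists2 d : R, 0 < d & forall t, 0 < t -> t < d -> P t.
Proof.
split=> [[d /= d0 hd]|[d d0 hd]].
  exists d => // t t0 td; apply: hd => //=; by rewrite sub0r normrN gtr0_norm.
exists d => //= t /=; rewrite sub0r normrN => td t0; apply: hd => //.
by rewrite gtr0_norm in td.
Qed.

Lemma T_strong x : T t x @[t --> 0^'+] --> x.
Proof.
apply/cvg_nm => e e0; apply/at_right_nm; have e3 : 0 < e / 3 by rewrite divr_gt0.
have [x' [z [Axz hx]]] := domA_dense x e3.
have k0 : 0 < nm z + 1 by rewrite ltr_wpDl ?nm_ge0.
exists (e / 3 / (nm z + 1)); first by rewrite divr_gt0.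
move=> t t0; rewrite ltr_pdivlMr // => td.
have -> : x - T t x = (x - x') - (T t x' - x') - T t (x - x').
  by rewrite (linearB (T t)); vring.
apply: le_lt_trans (nmB _ _) _; apply: le_lt_trans (lerD (nmB _ _) (lexx _)) _.
have := T_contr (x - x') (ltW t0); have := T_near t0 Axz; have := nm_ge0 z; nra.
Qed.

(** [T_taylor] asks for a vector in the domain of A^2. [J h x] is one, and by [T_near] replacing x
    by it costs at most |z - J h z|, uniformly in t. *)
Lemma T_gen_sub x z : A (x, z) -> (cR t^-1 *: (T t x - x)) @[t --> 0^'+] --> z.
Proof.
move=> Axz; apply/cvg_nm => e e0; apply/at_right_nm.
have e4 : 0 < e / 4 by rewrite divr_gt0.
have [d d0 hd] := J_cvg z e4; pose h := d / 2.
have h0 : 0 < h by rewrite divr_gt0.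
have hz : nm (J h z - z) < e / 4 by apply: hd => //; rewrite /h; lra.
have [y Azy _] := J_dom z h0.
have Axz' := J_A h0 Axz.
have k0 : 0 < 2 * nm y + 1 by rewrite ltr_wpDl ?mulr_ge0 ?nm_ge0.
exists (e / 4 / (2 * nm y + 1)); first by rewrite divr_gt0.
move=> t t0; rewrite ltr_pdivlMr // => td.
have ti : 0 < t^-1 by rewrite invr_gt0.
have n1 : nm (cR t^-1 *: (T t (x - J h x) - (x - J h x))) <= nm (z - J h z).
  rewrite nmZ nm_cR0 ?(ltW ti) // ler_pdivrMl //.
  exact: T_near (A_sub Axz Axz').
have n2 : nm (cR t^-1 *: (T t (J h x) - J h x - cR t *: J h z)) <= 2 * t * nm y.
  rewrite nmZ nm_cR0 ?(ltW ti) // ler_pdivrMl //.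
  by apply: le_trans (T_taylor t0 Axz' Azy) _; rewrite le_eqVlt; apply/orP; left; apply/eqP; ring.
have -> : z - cR t^-1 *: (T t x - x) = (z - J h z)
   - cR t^-1 *: (T t (x - J h x) - (x - J h x)) - cR t^-1 *: (T t (J h x) - J h x - cR t *: J h z).
  rewrite (linearB (T t)) !scalerDr !scalerN !scalerA -cRM mulVf ?gt_eqF // cR1; vring.
apply: le_lt_trans (nmB _ _) _; apply: le_lt_trans (lerD (nmB _ _) (lexx _)) _.
rewrite nmC in hz; have := nm_ge0 y; nra.
Qed.

(** Choose (x', z') in A with x' - z' = x - z. The difference quotients of d = x - x' then tend to d
    itself, while contractivity makes their real pairing with d nonpositive; so d = 0. *)
Lemma T_gen_sup x z : (cR t^-1 *: (T t x - x)) @[t --> 0^'+] --> z -> A (x, z).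
Proof.
move=> /cvg_nm hx.
have [x' [z' [Axz E']]] := A_range (x - z) ltr01.
have /cvg_nm hx' := T_gen_sub Axz.
suff d0 : x - x' = 0.
  have xx : x = x' by apply/eqP; rewrite -subr_eq0 d0.
  move: E'; rewrite scale1r xx => /addrI/oppr_inj <-; exact: Axz.
apply: nm_eq0; apply/eqP; rewrite -sqrf_eq0 eq_le sqr_ge0 andbT.
have zz : z - z' = x - x'.
  have -> : x' = x - z + z' by rewrite -E' scale1r subrK.
  vring.
apply/ler_addgt0Pr => e e0; rewrite add0r.
pose k := nm (x - x') + 1; have k0 : 0 < k by rewrite ltr_wpDl ?nm_ge0.
have ek : 0 < e / (2 * k) by rewrite divr_gt0 // mulr_gt0.
have /at_right_nm[d1 d10 h1] := hx _ ek; have /at_right_nm[d2 d20 h2] := hx' _ ek.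
pose t := Num.min d1 d2 / 2.
have m0 : 0 < Num.min d1 d2 by rewrite lt_min d10.
have t0 : 0 < t by rewrite divr_gt0.
have tm : t < Num.min d1 d2 by rewrite /t; lra.
move: tm; rewrite lt_min => /andP[/(h1 t t0) {}h1 /(h2 t t0) {}h2].
pose w := cR t^-1 *: (T t (x - x') - (x - x')).
have wd : nm (x - x' - w) <= e / k.
  have -> : x - x' - w = (z - cR t^-1 *: (T t x - x)) - (z' - cR t^-1 *: (T t x' - x')).
    by rewrite -zz /w (linearB (T t)); vring.
  apply: le_trans (nmB _ _) _; apply: le_trans (lerD (ltW h1) (ltW h2)) _.
  by rewrite le_eqVlt; apply/orP; left; apply/eqP; field; rewrite gt_eqF.
have wneg : rip w (x - x') <= 0.
  rewrite /w ripZl pmulr_rle0 ?invr_gt0 // ripBl rip_nm subr_le0.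
  apply: le_trans (rip_CS _ _) _; rewrite expr2 ler_wpM2r ?nm_ge0 //.
  exact: T_contr (ltW t0).
have := rip_CS (x - x' - w) (x - x'); rewrite ripBl rip_nm => h3.
have : nm (x - x' - w) * nm (x - x') <= e / k * nm (x - x') by rewrite ler_wpM2r ?nm_ge0.
have : e / k * nm (x - x') <= e.
  by rewrite mulrAC ler_pdivrMr // ler_wpM2l ?(ltW e0) // /k lerDl.
lra.
Qed.

End Generation.

Lemma lumer_phillips : generates_C0 A.
Proof.
have [T [T0 Tlim]] := T_exists; exists T; split.
  split; [exact: T0|by move=> s t s0 t0 x; exact: T_add| |exact: T_strong].
  by move=> t t0; apply: (@bounded_continuous _ _ _ _ 1) => x; rewrite mul1r; exact: T_contr.
by move=> x z; split; [exact: T_gen_sub|exact: T_gen_sup].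
Qed.

End LumerPhillips.

(** * Passive system nodes *)

Section PassiveNodes.
Variables (R : realType) (U X Y : hilbertType R) (N : node U X Y).
Hypothesis N_lin : linear_operator N.

Lemma energy_term (z x : X) : 2 * 'Re (inner z x) = cR (2 * rip z x).
Proof. by rewrite -complexRe cRM; congr (_ * _); rewrite /cR rmorphMn rmorph1. Qed.

Lemma passive_le : passive N -> forall x u z y, N ((x, u), (z, y)) ->
  2 * rip z x <= nm u ^+ 2 - nm y ^+ 2.
Proof.
by move=> h x u z y /h; rewrite energy_term !nmE -!cRX -cRB cR_le.
Qed.

Lemma energy_eq : energy_preserving N -> forall x u z y, N ((x, u), (z, y)) ->
  2 * rip z x = nm u ^+ 2 - nm y ^+ 2.
Proof.
by move=> h x u z y /h; rewrite energy_term !nmE -!cRX -cRB => /cR_inj.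
Qed.

Lemma energy_preservingI : (forall x u z y, N ((x, u), (z, y)) ->
  2 * rip z x = nm u ^+ 2 - nm y ^+ 2) -> energy_preserving N.
Proof.
by move=> h x u z y /h; rewrite energy_term !nmE -!cRX -cRB => ->.
Qed.

Lemma energy_passive : energy_preserving N -> passive N.
Proof. by move=> h x u z y /h ->. Qed.

Lemma node_comb (a : R[i]) x u z y x' u' z' y' :
  N ((x, u), (z, y)) -> N ((x', u'), (z', y')) ->
  N ((a *: x + x', a *: u + u'), (a *: z + z', a *: y + y')).
Proof.
by case: N_lin => _ /(_ a ((x, u), (z, y)) ((x', u'), (z', y'))) h _; exact: h.
Qed.

(** Polarization of the energy balance; the scalar a recovers the imaginary part. *)
Lemma energy_neutral : energy_preserving N -> forall x u z y x' u' z' y',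
  N ((x, u), (z, y)) -> N ((x', u'), (z', y')) ->
  inner z x' + inner x z' = inner u u' - inner y y'.
Proof.
move=> hN x u z y x' u' z' y' h h'; apply: rip_ip => a.
have N0 : N ((0, 0), (0, 0)) by case: N_lin.
have E1 := energy_eq hN h'; have E2 := energy_eq hN (node_comb a h N0).
have E3 := energy_eq hN (node_comb a h h'); move: E2 E3; rewrite !addr0.
rewrite mulrDr mulrBr !ReD ReN -!ipZl -!/(rip _ _) !ripDl !ripDr !nm_sqrD (ripC (a *: x) z').
by lra.
Qed.

Lemma node_sub x u z y x' u' z' y' :
  N ((x, u), (z, y)) -> N ((x', u'), (z', y')) -> N ((x - x', u - u'), (z - z', y - y')).
Proof.
move=> h h'; have := node_comb (-1) h' h.
by rewrite !scaleN1r [- x' + _]addrC [- u' + _]addrC [- z' + _]addrC [- y' + _]addrC.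
Qed.

Lemma node_add x u z y x' u' z' y' :
  N ((x, u), (z, y)) -> N ((x', u'), (z', y')) -> N ((x + x', u + u'), (z + z', y + y')).
Proof. by move=> h h'; have := node_comb 1 h h'; rewrite !scale1r. Qed.

Lemma node_fun x u z y z' y' : N ((x, u), (z, y)) -> N ((x, u), (z', y')) -> z = z' /\ y = y'.
Proof. by case: N_lin => _ _ h h1 h2; have [-> ->] := h _ _ _ h1 h2. Qed.

Local Notation A := (main_operator N).

Lemma main_lin : linear_operator A.
Proof.
split.
- by exists 0; case: N_lin.
- move=> a [x z] [x' z'] [y h] [y' h']; exists (a *: y + y').
  by have := node_comb a h h'; rewrite scaler0 addr0.
- by move=> x z z' [y h] [y' h']; have [] := node_fun h h'.
Qed.

Lemma main_diss : passive N -> forall x z, A (x, z) -> rip z x <= 0.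
Proof.
move=> hp x z [y /(passive_le hp)] /=; rewrite nm0 expr0n /=; have := sqr_ge0 (nm y); lra.
Qed.

Lemma diss_bound (lam : R[i]) (x z : X) : cplus lam -> rip z x <= 0 ->
  complex.Re lam * nm x <= nm (lam *: x - z).
Proof.
move=> lam0 d; have [->|x0] := eqVneq x 0; first by rewrite nm0 mulr0 nm_ge0.
rewrite -(ler_pM2r (nm_pos x0)) -mulrA -expr2.
apply: le_trans (rip_CS _ _); rewrite ripBl.
have -> : rip (lam *: x) x = complex.Re lam * nm x ^+ 2.
  by rewrite /rip ipZl ip_nm ReM Re_cR Im_cR mulr0 subr0.
by lra.
Qed.

Lemma passive_eigen_uniq (lam : R[i]) x u y x' y' : passive N -> cplus lam ->
  N ((x, u), (lam *: x, y)) -> N ((x', u), (lam *: x', y')) -> x = x' /\ y = y'.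
Proof.
move=> hp lam0 h h'; have := node_sub h h'; rewrite subrr -scalerBr => hd.
have d : x - x' = 0.
  apply: nm_eq0; apply/eqP; rewrite eq_le nm_ge0 andbT -(@pmulr_rle0 _ (complex.Re lam)) //.
  have hd' : A (x - x', lam *: (x - x')) by exists (y - y').
  by have := diss_bound lam0 (main_diss hp hd'); rewrite subrr nm0.
have xx : x = x' by apply/eqP; rewrite -subr_eq0 d.
by split => //; move: h; rewrite xx => /node_fun /(_ h')[].
Qed.

(** The equation (lam - A_{-1}) x - B u = f, expressed through the graph and thus free of
    extrapolation spaces. *)
Definition solvable_node := forall lam, cplus lam -> forall f u,
  exists x z y, N ((x, u), (z, y)) /\ lam *: x - z = f.

Lemma solvable_resolvent : passive N -> solvable_node -> forall lam, cplus lam ->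
  exists T, is_resolvent A lam T.
Proof.
move=> hp hs lam lam0.
have diss := main_diss hp.
have /choice[f hf] : forall g, exists x, A (x, lam *: x - g).
  move=> g; have [x [z [y [h <-]]]] := hs lam lam0 g 0; exists x; exists y.
  by rewrite /= subKr.
have uniq x z : A (x, z) -> f (lam *: x - z) = x.
  move=> h; have := hf (lam *: x - z) => h'; apply/eqP; rewrite -subr_eq0.
  have hd : A (f (lam *: x - z) - x, lam *: (f (lam *: x - z) - x)).
    have [_ /(_ (-1) _ _ h h') + _] := main_lin.
    congr A; congr pair; rewrite /= scaleN1r addrC //.
    by vring.
  apply/eqP/nm_eq0/eqP; rewrite eq_le nm_ge0 andbT -(@pmulr_rle0 _ (complex.Re lam)) //.
  have := diss_bound lam0 (diss _ _ hd); by rewrite subrr nm0.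
have fl a g h : f (a *: g + h) = a *: f g + f h.
  have [_ /(_ a _ _ (hf g) (hf h)) /= hh _] := main_lin.
  rewrite -(uniq _ _ hh); congr f => /=; rewrite scalerBr !scalerDr !scalerA (mulrC lam).
  vring.
have [T hT] := mk_linear fl; exists T; split.
- apply: (@bounded_continuous _ _ _ _ (complex.Re lam)^-1) => g; rewrite hT ler_pdivlMl //.
  by have := diss_bound lam0 (diss _ _ (hf g)); rewrite subKr.
- by move=> g; rewrite hT; exact: hf.
- by move=> x z h; rewrite hT; exact: uniq.
Qed.

Lemma solvable_generates : passive N -> solvable_node -> generates_C0 A.
Proof.
move=> hp hs; apply: lumer_phillips; [exact: main_lin|exact: main_diss|].
move=> r f r0; have [x [z [y [h E]]]] := hs (cR r) r0 f 0.
by exists x, z; split => //; exists y.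
Qed.

(* The resolvent [T] at 1 serves as the embedding of an extrapolation space that is
   carried by X itself. *)
Lemma solvable_control_resolvent lam u x y : passive N -> solvable_node -> cplus lam ->
  N ((x, u), (lam *: x, y)) -> control_resolvent N lam u x.
Proof.
move=> hp hs lam0 hx; split; first exact: solvable_resolvent.
have c1 : cplus (1 : R[i]) by rewrite /cplus /= ltr01.
have [T hT] := solvable_resolvent hp hs c1.
have [Tc TA TU] := hT; have [C C0 hC] := continuous_bounded Tc.
have dense_T : dense (range T).
  move=> O [p Op] oO; have /nbhs_nm[e e0 he] : nbhs p O by exact: open_nbhs_nbhs.
  have rg f : exists x z, A (x, z) /\ 1 *: x - z = f.
    by exists (T f), (1 *: T f - f); split; [exact: TA|rewrite subKr].
  have [x' [z' [Ax' hx']]] := dissipative_dense main_lin (main_diss hp) c1 rg p e0.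
  by exists x'; split; [exact: he|exists (1 *: x' - z') => //; exact: TU].
(* With T = (1 - A)^{-1} as embedding the extension of A is T - 1, since T A v = T v - v. *)
have [op hop] : exists op : {linear X -> X}, forall x, op x = T x - x.
  apply: mk_linear => a v w; rewrite linearP; vring.
have op_c : continuous op.
  apply: (@bounded_continuous _ _ _ _ (C + 1)) => v; rewrite hop.
  by apply: le_trans (nmB _ _) _; have := hC v; lra.
have opE v w : A (v, w) -> op v = T w.
  by move=> /TU; rewrite scale1r linearB hop => E; rewrite -{2}E; vring.
pose E := @Extrapolation R X A 1 T hT X T (fun _ => erefl) dense_T op op_c opE.
exists E.
(* The state b v with z = x is (1 - A_{-1})^{-1} B v; as T is the embedding, it also represents B
   v. *)
have /choice[b hb] : forall v, exists w, exists y, N ((w, v), (w, y)).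
  move=> v; have [w [z [y' [h]]]] := hs 1 c1 0 v; rewrite scale1r => /eqP.
  by rewrite subr_eq0 => /eqP E'; exists w, y'; rewrite {2}E'.
have bl a v w : b (a *: v + w) = a *: b v + b w.
  have [y1 h1] := hb v; have [y2 h2] := hb w; have [y3 h3] := hb (a *: v + w).
  have h4 := node_comb a h1 h2.
  have h5 : N ((a *: b v + b w, a *: v + w), (1 *: (a *: b v + b w), a *: y1 + y2)).
    by rewrite scale1r.
  have h6 : N ((b (a *: v + w), a *: v + w), (1 *: b (a *: v + w), y3)) by rewrite scale1r.
  by have [] := passive_eigen_uniq hp c1 h6 h5.
have [B hB] := mk_linear bl.
have BE v w z : AB N ((v, w), z) -> T z = op v + B w.
  move=> [y' h]; rewrite hop hB; have [y1 h1] := hb w.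
  have := node_sub h h1; rewrite subrr => h2.
  have /TU : A (v - b w, z - b w) by exists (y' - y1).
  have -> : 1 *: (v - b w) - (z - b w) = v - z by rewrite scale1r; vring.
  by rewrite linearB => E'; rewrite (_ : T z = T v - (v - b w)); [vring|rewrite -E' subKr].
exists B; split; last first.
  have h : AB N ((x, u), lam *: x) by exists y.
  by rewrite /= -linearZ_LR (BE _ _ _ h); vring.
split; last by move=> v w z /BE.
apply: (@bounded_continuous _ _ _ _ 1) => v; rewrite mul1r hB.
have [y1 /(passive_le hp)] := hb v; rewrite rip_nm => h.
rewrite -(@ler_pXn2r _ 2) ?nnegrE ?nm_ge0 //.
by have := sqr_ge0 (nm (b v)); have := sqr_ge0 (nm y1); lra.
Qed.

(** Here the extrapolation space is arbitrary. Compare x with some x0 in the domain over the same u: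
    d = x - x0 satisfies A_{-1} d = w with w in X, and it has to be shown that d is in the domain of
    A. *)
Lemma control_resolvent_node lam u x : passive N -> (forall u, exists x, dom N (x, u)) ->
  cplus lam -> control_resolvent N lam u x -> exists y, N ((x, u), (lam *: x, y)).
Proof.
move=> hp hd lam0 [[Tl [Tlc TlA TlU]] [E [B [[Bc BE] EB]]]].
have [x0 [[z0 y0] h0]] := hd u.
have B0 : ex_emb E z0 = ex_op E x0 + B u by apply: BE; exists y0.
have [Rc RA RU] := ex_resP E.
pose b := ex_beta E; pose Rb := ex_res E.
have [C C0 hC] := continuous_bounded Rc.
have emb_b : bounded_by (ex_emb E) C.
  by move=> v; have := hC v; rewrite /nm ex_emb_norm.
have [D D0 hD] := continuous_bounded (@ex_op_bounded _ _ _ E).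
have rg f : exists x z, A (x, z) /\ lam *: x - z = f.
  by exists (Tl f), (lam *: Tl f - f); split; [exact: TlA|rewrite subKr].
have dd := dissipative_dense main_lin (main_diss hp) lam0 rg.
(* the defect of [lam - A_{-1}] can be read off in X *)
have key q : lam *: ex_emb E q = ex_op E q -> q + (lam - b) *: Rb q = 0.
  move=> Eq; apply: nm_le_eq0 => e e0.
  pose M := 1 + nm (lam - b) * C + nm lam * C + D + 1.
  have M0 : 0 < M by have := mulr_ge0 (nm_ge0 (lam - b)) C0; have := mulr_ge0 (nm_ge0 lam) C0; rewrite /M; lra.
  have [q' [a [Aqa hq]]] := dd q _ (divr_gt0 e0 M0).
  have E1 : nm (q' + (lam - b) *: Rb q') = nm (lam *: ex_emb E q' - ex_op E q').
    have -> : lam *: ex_emb E q' - ex_op E q' = ex_emb E (lam *: q' - a).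
      by rewrite (linearB (ex_emb E)) (linearZ_LR (ex_emb E)) (ex_opE E Aqa).
    have -> : q' + (lam - b) *: Rb q' = Rb (lam *: q' - a).
      have ERb := RU _ _ Aqa; rewrite (linearB Rb) (linearZ_LR Rb) in ERb.
      have Ra : Rb a = b *: Rb q' - q' by rewrite -[X in _ - X]ERb subKr.
      by rewrite (linearB Rb) (linearZ_LR Rb) Ra; vring.
    by rewrite /nm -ex_emb_norm.
  have -> : q + (lam - b) *: Rb q = (q - q') + (lam - b) *: Rb (q - q') + (q' + (lam - b) *: Rb q').
    by rewrite (linearB Rb); vring.
  apply: le_trans (nmD _ _) _; rewrite E1.
  have -> : lam *: ex_emb E q' - ex_op E q' = ex_op E (q - q') - lam *: ex_emb E (q - q').
    by rewrite (linearB (ex_op E)) (linearB (ex_emb E)) scalerBr Eq subr4 subrr sub0r opprB.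
  have n1 : nm ((q - q') + (lam - b) *: Rb (q - q')) <= (1 + nm (lam - b) * C) * nm (q - q').
    apply: le_trans (nmD _ _) _; rewrite mulrDl mul1r lerD2l nmZ -mulrA ler_wpM2l ?nm_ge0 //.
  have n2 : nm (ex_op E (q - q') - lam *: ex_emb E (q - q')) <= (D + nm lam * C) * nm (q - q').
    apply: le_trans (nmB _ _) _; rewrite mulrDl lerD ?hD // nmZ -mulrA ler_wpM2l ?nm_ge0 //.
  have : M * nm (q - q') <= e by rewrite mulrC -ler_pdivlMr // ltW.
  rewrite /M; have := nm_ge0 (q - q'); lra.
pose d := x - x0; pose w := lam *: x - z0.
have opd : ex_op E d = ex_emb E w.
  rewrite /d /w (linearB (ex_op E)) (linearB (ex_emb E)) (linearZ_LR (ex_emb E)) B0 -EB.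
  by rewrite opprD addrA subr4 subrr sub0r opprB.
(* p is what d ought to be. The difference q satisfies A_{-1} q = lam q; by [key] it is a multiple
   of a resolvent value, so it lies in the domain of A and vanishes. *)
pose p := Tl (lam *: d - w); have Ap : A (p, lam *: p - (lam *: d - w)) by exact: TlA.
pose q := p - d.
have Eq : lam *: ex_emb E q = ex_op E q.
  rewrite /q (linearB (ex_op E)) (ex_opE E Ap) opd -(linearB (ex_emb E)) -(linearZ_LR (ex_emb E)); congr (ex_emb E _).
  by rewrite scalerBr; vring.
have Kq := key q Eq.
have qE : q = (b - lam) *: Rb q.
  apply/eqP; rewrite -subr_eq0; apply/eqP; rewrite -[RHS]Kq -scaleNr opprB //.
have Aq : A (q, lam *: q).
  have [A0 hcomb _] := main_lin.
  have h : A ((b - lam) *: Rb q + 0, (b - lam) *: (b *: Rb q - q) + 0).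
    exact: (hcomb (b - lam) _ _ (RA q) A0).
  have E2 : (b - lam) *: (b *: Rb q - q) = lam *: q.
    by rewrite scalerBr scalerA mulrC -scalerA -qE scalerBl; vring.
  by rewrite !addr0 E2 -qE in h.
have q0 : q = 0 by rewrite -(TlU _ _ Aq) subrr linear0.
have pd : p = d by apply/eqP; rewrite -subr_eq0 -/q q0.
have [y1 h1] : A (d, w) by move: Ap; rewrite pd subKr.
exists (y0 + y1); have := node_add h0 h1; rewrite addr0 /d /w.
by rewrite [x0 + _]addrC subrK [z0 + _]addrC subrK.
Qed.

End PassiveNodes.

(** * The canonical node *)

Section CanonicalModelSpace.
Variables (R : realType) (U Y : hilbertType R) (phi : R[i] -> {linear U -> Y}).
Hypothesis phi_schur : operator_schur phi.
Variable Hs : rkhs (@cplus2 R) (Ks phi).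
Local Notation H := (rk_space Hs).
Local Notation dq := (dq phi_schur).

Lemma cplus1 : cplus (1 : R[i]). Proof. by rewrite /cplus /= ltr01. Qed.

(** The first component does not depend on the second point, nor the second on the first
    ([rk_split]); 1 is a placeholder, here and in [e1] and [e2]. *)
Definition x1 (x : H) (l : R[i]) : Y := (rk_fun x (l, 1)).1.
Definition x2 (x : H) (m : R[i]) : U := (rk_fun x (1, m)).2.

Lemma kvec_exists w h : exists k : H, cplus2 w ->
  (forall w', cplus2 w' -> rk_fun k w' = Ks phi w' w h) /\
  (forall x : H, inner x k = dsum_inner (rk_fun x w) h).
Proof.
have [hw|nw] := pselect (cplus2 w); last by exists 0.
by have [k hk] := @rk_reproducing _ _ _ _ _ _ Hs w hw h; exists k.
Qed.
Definition kvec w h : H := projT1 (cid (kvec_exists w h)).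
Lemma kvec_fun w h w' : cplus2 w -> cplus2 w' -> rk_fun (kvec w h) w' = Ks phi w' w h.
Proof. by move=> /(projT2 (cid (kvec_exists w h)))[h1 _] /h1. Qed.
Lemma kvec_ip w h (x : H) : cplus2 w -> inner x (kvec w h) = dsum_inner (rk_fun x w) h.
Proof. by move=> /(projT2 (cid (kvec_exists w h)))[_ h2]. Qed.

Lemma kvecE l m h mu mus : cplus l -> cplus m -> cplus mu -> cplus mus ->
  rk_fun (kvec (l, m) h) (mu, mus) = Kdq phi_schur mu mus l m h.
Proof. by move=> h1 h2 h3 h4; rewrite kvec_fun ?(Ks_dq phi_schur). Qed.

Definition e1 l (g : Y) : H := kvec (l, 1) (g, 0).
Definition e2 m (v : U) : H := kvec (1, m) (0, v).

Lemma rk_ext (x x' : H) : (forall w, cplus2 w -> rk_fun x w = rk_fun x' w) -> x = x'.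
Proof.
move=> h; apply/eqP; rewrite -subr_eq0; apply/eqP; apply: rk_fun_inj => w hw.
have := rk_fun_linear hw (-1) x' x; rewrite scaleN1r [- x' + x]addrC => ->.
by rewrite h // scaleN1r addNr.
Qed.

Lemma adjoint0 (T : {linear U -> Y}) C : bounded_by T C -> adjoint T 0 = 0.
Proof. by move=> hT; apply: (adjoint_uniq hT) => u; rewrite !ip0r. Qed.

Lemma kvec_fst l m m' g : cplus l -> cplus m -> cplus m' -> kvec (l, m) (g, 0) = kvec (l, m') (g, 0).
Proof.
move=> hl hm hm'; apply: rk_ext => -[mu mus] [h1 h2].
rewrite !kvecE // /Kdq /= !linear0.
by rewrite (adjoint0 (schur_bnd phi_schur (cplusJ h2))) !subr0 !scaler0.
Qed.

Lemma kvec_snd l l' m v : cplus l -> cplus l' -> cplus m -> kvec (l, m) (0, v) = kvec (l', m) (0, v).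
Proof.
move=> hl hl' hm; apply: rk_ext => -[mu mus] [h1 h2].
rewrite !kvecE // /Kdq /=.
have [C _ hC] := dq_bnd phi_schur (cplusJ h2) hl.
have [C' _ hC'] := dq_bnd phi_schur (cplusJ h2) hl'.
rewrite (adjoint0 (schur_bnd phi_schur hl)) (adjoint0 (schur_bnd phi_schur hl')).
by rewrite (adjoint0 hC) (adjoint0 hC') linear0 !subr0 !scaler0.
Qed.

Lemma e1_ip_rk (x : H) l m g : cplus l -> cplus m -> inner x (e1 l g) = inner (rk_fun x (l, m)).1 g.
Proof.
move=> hl hm; rewrite /e1 (kvec_fst g hl cplus1 hm) kvec_ip //.
by rewrite /dsum_inner /= ip0r addr0.
Qed.

Lemma e2_ip_rk (x : H) l m v : cplus l -> cplus m -> inner x (e2 m v) = inner (rk_fun x (l, m)).2 v.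
Proof.
move=> hl hm; rewrite /e2 (kvec_snd v cplus1 hl hm) kvec_ip //.
by rewrite /dsum_inner /= ip0r add0r.
Qed.

Lemma e1_ip (x : H) l g : cplus l -> inner x (e1 l g) = inner (x1 x l) g.
Proof. by move=> hl; exact: (e1_ip_rk x g hl cplus1). Qed.
Lemma e2_ip (x : H) m v : cplus m -> inner x (e2 m v) = inner (x2 x m) v.
Proof. by move=> hm; exact: (e2_ip_rk x v cplus1 hm). Qed.

Lemma rk_split (x : H) l m : cplus l -> cplus m -> rk_fun x (l, m) = (x1 x l, x2 x m).
Proof.
move=> hl hm; rewrite [LHS]surjective_pairing; congr pair.
  by apply: ip_eq => g; rewrite -(e1_ip_rk x g hl hm) e1_ip.
by apply: ip_eq => v; rewrite -(e2_ip_rk x v hl hm) e2_ip.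
Qed.

Lemma x1_e1 l g mu : cplus l -> cplus mu ->
  x1 (e1 l g) mu = (mu + l^*)^-1 *: (g - phi mu (adjoint (phi l) g)).
Proof.
move=> hl hm; have c1 := cplus1; rewrite /x1 /e1 kvecE //.
by rewrite /Kdq /= linear0 subr0.
Qed.
Lemma x2_e1 l g mus : cplus l -> cplus mus -> x2 (e1 l g) mus = - adjoint (dq l (mus^*)) g.
Proof.
move=> hl hm; have c1 := cplus1; rewrite /x2 /e1 kvecE //.
rewrite /Kdq /= linear0 (adjoint0 (schur_bnd phi_schur (cplusJ hm))) subr0 scaler0 addr0 //.
Qed.
Lemma x1_e2 m v mu : cplus m -> cplus mu -> x1 (e2 m v) mu = - dq mu (m^*) v.
Proof.
move=> hl hm; have c1 := cplus1; rewrite /x1 /e2 kvecE //.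
by rewrite /Kdq /= (adjoint0 (schur_bnd phi_schur cplus1)) linear0 subr0 scaler0 sub0r.
Qed.
Lemma x2_e2 m v mus : cplus m -> cplus mus ->
  x2 (e2 m v) mus = (mus + m^*)^-1 *: (v - adjoint (phi (mus^*)) (phi (m^*) v)).
Proof.
move=> hl hm; have c1 := cplus1; rewrite /x2 /e2 kvecE //.
have [C _ hC] := dq_bnd phi_schur (cplusJ hm) cplus1.
by rewrite /Kdq /= (adjoint0 hC) oppr0 add0r.
Qed.

Lemma rk_total (x : H) : (forall l g, cplus l -> inner x (e1 l g) = 0) ->
  (forall m v, cplus m -> inner x (e2 m v) = 0) -> x = 0.
Proof.
move=> h1 h2; apply: rk_fun_inj => -[l m] [hl hm]; rewrite rk_split //.
have -> : x1 x l = 0 by apply: ip_eq0 => g; rewrite -e1_ip // h1.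
by have -> : x2 x m = 0 by apply: ip_eq0 => v; rewrite -e2_ip // h2.
Qed.

(** The first diagonal entry of the kernel at (l, l) is at most 1 / (2 Re l), since 1 - phi phi^* is
    at most 1; Cauchy-Schwarz with [e1 l (x1 x l)] does the rest. *)
Lemma x1_bound (x : H) l : cplus l -> 2 * complex.Re l * nm (x1 x l) ^+ 2 <= nm x ^+ 2.
Proof.
move=> hl; have hl2 : 0 < 2 * complex.Re l by rewrite mulr_gt0.
have n1 : 2 * complex.Re l * nm (e1 l (x1 x l)) ^+ 2 <= nm (x1 x l) ^+ 2.
  have -> : nm (e1 l (x1 x l)) ^+ 2 = complex.Re (inner (e1 l (x1 x l)) (e1 l (x1 x l))) by rewrite ip_nm.
  rewrite e1_ip // x1_e1 // ipZl ipBl addJ -cRV ReM Re_cR Im_cR mul0r subr0 mulrA mulfV ?gt_eqF // mul1r.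
  rewrite (adjointE (schur_bnd phi_schur hl)) !ip_nm ReB !Re_cR.
  by have := sqr_ge0 (nm (adjoint (phi l) (x1 x l))); lra.
have : nm (x1 x l) ^+ 2 = rip x (e1 l (x1 x l)) by rewrite /rip e1_ip // ip_nm.
have := rip_CS x (e1 l (x1 x l)); move: (rip _ _) (nm (e1 l _)) n1 (nm_ge0 (e1 l (x1 x l))) => r q n1 q0 h1 h2.
rewrite -h2 in h1.
have q3 := nm_ge0 (x1 x l); have q4 := nm_ge0 x.
have [z0|z0] := eqVneq (nm (x1 x l)) 0; first by rewrite z0 expr0n mulr0 sqr_ge0.
have p0 : 0 < nm (x1 x l) by rewrite lt_def z0.
have h3 : nm (x1 x l) ^+ 2 * nm (x1 x l) ^+ 2 <= nm x ^+ 2 * q ^+ 2.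
  by rewrite -!exprMn -expr2 lerXn2r ?nnegrE ?mulr_ge0 ?exprn_ge0.
rewrite -(ler_pM2r (exprn_gt0 2 p0)).
have := ler_wpM2l (sqr_ge0 (nm x)) n1; have := ler_wpM2l (ltW hl2) h3; lra.
Qed.

Lemma SsP x u z y : Ss Hs ((x, u), (z, y)) <->
  (forall l, cplus l -> x1 z l = l *: x1 x l + phi l u - y) /\
  (forall m, cplus m -> x2 z m = - (m *: x2 x m) + u - adjoint (phi (m^*)) y).
Proof.
split=> [[f1 [f2 [hf _ hz]]]|[h1 h2]].
  have xf1 l : cplus l -> x1 x l = f1 l by move=> hl; rewrite /x1 hf //; exact: cplus1.
  have xf2 m : cplus m -> x2 x m = f2 m by move=> hm; rewrite /x2 hf //; exact: cplus1.
  split=> [l hl|m hm]; first by rewrite xf1 // /x1 hz //; exact: cplus1.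
  by rewrite xf2 // /x2 hz //; exact: cplus1.
exists (x1 x), (x2 x); split=> [mu mus hm hms||mu mus hm hms].
- exact: rk_split.
- move=> P /nbhs_nm[e e0 hP].
  exists (nm z ^+ 2 / e ^+ 2) => eta heta; apply: hP.
  have eta0 : cplus eta by apply: le_lt_trans heta; rewrite divr_ge0 ?sqr_ge0.
  have -> : y - (eta *: x1 x eta + phi eta u) = - x1 z eta.
    by rewrite h1 //; vring.
  rewrite nmN -(@ltr_pXn2r _ 2) ?nnegrE ?nm_ge0 ?(ltW e0) //.
  have := x1_bound z eta0; move: heta; rewrite ltr_pdivrMr ?exprn_gt0 //.
  have q0 : 0 < complex.Re eta by [].
  move=> h3 h4; have h5 : 2 * complex.Re eta * nm (x1 z eta) ^+ 2 < complex.Re eta * e ^+ 2.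
    exact: le_lt_trans h4 h3.
  have h6 : complex.Re eta * nm (x1 z eta) ^+ 2 < complex.Re eta * e ^+ 2.
    have := mulr_ge0 (ltW q0) (sqr_ge0 (nm (x1 z eta))); lra.
  by rewrite ltr_pM2l in h6.
- by rewrite rk_split // h1 // h2.
Qed.

(** This exhibits [e2 m v] as the solution of (lam - A_{-1}) x = B v for the conjugate point lam of
    m, with output [phi lam v]. *)
Lemma gen2 m v : cplus m -> Ss Hs ((e2 m v, v), (m^* *: e2 m v, phi (m^*) v)).
Proof.
move=> hm; have hmJ := cplusJ hm; apply/SsP.
have x1Z a (x : H) l : cplus l -> x1 (a *: x) l = a *: x1 x l.
  by move=> hl; apply: ip_eq => g; rewrite -e1_ip // ipZl e1_ip // ipZl.
have x2Z a (x : H) l : cplus l -> x2 (a *: x) l = a *: x2 x l.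
  by move=> hl; apply: ip_eq => g; rewrite -e2_ip // ipZl e2_ip // ipZl.
split=> l hl.
  rewrite x1Z // x1_e2 //; have := dq_mul phi_schur l v hmJ; rewrite scalerBl => E.
  have -> : phi l v = phi (m^*) v + (l *: dq l (m^*) v - m^* *: dq l (m^*) v) by rewrite E addrC subrK.
  by rewrite !scalerN; vring.
rewrite x2Z // x2_e2 //; have l0 : l + m^* != 0.
  apply/eqP => /(congr1 (@complex.Re R)); rewrite ReD ReJ; have := hl; have := hm.
  by rewrite /cplus /=; lra.
set X := v - _.
have -> : - (l *: ((l + m^*)^-1 *: X)) + v - adjoint (phi l^*) (phi m^* v) = - (l *: ((l + m^*)^-1 *: X)) + X.
  by rewrite /X addrA.
rewrite -{3}[X]scale1r -(mulfV l0) scalerA -(scalerA _ _ X); vring.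
Qed.

(** With input and output exchanged and the sign of z reversed, this is the corresponding solution
    for the adjoint node. *)
Lemma gen1 l g : cplus l -> Ss Hs ((e1 l g, adjoint (phi l) g), (- (l^* *: e1 l g), g)).
Proof.
move=> hl; have hlJ := cplusJ hl; apply/SsP.
have x1Z a (x : H) l' : cplus l' -> x1 (a *: x) l' = a *: x1 x l'.
  by move=> hl'; apply: ip_eq => g'; rewrite -e1_ip // ipZl e1_ip // ipZl.
have x2Z a (x : H) l' : cplus l' -> x2 (a *: x) l' = a *: x2 x l'.
  by move=> hl'; apply: ip_eq => g'; rewrite -e2_ip // ipZl e2_ip // ipZl.
rewrite -scaleNr; split=> m hm.
  rewrite x1Z // x1_e1 //; have l0 : m + l^* != 0.
    apply/eqP => /(congr1 (@complex.Re R)); rewrite ReD ReJ; have := hl; have := hm.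
    by rewrite /cplus /=; lra.
  set X := g - _.
  have -> : m *: ((m + l^*)^-1 *: X) + phi m (adjoint (phi l) g) - g = m *: ((m + l^*)^-1 *: X) - X.
    by rewrite /X; vring.
  rewrite -{3}[X]scale1r -(mulfV l0) scalerA -(scalerA _ _ X); vring.
rewrite x2Z // x2_e1 //; have [C _ hC] := dq_bnd phi_schur (cplusJ hm) hl.
apply: ip_eq => w; rewrite !(ipDl, ipNl, ipZl) !(adjointEl hC) (adjointEl (schur_bnd phi_schur hl)).
rewrite (adjointEl (schur_bnd phi_schur (cplusJ hm))).
have : inner g ((l - m^*) *: dq l m^* w) = inner g (phi l w) - inner g (phi m^* w).
  by rewrite (dq_mul phi_schur _ _ (cplusJ hm)) ipBr.
rewrite ipZr rmorphB /= conjCK => E.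
have -> : inner g (phi l w) = (l^* - m) * inner g (dq l m^* w) + inner g (phi m^* w) by rewrite E subrK.
ring.
Qed.

(* [((gx i, gu i), (gz i, gy i))] runs through the elements of the graph of [Ss]
   given by the kernel functions; by [Ss_gen] the graph is their neutral companion. *)
Definition gidx := (({l : R[i] | cplus l} * Y) + ({m : R[i] | cplus m} * U))%type.
Definition gx (i : gidx) : H := match i with inl p => e1 (sval p.1) p.2 | inr p => e2 (sval p.1) p.2 end.
Definition gu (i : gidx) : U := match i with inl p => adjoint (phi (sval p.1)) p.2 | inr p => p.2 end.
Definition gz (i : gidx) : H :=
  match i with inl p => - ((sval p.1)^* *: e1 (sval p.1) p.2) | inr p => (sval p.1)^* *: e2 (sval p.1) p.2 end.
Definition gy (i : gidx) : Y := match i with inl p => p.2 | inr p => phi ((sval p.1)^*) p.2 end.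

Lemma gen_Ss i : Ss Hs ((gx i, gu i), (gz i, gy i)).
Proof. by case: i => -[[l hl] g] /=; [exact: gen1|exact: gen2]. Qed.

(** Pairing with [e1] and [e2] evaluates the two components at points, so these scalar equations are
    (2) tested against all vectors of Y and U. *)
Lemma Ss_gen x u z y : Ss Hs ((x, u), (z, y)) <->
  forall i, inner z (gx i) + inner x (gz i) = inner u (gu i) - inner y (gy i).
Proof.
split.
  move=> /SsP[h1 h2] [[[l hl] g]|[[m hm] v]] /=.
    rewrite ipNr ipZr conjCK !e1_ip // h1 // ipBl ipDl ipZl (adjointE (schur_bnd phi_schur hl)); ring.
  rewrite ipZr conjCK !e2_ip // h2 // ipBl ipDl ipNl ipZl.
  by rewrite (adjointEl (schur_bnd phi_schur (cplusJ hm))); ring.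
move=> h; apply/SsP; split=> [l hl|m hm].
  apply: ip_eq => g; have /= := h (inl (exist _ l hl, g)).
  rewrite ipNr ipZr conjCK !e1_ip // -(adjointE (schur_bnd phi_schur hl)) => E.
  by rewrite ipBl ipDl ipZl; rewrite -(addrA (l * _)) -E; ring.
apply: ip_eq => v; have /= := h (inr (exist _ m hm, v)).
rewrite ipZr conjCK !e2_ip // -(adjointEl (schur_bnd phi_schur (cplusJ hm))) => E.
by rewrite ipBl ipDl ipNl ipZl -(addrA (- _)) -E; ring.
Qed.

End CanonicalModelSpace.

(** * The Cayley transform of the graph *)

Section CayleyTransform.
Variables (R : realType) (U Y : hilbertType R) (phi : R[i] -> {linear U -> Y}).
Hypothesis phi_schur : operator_schur phi.
Variable Hs : rkhs (@cplus2 R) (Ks phi).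
Local Notation H := (rk_space Hs).
Local Notation gidx := (@gidx R U Y).
Local Notation gx := (@gx _ _ _ phi Hs).
Local Notation gz := (@gz _ _ _ phi Hs).
Local Notation gu := (@gu _ _ _ phi).
Local Notation gy := (@gy _ _ _ phi).
Local Notation e1 := (@e1 _ _ _ phi Hs).
Local Notation e2 := (@e2 _ _ _ phi Hs).

Lemma gen_neutral i j : inner (gz i) (gx j) + inner (gx i) (gz j) =
  inner (gu i) (gu j) - inner (gy i) (gy j).
Proof. exact: (Ss_gen phi_schur _ _ _ _).1 (gen_Ss phi_schur Hs i) j. Qed.

(** Pair [l x - l' x' = l (x - x') + (l - l') x'] with x - x'. For solutions at two points with
    common data this gives continuity in the point. *)
Lemma eigen_continuity (X : hilbertType R) (l l' : R[i]) (x x' : X) : cplus l ->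
  rip (l *: x - l' *: x') (x - x') <= 0 -> complex.Re l * nm (x - x') <= nm (l - l') * nm x'.
Proof.
move=> hl h; have [d0|d0] := eqVneq (x - x') 0.
  by rewrite d0 nm0 mulr0 mulr_ge0 ?nm_ge0.
have E : l *: x - l' *: x' = l *: (x - x') + (l - l') *: x' by rewrite scalerBr scalerBl; vring.
move: h; rewrite E ripDl.
have -> : rip (l *: (x - x')) (x - x') = complex.Re l * nm (x - x') ^+ 2.
  by rewrite /rip ipZl ip_nm ReM Re_cR Im_cR mulr0 subr0.
have : - rip ((l - l') *: x') (x - x') <= nm (l - l') * nm x' * nm (x - x').
  by rewrite -ripNl -nmZ -nmN; exact: rip_CS.
move=> h1 h2; rewrite -(ler_pM2r (nm_pos d0)) -[leLHS]mulrA -expr2; lra.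
Qed.

(** Both graph elements have the input v, so the energy of their difference is minus the square of
    an output, hence nonpositive. *)
Lemma e2_near m v (a : R[i]) : cplus a -> cplus m ->
  complex.Re m * nm (e2 m v - e2 a v) <= nm (m - a) * nm (e2 a v).
Proof.
move=> ha hm; rewrite -(nmJ (m - a)) rmorphB /= -ReJ; apply: eigen_continuity; first exact: cplusJ.
pose i : gidx := inr (exist _ m hm, v); pose j : gidx := inr (exist _ a ha, v).
have N p q := congr1 (@complex.Re R) (gen_neutral p q).
have := N i i; have := N i j; have := N j i; have := N j j; rewrite /= !ReD !ReN -!/(rip _ _).
have := sqr_ge0 (nm (phi m^* v - phi a^* v)); rewrite nm_sqrB -!rip_nm.
rewrite ripBl !ripBr (ripC (phi m^* v)) (ripC (m^* *: e2 m v)) (ripC (a^* *: e2 a v)).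
by rewrite (ripC (m^* *: e2 m v)) (ripC (a^* *: e2 a v) (e2 m v)); lra.
Qed.

Lemma e1_near l g (a : R[i]) : cplus a -> cplus l ->
  complex.Re l * nm (e1 l g - e1 a g) <= nm (l - a) * nm (e1 a g).
Proof.
move=> ha hl; rewrite -(nmJ (l - a)) rmorphB /= -ReJ; apply: eigen_continuity; first exact: cplusJ.
pose i : gidx := inl (exist _ l hl, g); pose j : gidx := inl (exist _ a ha, g).
have N p q := congr1 (@complex.Re R) (gen_neutral p q).
have := N i i; have := N i j; have := N j i; have := N j j; rewrite /= !ReD !ReN -!/(rip _ _).
have := sqr_ge0 (nm (adjoint (phi l) g - adjoint (phi a) g)); rewrite nm_sqrB -!rip_nm !ripNl !ripNr.
rewrite ripBl !ripBr (ripC (adjoint (phi l) g)) (ripC (l^* *: e1 l g)) (ripC (a^* *: e1 a g)).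
by rewrite (ripC (l^* *: e1 l g)) (ripC (a^* *: e1 a g) (e1 l g)); lra.
Qed.

(** It recovers orthogonality at the one point where a coefficient of the equations vanishes, by
    approaching it along a + r with r > 0. *)
Lemma orth_limit (X : hilbertType R) (f : X) (e : R[i] -> X) (a : R[i]) : cplus a ->
  (forall l, cplus l -> complex.Re l * nm (e l - e a) <= nm (l - a) * nm (e a)) ->
  (forall l, cplus l -> l != a -> inner f (e l) = 0) -> inner f (e a) = 0.
Proof.
move=> ha he hf; apply: nm_le_eq0 => d d0.
have a0 : 0 < complex.Re a by [].
pose M := nm f * nm (e a) + 1; have M0 : 0 < M by rewrite ltr_wpDl ?mulr_ge0 ?nm_ge0.
pose r := d * complex.Re a / M; have r0 : 0 < r by rewrite divr_gt0 // mulr_gt0.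
pose l := a + cR r.
have hl : cplus l by rewrite /cplus /= /l ReD Re_cR addr_gt0.
have la : l != a by rewrite /l -subr_eq0 addrAC subrr add0r cR_eq0 gt_eqF.
have lar : nm (l - a) = r by rewrite /l addrAC subrr add0r nm_cR0 // ltW.
have := he l hl; rewrite lar => h.
have h1 : complex.Re a * nm (e l - e a) <= r * nm (e a).
  by apply: le_trans h; rewrite ler_wpM2r ?nm_ge0 // /l ReD Re_cR lerDl ltW.
have -> : inner f (e a) = - inner f (e l - e a) by rewrite ipBr (hf l) // sub0r opprK.
rewrite nmN; apply: le_trans (ip_CS _ _) _.
rewrite -(ler_pM2l a0).
have h2 : complex.Re a * (nm f * nm (e l - e a)) <= nm f * (r * nm (e a)).
  by rewrite mulrCA ler_wpM2l ?nm_ge0.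
apply: le_trans h2 _.
have -> : complex.Re a * d = r * M by rewrite /r; field; rewrite gt_eqF.
by rewrite mulrCA ler_pM2l // /M lerDl.
Qed.

Variable alpha : R[i].
Hypothesis alpha0 : cplus alpha.

Let s : R := Num.sqrt (2 * complex.Re alpha).
Let s0 : 0 < s.
Proof. by rewrite sqrtr_gt0 mulr_gt0. Qed.
Let s2 : cR s * cR s = alpha + alpha^*.
Proof. by rewrite -cRM -expr2 sqr_sqrtr ?addJ // mulr_ge0 // ltW. Qed.

(* The Cayley transform [cay_in] |-> [cay_out] turns the energy balance into isometry. *)
Definition cay_in x u : dsum H U := (alpha *: x.1 - x.2, cR s *: u) : dsum H U.
Definition cay_out x y : dsum H Y := (alpha^* *: x.1 + x.2, cR s *: y) : dsum H Y.

Lemma cayley_ip (x z x' z' : H) (u u' : U) (y y' : Y) :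
  inner (cay_in (x, z) u) (cay_in (x', z') u') - inner (cay_out (x, z) y) (cay_out (x', z') y') =
  (alpha + alpha^*) * (inner u u' - inner y y' - (inner z x' + inner x z')).
Proof.
rewrite !dsum_ip /= !(ipBl, ipDl, ipBr, ipDr, ipZl, ipZr) !conjCK !cRJ.
rewrite mulrBr mulrBr -{1 2}s2; ring.
Qed.

Lemma alphaJ0 : alpha + alpha^* != 0.
Proof. by rewrite addJ cR_eq0 gt_eqF // mulr_gt0. Qed.

Lemma cayley_neutral (x z x' z' : H) (u u' : U) (y y' : Y) :
  inner (cay_in (x, z) u) (cay_in (x', z') u') = inner (cay_out (x, z) y) (cay_out (x', z') y') <->
  inner z x' + inner x z' = inner u u' - inner y y'.
Proof.
split=> [E|E].
  have := cayley_ip x z x' z' u u' y y'; rewrite E subrr => /esym/eqP.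
  by rewrite mulf_eq0 (negbTE alphaJ0) /= subr_eq0 => /eqP.
by apply/eqP; rewrite -subr_eq0 (cayley_ip x z x' z' u u' y y') E subrr mulr0.
Qed.

(** At the conjugate of [alpha] the coefficient of [e2] vanishes, which isolates w and gives w = 0.
    Then f is orthogonal to all kernel functions except possibly those at that point, where
    [orth_limit] applies. *)
Lemma cay_in_total : total (fun i => cay_in (gx i, gz i) (gu i)).
Proof.
move=> [f w] hf.
have k2 m v : cplus m -> (alpha^* - m) * inner f (e2 m v) + cR s * inner w v = 0.
  move=> hm; have := hf (inr (exist _ m hm, v)).
  by rewrite dsum_ip /= ipBr !ipZr cRJ conjCK mulrBl.
have k1 l g : cplus l -> (alpha^* + l) * inner f (e1 l g) + cR s * inner w (adjoint (phi l) g) = 0.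
  move=> hl; have := hf (inl (exist _ l hl, g)).
  by rewrite dsum_ip /= opprK ipDr !ipZr cRJ conjCK mulrDl.
have sn : cR s != 0 by rewrite cR_eq0 gt_eqF.
have w0 : w = 0.
  apply: ip_eq0 => v; have := k2 (alpha^*) v (cplusJ alpha0).
  by rewrite subrr mul0r add0r => /eqP; rewrite mulf_eq0 (negbTE sn) => /eqP.
have f0 : f = 0.
  apply: (rk_total phi_schur) => [l g hl|m v hm].
    have := k1 l g hl; rewrite w0 ip0l mulr0 addr0 => /eqP; rewrite mulf_eq0 => /orP[/eqP E|/eqP//].
    move: (congr1 (@complex.Re R) E) => {E}; rewrite ReD ReJ /= => E'.
    by have := addr_gt0 alpha0 hl; rewrite E' ltxx.
  have k3 m' : cplus m' -> m' != alpha^* -> inner f (e2 m' v) = 0.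
    move=> hm' ne; have := k2 m' v hm'; rewrite w0 ip0l mulr0 addr0 => /eqP.
    by rewrite mulf_eq0 subr_eq0 eq_sym (negbTE ne) => /eqP.
  have [->|ne] := eqVneq m (alpha^*); last exact: k3.
  apply: (orth_limit (e := fun m => e2 m v) (cplusJ alpha0)) => // l hl.
  by apply: e2_near => //; exact: cplusJ.
by rewrite w0 f0.
Qed.

(** As for [cay_in_total], with the families exchanged: now the coefficient of [e1] vanishes at
    [alpha]. *)
Lemma cay_out_total : total (fun i => cay_out (gx i, gz i) (gy i)).
Proof.
move=> [f w] hf.
have k2 m v : cplus m -> (alpha + m) * inner f (e2 m v) + cR s * inner w (phi (m^*) v) = 0.
  move=> hm; have := hf (inr (exist _ m hm, v)).
  by rewrite dsum_ip /= ipDr !ipZr cRJ !conjCK mulrDl.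
have k1 l g : cplus l -> (alpha - l) * inner f (e1 l g) + cR s * inner w g = 0.
  move=> hl; have := hf (inl (exist _ l hl, g)).
  by rewrite dsum_ip /= ipBr !ipZr cRJ !conjCK mulrBl.
have sn : cR s != 0 by rewrite cR_eq0 gt_eqF.
have w0 : w = 0.
  apply: ip_eq0 => v; have := k1 alpha v alpha0.
  by rewrite subrr mul0r add0r => /eqP; rewrite mulf_eq0 (negbTE sn) => /eqP.
have f0 : f = 0.
  apply: (rk_total phi_schur) => [l g hl|m v hm].
    have k3 m' : cplus m' -> m' != alpha -> inner f (e1 m' g) = 0.
      move=> hm' ne; have := k1 m' g hm'; rewrite w0 ip0l mulr0 addr0 => /eqP.
      by rewrite mulf_eq0 subr_eq0 eq_sym (negbTE ne) => /eqP.
    have [->|ne] := eqVneq l alpha; last exact: k3.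
    by apply: (orth_limit (e := fun l => e1 l g) alpha0) => // l' hl'; exact: e1_near.
  have := k2 m v hm; rewrite w0 ip0l mulr0 addr0 => /eqP; rewrite mulf_eq0 => /orP[/eqP E|/eqP//].
  move: (congr1 (@complex.Re R) E) => {E}; rewrite ReD /= => E'.
  by have := addr_gt0 alpha0 hm; rewrite E' ltxx.
by rewrite w0 f0.
Qed.

(** Neutrality makes the two Gram matrices equal. The equation [W (cay_in ...) = cay_out ...] may be
    tested on the total family [cay_out], where it is the condition of [Ss_gen]; so W describes the
    whole graph. *)
Lemma cayley_unitary : exists W : {linear dsum H U -> dsum H Y},
  [/\ forall p q, inner (W p) (W q) = inner p q, forall q, exists p, W p = q,
      forall x u z y, Ss Hs ((x, u), (z, y)) <-> W (cay_in (x, z) u) = cay_out (x, z) y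
    & True].
Proof.
have [W [Wi Ws Wg]] := unitary_extension
  (fun i j => (cayley_neutral _ _ _ _ _ _ _ _).2 (gen_neutral i j)) cay_in_total cay_out_total.
exists W; split => // x u z y; rewrite (Ss_gen phi_schur); split=> [h|h i].
  apply: (total_eq cay_out_total) => i.
  rewrite -{1}Wg Wi; exact: (cayley_neutral _ _ _ _ _ _ _ _).2 (h i).
by apply/cayley_neutral; rewrite -h -Wg Wi.
Qed.

Lemma cay_in_surj (f : H) (w : H) : exists x z : H, alpha *: x - z = f /\ alpha^* *: x + z = w.
Proof.
exists ((alpha + alpha^*)^-1 *: (f + w)), (alpha *: ((alpha + alpha^*)^-1 *: (f + w)) - f).
split; first by rewrite subKr.
rewrite addrA -scalerDl addrC scalerA [alpha^* + alpha]addrC mulfV ?alphaJ0 // scale1r.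
vring.
Qed.

Lemma Ss_solve f u : exists x z y, Ss Hs ((x, u), (z, y)) /\ alpha *: x - z = f.
Proof.
have [W [Wi Ws WS _]] := cayley_unitary.
case E : (W ((f, cR s *: u) : dsum H U)) => [w y'].
have [x [z [h1 h2]]] := cay_in_surj f w.
exists x, z, (cR s^-1 *: y'); split => //; apply/WS.
have -> : cay_in (x, z) u = (f, cR s *: u) by rewrite /cay_in /= h1.
by rewrite E /cay_out /= h2 scalerA -cRM mulfV ?gt_eqF // scale1r.
Qed.

(** Surjectivity of W solves the time-reversed equation, which is that of the adjoint node. *)
Lemma Ss_solve_dual w y : exists x z u, Ss Hs ((x, u), (z, y)) /\ alpha^* *: x + z = w.
Proof.
have [W [Wi Ws WS _]] := cayley_unitary.
have [[f u'] E] := Ws ((w, cR s *: y) : dsum H Y).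
have [x [z [h1 h2]]] := cay_in_surj f w.
exists x, z, (cR s^-1 *: u'); split => //; apply/WS.
have -> : cay_out (x, z) y = (w, cR s *: y) by rewrite /cay_out /= h2.
rewrite -E; congr (W _); rewrite /cay_in /= h1 scalerA -cRM mulfV ?gt_eqF // scale1r //.
Qed.

(** [Ss_gen] only pairs with kernel functions; that W is isometric extends neutrality to any two
    elements of the graph. *)
Lemma Ss_neutral x u z y x' u' z' y' : Ss Hs ((x, u), (z, y)) -> Ss Hs ((x', u'), (z', y')) ->
  inner z x' + inner x z' = inner u u' - inner y y'.
Proof.
have [W [Wi _ WS _]] := cayley_unitary.
by move=> /WS h /WS h'; apply/cayley_neutral; rewrite -h -h' Wi.
Qed.

End CayleyTransform.

(** * The node properties of S_s *)

Section CanonicalNode.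
Variables (R : realType) (U Y : hilbertType R) (phi : R[i] -> {linear U -> Y}).
Hypothesis phi_schur : operator_schur phi.
Variable Hs : rkhs (@cplus2 R) (Ks phi).
Local Notation H := (rk_space Hs).
Local Notation gidx := (@gidx R U Y).
Local Notation gx := (@gx _ _ _ phi Hs).
Local Notation gz := (@gz _ _ _ phi Hs).
Local Notation gu := (@gu _ _ _ phi).
Local Notation gy := (@gy _ _ _ phi).
Local Notation e1 := (@e1 _ _ _ phi Hs).
Local Notation e2 := (@e2 _ _ _ phi Hs).
Let Sgen := @Ss_gen _ _ _ _ phi_schur Hs.

Lemma Ss_neut x u z y x' u' z' y' : Ss Hs ((x, u), (z, y)) -> Ss Hs ((x', u'), (z', y')) ->
  inner z x' + inner x z' = inner u u' - inner y y'.
Proof. exact: (Ss_neutral phi_schur (cplus1 R)). Qed.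

Lemma Ss_energy : energy_preserving (Ss Hs).
Proof.
apply: energy_preservingI => x u z y h.
have := congr1 (@complex.Re R) (Ss_neut h h); rewrite !ReD ReN !ip_nm !Re_cR -!/(rip _ _).
by rewrite (ripC z x); lra.
Qed.

Lemma Ss_comb (a : R[i]) x u z y x' u' z' y' :
  Ss Hs ((x, u), (z, y)) -> Ss Hs ((x', u'), (z', y')) ->
  Ss Hs ((a *: x + x', a *: u + u'), (a *: z + z', a *: y + y')).
Proof.
move=> /Sgen h /Sgen h'; apply/Sgen => i.
have -> : inner (a *: z + z') (gx i) + inner (a *: x + x') (gz i) =
    a * (inner z (gx i) + inner x (gz i)) + (inner z' (gx i) + inner x' (gz i)).
  by rewrite !ipDl !ipZl; ring.
by rewrite h h' !ipDl !ipZl; ring.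
Qed.

Lemma Ss_linear : linear_operator (Ss Hs).
Proof.
split.
- by apply/Sgen => i; rewrite !ip0l subr0 addr0.
- by move=> a [[x u] [z y]] [[x' u'] [z' y']]; exact: Ss_comb.
move=> [x u] [z y] [z' y'] h h'.
have hd := Ss_comb (-1) h' h; rewrite !scaleN1r !addNr in hd.
(* An element over (0, 0) has y = 0 because it is neutral to itself; then z is orthogonal to all
   kernel functions. *)
have := Ss_neut hd hd; rewrite ip0l ip0r addr0 ip0l sub0r ip_nm => /eqP.
rewrite eq_sym oppr_eq0 cR_eq0 sqrf_eq0 => /eqP/nm_eq0 dy.
have dz : - z' + z = 0.
  apply: (rk_total phi_schur) => [l g hl|m v hm].
    have /Sgen /(_ (inl (exist _ l hl, g))) := hd.
    by rewrite dy !ip0l /= addr0 subr0.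
  have /Sgen /(_ (inr (exist _ m hm, v))) := hd.
  by rewrite dy !ip0l /= addr0 subr0.
by congr pair; apply/eqP; rewrite -subr_eq0 addrC ?dz ?dy.
Qed.

Lemma Ss_solvable : solvable_node (Ss Hs).
Proof. by move=> lam hl f u; exact: (Ss_solve phi_schur). Qed.

Lemma Ss_passive : passive (Ss Hs).
Proof. by apply: energy_passive; exact: Ss_energy. Qed.

(** The graph is its own neutral companion: neutrality to all of it implies the equations of
    [Ss_gen], and conversely by [Ss_neut]. Hence the adjoint is the node run backwards in time. *)
Lemma Ss_adjointP x y z u : adjoint_node (Ss Hs) ((x, y), (z, u)) <-> Ss Hs ((x, u), (- z, y)).
Proof.
split=> [h|h].
  apply/Sgen => i; have := h _ (gen_Ss phi_schur Hs i); rewrite /dsum_inner /= => E.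
  have := congr1 Num.conj E; rewrite !rmorphD /= -!ipC => E'.
  apply/eqP; rewrite -subr_eq0 ipNl; apply/eqP.
  have -> : - inner z (gx i) + inner x (gz i) - (inner u (gu i) - inner y (gy i)) =
    (inner x (gz i) + inner y (gy i)) - (inner z (gx i) + inner u (gu i)) by ring.
  by rewrite E' subrr.
move=> [[x' u'] [z' y']] h'; rewrite /dsum_inner /=.
have := Ss_neut h' h; rewrite ipNr => E.
apply/eqP; rewrite -subr_eq0; apply/eqP.
have -> : inner z' x + inner y' y - (inner x' z + inner u' u) =
   (inner z' x + - inner x' z) - (inner u' u - inner y' y) by ring.
by rewrite E subrr.
Qed.

Lemma Sd_linear : linear_operator (adjoint_node (Ss Hs)).
Proof.
have [S0 _ Sf] := Ss_linear; split.
- by apply/Ss_adjointP; rewrite oppr0.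
- move=> a [[x y] [z u]] [[x' y'] [z' u']] /Ss_adjointP h /Ss_adjointP h'; apply/Ss_adjointP.
  have := Ss_comb a h h'; congr (Ss Hs (_, (_, _))); rewrite scalerN opprD //.
move=> [x y] [z u] [z' u'] /Ss_adjointP h /Ss_adjointP h'.
have hd := Ss_comb (-1) h' h; rewrite !scaleN1r !addNr opprK in hd.
have := Ss_neut hd hd; rewrite !ip0l !ip0r addr0 subr0 ip_nm => /esym/eqP.
rewrite cR_eq0 sqrf_eq0 => /eqP/nm_eq0 du.
rewrite du in hd; have [zz _] := node_fun Ss_linear hd S0.
congr pair; first by apply/eqP; rewrite eq_sym -subr_eq0 zz.
by apply/eqP; rewrite -subr_eq0 addrC du.
Qed.

Lemma Sd_energy : energy_preserving (adjoint_node (Ss Hs)).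
Proof.
apply: energy_preservingI => x y z u /Ss_adjointP /(energy_eq Ss_energy).
by rewrite ripNl; lra.
Qed.

Lemma Sd_passive : passive (adjoint_node (Ss Hs)).
Proof. by apply: energy_passive; exact: Sd_energy. Qed.

Lemma Sd_solvable : solvable_node (adjoint_node (Ss Hs)).
Proof.
move=> lam hl f y.
have [x [z [u [h E]]]] := Ss_solve_dual phi_schur (Hs := Hs) (cplusJ hl) f y.
exists x, (- z), u; split; first by apply/Ss_adjointP; rewrite opprK.
by rewrite opprK -E conjCK.
Qed.

Lemma Ss_conservative : conservative (Ss Hs).
Proof. by split; [exact: Ss_energy|exact: Sd_energy]. Qed.

Lemma Ss_limit (x z : nat -> H) (u : nat -> U) (y : nat -> Y) x0 z0 u0 y0 :
  x @ \oo --> x0 -> z @ \oo --> z0 -> u @ \oo --> u0 -> y @ \oo --> y0 ->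
  (forall n, Ss Hs ((x n, u n), (z n, y n))) -> Ss Hs ((x0, u0), (z0, y0)).
Proof.
move=> xl zl ul yl h; apply/Sgen => i; apply/eqP; rewrite -subr_eq0; apply/eqP/nm_le_eq0 => e e0.
have e4 : 0 < e / 4 by rewrite divr_gt0.
have [N1 h1] := ip_lim zl (@seq_cst _ _ (gx i)) e4.
have [N2 h2] := ip_lim xl (@seq_cst _ _ (gz i)) e4.
have [N3 h3] := ip_lim ul (@seq_cst _ _ (gu i)) e4.
have [N4 h4] := ip_lim yl (@seq_cst _ _ (gy i)) e4.
pose n := maxn (maxn N1 N2) (maxn N3 N4).
have := leqnn n; rewrite {1}/n !geq_max => /andP[/andP[/h1 {}h1 /h2 {}h2] /andP[/h3 {}h3 /h4 {}h4]].
have /Sgen /(_ i) E := h n.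
have -> : inner z0 (gx i) + inner x0 (gz i) - (inner u0 (gu i) - inner y0 (gy i)) =
   (inner z0 (gx i) - inner (z n) (gx i)) + (inner x0 (gz i) - inner (x n) (gz i))
   - (inner u0 (gu i) - inner (u n) (gu i)) + (inner y0 (gy i) - inner (y n) (gy i))
   + (inner (z n) (gx i) + inner (x n) (gz i) - (inner (u n) (gu i) - inner (y n) (gy i))) by ring.
rewrite E subrr addr0; apply: le_trans (nmD _ _) _.
apply: le_trans (lerD (nmB _ _) (lexx _)) _; apply: le_trans (lerD (lerD (nmD _ _) (lexx _)) (lexx _)) _.
lra.
Qed.

Lemma nm_pair (V W : normedModType R[i]) (p : (V * W)%type) : nm p.1 <= nm p /\ nm p.2 <= nm p.
Proof.
split; rewrite -cR_le -!nmE prod_normE; last by rewrite comparable_le_max ?lexx ?orbT ?real_comparable ?normr_real.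
by rewrite comparable_le_max ?lexx ?real_comparable ?normr_real.
Qed.

Lemma pair_seq (V W : normedModType R[i]) (u : nat -> (V * W)%type) (l : (V * W)%type) :
  u @ \oo --> l -> (fun n => (u n).1) @ \oo --> l.1 /\ (fun n => (u n).2) @ \oo --> l.2.
Proof.
move=> /cvg_seq_nm h; split; apply/cvg_seq_nm => e /h[N hN]; exists N => n /hN;
  apply: le_lt_trans; have [h1 h2] := nm_pair (l - u n); [exact: h1|exact: h2].
Qed.

Lemma Ss_closed : closed (Ss Hs).
Proof.
move=> p /closure_seq[q [hq qp]].
have [/pair_seq[h1 h2] /pair_seq[h3 h4]] := pair_seq qp.
move: p h1 h2 h3 h4 {qp} => [[x u] [z y]] /= h1 h2 h3 h4.
apply: (Ss_limit h1 h3 h2 h4) => n.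
by have := hq n; case: (q n) => -[? ?] [? ?].
Qed.

Lemma x1_lin (a : R[i]) (x x' : H) l : cplus l -> x1 (a *: x + x') l = a *: x1 x l + x1 x' l.
Proof.
move=> hl; apply: ip_eq => g; rewrite -(e1_ip phi_schur) // ipDl ipZl !(e1_ip phi_schur) //.
by rewrite ipDl ipZl.
Qed.

Lemma x1_seq (x : nat -> H) x0 : x @ \oo --> x0 -> (fun n => x1 (x n) 1) @ \oo --> x1 x0 1.
Proof.
have c1 := cplus1 R.
have xB (a b : H) : x1 (a - b) 1 = x1 a 1 - x1 b 1.
  by have := x1_lin (-1) b a c1; rewrite !scaleN1r [- b + a]addrC => ->; rewrite addrC.
move=> /cvg_seq_nm h; apply/cvg_seq_nm => e e0; have [N hN] := h e e0; exists N => n /hN.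
rewrite -xB => hn; have := x1_bound phi_schur (x0 - x n) c1 => hb.
rewrite -(@ltr_pXn2r _ 2) ?nnegrE ?nm_ge0 ?(ltW e0) //.
have h2 : nm (x0 - x n) ^+ 2 < e ^+ 2 by rewrite ltr_pXn2r ?nnegrE ?nm_ge0 ?(ltW e0).
have := sqr_ge0 (nm (x1 (x0 - x n) 1)); move: hb => /=; lra.
Qed.

Lemma AB_closed : closed (AB (Ss Hs)).
Proof.
have c1 := cplus1 R.
move=> p /closure_seq[q [hq qp]].
have [/pair_seq[h1 h2] h3] := pair_seq qp.
pose yq n := x1 (q n).1.1 1 + phi 1 (q n).1.2 - x1 (q n).2 1.
have hy n : Ss Hs ((q n).1, ((q n).2, yq n)).
  have [y hy] := hq n; suff -> : yq n = y by [].
  move: hy; rewrite /yq; case: (q n) => -[x u] z /= /(SsP phi_schur)[/(_ 1 c1) -> _].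
  by rewrite scale1r; vring.
have yl : yq @ \oo --> x1 p.1.1 1 + phi 1 p.1.2 - x1 p.2 1.
  apply: seqB; last exact: x1_seq.
  by apply: seqD; [exact: x1_seq|exact: (bounded_seq (schur_bnd phi_schur c1) h2)].
exists (x1 p.1.1 1 + phi 1 p.1.2 - x1 p.2 1).
move: p h1 h2 h3 yl {qp} => [[x u] z] /= h1 h2 h3 yl.
by apply: (Ss_limit h1 h3 h2 yl) => n; have := hy n; case: (q n) => -[? ?] ?.
Qed.

Lemma Ss_system_node : system_node (Ss Hs).
Proof.
split; [exact: Ss_linear|exact: Ss_closed|exact: AB_closed| |].
  exact: (solvable_generates Ss_linear Ss_passive Ss_solvable).
move=> u; exists (e2 1 u); eexists; exact: (gen2 phi_schur Hs u (cplus1 R)).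
Qed.

Lemma e2_control m v : cplus m -> control_resolvent (Ss Hs) (m^*) v (e2 m v).
Proof.
move=> hm; apply: (solvable_control_resolvent Ss_linear Ss_passive Ss_solvable (cplusJ hm)).
exact: gen2.
Qed.

Lemma e1_control l g : cplus l -> control_resolvent (adjoint_node (Ss Hs)) (l^*) g (e1 l g).
Proof.
move=> hl; apply: (solvable_control_resolvent Sd_linear Sd_passive Sd_solvable (cplusJ hl)).
by apply/Ss_adjointP; exact: gen1.
Qed.

Lemma Ss_simple : simple (Ss Hs).
Proof.
split; first exact: Ss_passive.
apply: total_dense => x hx.
have c1 := cplus1 R.
(* Simplicity speaks of sums of one vector from each family; a zero summand isolates the other. *)
have e20 : e2 1 0 = 0 by apply: ip_eqr => x'; rewrite (e2_ip phi_schur) // !ip0r.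
have e10 : e1 1 0 = 0 by apply: ip_eqr => x'; rewrite (e1_ip phi_schur) // !ip0r.
apply: (rk_total phi_schur) => [l g hl|m v hm]; apply: hx.
  exists (l^*), (1^*), g, 0, (e1 l g), (e2 1 0); split.
  - exact: cplusJ.
  - exact: cplusJ.
  - exact: e1_control.
  - exact: e2_control.
  - by rewrite e20 addr0.
exists (1^*), (m^*), 0, v, (e1 1 0), (e2 m v); split.
- exact: cplusJ.
- exact: cplusJ.
- exact: e1_control.
- exact: e2_control.
- by rewrite e10 add0r.
Qed.

Lemma Ss_transfer : has_transfer_function (Ss Hs) phi.
Proof.
move=> lam hl u; have hlJ := cplusJ hl.
exists (e2 (lam^*) u), (lam *: e2 (lam^*) u); split.
  by have := e2_control u hlJ; rewrite conjCK.
by have := gen2 phi_schur Hs u hlJ; rewrite conjCK.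
Qed.

End CanonicalNode.

(** * Uniqueness up to unitary similarity *)

Section Uniqueness.
Variables (R : realType) (U Y : hilbertType R) (phi : R[i] -> {linear U -> Y}).
Hypothesis phi_schur : operator_schur phi.
Variables (X : hilbertType R) (S : node U X Y).
Hypotheses (S_node : system_node S) (S_cons : conservative S) (S_simple : simple S).
Hypothesis S_tf : has_transfer_function S phi.
Local Notation Sd := (adjoint_node S).

Let S_lin : linear_operator S. Proof. by case: S_node. Qed.
Let S_dom : forall u, exists x, dom S (x, u). Proof. by case: S_node. Qed.
Let S_pass : passive S. Proof. by case: S_simple. Qed.

Lemma node_resolvent l : cplus l -> exists T, is_resolvent (main_operator S) l T.
Proof. by move=> hl; have [x [z [[hr _] _]]] := S_tf hl 0. Qed.

Lemma node_main_dense (x : X) (e : R) : 0 < e ->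
  exists x' z', main_operator S (x', z') /\ nm (x - x') < e.
Proof.
have [T [_ TA _]] := node_resolvent (cplus1 R).
apply: (dissipative_dense (main_lin S_lin) (main_diss S_pass) (cplus1 R)) => f.
by exists (T f), (1 *: T f - f); split; [exact: TA|rewrite subKr].
Qed.

Lemma node_eigen m v : cplus m -> exists x, S ((x, v), (m^* *: x, phi m^* v)).
Proof.
move=> hm; have [x [z [hx h]]] := S_tf (cplusJ hm) v.
have [y h'] := control_resolvent_node S_lin S_pass S_dom (cplusJ hm) hx.
by exists x; have [zE _] := node_fun S_lin h h'; rewrite -zE.
Qed.

Lemma adjoint_pairing x u z y x' w z' v : S ((x, u), (z, y)) -> Sd ((x', w), (z', v)) ->
  inner z x' + inner y w = inner x z' + inner u v.
Proof. by move=> h h'; exact: (h' _ h). Qed.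

(** Single-valuedness uses density: the domain of A is dense, which fixes z, and every u occurs in
    the domain of S, which fixes v. *)
Lemma adjoint_node_linear : linear_operator Sd.
Proof.
split.
- by move=> p _; rewrite /dsum_inner /= !ip0r.
- move=> a [[x w] [z v]] [[x' w'] [z' v']] h h' [[x0 u0] [z0 y0]] h0.
  have E := adjoint_pairing h0 h; have E' := adjoint_pairing h0 h'.
  rewrite /dsum_inner /= !ipDr !ipZr.
  have -> : a^* * inner z0 x + inner z0 x' + (a^* * inner y0 w + inner y0 w') =
    a^* * (inner z0 x + inner y0 w) + (inner z0 x' + inner y0 w') by ring.
  by rewrite E E'; ring.
move=> [x w] [z v] [z' v'] h h'.
have d x0 u0 : dom S (x0, u0) -> inner x0 (z - z') + inner u0 (v - v') = 0.
  move=> [[z0 y0] h0]; rewrite !ipBr addrACA -opprD.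
  by rewrite -(adjoint_pairing h0 h) -(adjoint_pairing h0 h') subrr.
have z0 : z - z' = 0.
  have dA x0 z0 : main_operator S (x0, z0) -> inner x0 (z - z') = 0.
    by move=> [y0 h0]; rewrite -[RHS](@d x0 0) ?ip0l ?addr0 //; exists (z0, y0).
  apply: ip_eq0 => f; apply: nm_le_eq0 => e e0.
  have M0 : 0 < nm (z - z') + 1 by have := nm_ge0 (z - z'); lra.
  have [x0 [z0 [h0 hx]]] := node_main_dense f (divr_gt0 e0 M0).
  rewrite ipC nmJ -[inner f _]subr0 -(dA _ _ h0) -ipBl; apply: le_trans (ip_CS _ _) _.
  apply: le_trans (ler_wpM2r (nm_ge0 _) (ltW hx)) _.
  rewrite mulrAC ler_pdivrMr // ler_wpM2l ?(ltW e0) //; lra.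
have v0 : v - v' = 0.
  apply: ip_eq0 => u; have [x0 hx0] := S_dom u.
  by have := d _ _ hx0; rewrite z0 ip0r add0r [inner (v - v') u]ipC => ->; rewrite conjC0.
by congr pair; apply/eqP; rewrite -subr_eq0 ?z0 ?v0.
Qed.

(** The vector is the adjoint of C (l - A)^{-1} applied to g, obtained by Riesz from the boundedness
    of that operator. *)
Lemma adjoint_node_eigen l g : cplus l -> exists x, Sd ((x, g), (l^* *: x, adjoint (phi l) g)).
Proof.
move=> hl; have [T [Tc TA TU]] := node_resolvent hl.
(* c is C (l - A)^{-1}. *)
have /choice[c hc] : forall f, exists y, S ((T f, 0), (l *: T f - f, y)) by move=> f; exact: TA.
have cl a f f' : c (a *: f + f') = a *: c f + c f'.
  have := node_comb S_lin a (hc f) (hc f'); rewrite scaler0 addr0.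
  have -> : a *: (l *: T f - f) + (l *: T f' - f') = l *: T (a *: f + f') - (a *: f + f').
    by rewrite linearP !scalerDr scalerN !scalerA (mulrC l); vring.
  by rewrite -linearP => h; have [_ ->] := node_fun S_lin (hc (a *: f + f')) h.
have l0 : 0 < complex.Re l by [].
(* Passivity gives |c f|^2 <= (2 / Re l) |f|^2, and 2 / Re l is below the square of 2 / Re l + 1. *)
have cb f : nm (c f) <= (2 / complex.Re l + 1) * nm f.
  have := passive_le S_pass (hc f); rewrite nm0 expr0n /= ripBl sub0r => h.
  have hT : complex.Re l * nm (T f) <= nm f.
    have hA : main_operator S (T f, l *: T f - f) by exists (c f); exact: hc.
    by have := diss_bound hl (main_diss S_pass hA); rewrite subKr.
  have hT2 : nm (T f) <= (complex.Re l)^-1 * nm f by rewrite ler_pdivlMl.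
  have r1 : rip (l *: T f) (T f) = complex.Re l * nm (T f) ^+ 2.
    by rewrite /rip ipZl ip_nm ReM Re_cR Im_cR mulr0 subr0.
  have r2 := rip_CS f (T f).
  have r3 := ler_wpM2l (nm_ge0 f) hT2.
  have r4 : 0 <= complex.Re l * nm (T f) ^+ 2 by rewrite mulr_ge0 ?sqr_ge0 ?ltW.
  have il : 0 <= (complex.Re l)^-1 by rewrite invr_ge0 ltW.
  rewrite r1 in h; rewrite -(@ler_pXn2r _ 2) ?nnegrE ?mulr_ge0 ?nm_ge0 //; last first.
    by rewrite addr_ge0 // mulr_ge0.
  move: r3 il h r4 r2; move: (complex.Re l)^-1 (nm f) (nm_ge0 f) => i nf nf0.
  move=> r3 il h r4 r2; have r5 : 0 <= i ^+ 2 * nf ^+ 2 by rewrite mulr_ge0 ?sqr_ge0.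
  have r6 : 0 <= i * nf ^+ 2 by rewrite mulr_ge0 ?sqr_ge0.
  have r7 := sqr_ge0 nf; lra.
have [x hx] : exists x, forall f, inner (c f) g = inner f x.
  apply: (@riesz _ _ _ ((2 / complex.Re l + 1) * nm g)) => [a f f'|f].
    by rewrite cl ipDl ipZl.
  by apply: le_trans (ip_CS _ _) _; rewrite mulrAC ler_wpM2r ?nm_ge0.
exists x => -[[x0 u] [z y]] h; rewrite /dsum_inner /=.
(* Subtracting the solution with the same input u leaves an element of the main operator, on which
   the output is given by c. *)
have [w hw] := node_eigen u (cplusJ hl); rewrite conjCK in hw.
have := node_sub S_lin h hw; rewrite subrr => h'.
have hA : main_operator S (x0 - w, z - l *: w) by exists (y - phi l u).
have E : l *: (x0 - w) - (z - l *: w) = l *: x0 - z by rewrite scalerBr; vring.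
have Tf : T (l *: x0 - z) = x0 - w by rewrite -E; exact: TU.
have hf := hc (l *: x0 - z); rewrite Tf -E subKr in hf.
have [_ yE] := node_fun S_lin h' hf; have := hx (l *: x0 - z); rewrite -E -yE E.
rewrite !ipBl ipZl ipZr conjCK (adjointE (schur_bnd phi_schur hl)) => E2.
have -> : inner y g = l * inner x0 x - inner z x + inner u (adjoint (phi l) g) by rewrite -E2 subrK.
ring.
Qed.

Lemma eigen_exists (p : R[i] * U) : exists x, cplus p.1 ->
  S ((x, p.2), (p.1^* *: x, phi p.1^* p.2)).
Proof.
have [hm|hm] := pselect (cplus p.1); last by exists 0.
by have [x hx] := node_eigen p.2 hm; exists x.
Qed.

Lemma dual_eigen_exists (p : R[i] * Y) : exists x, cplus p.1 ->
  Sd ((x, p.2), (p.1^* *: x, adjoint (phi p.1) p.2)).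
Proof.
have [hm|hm] := pselect (cplus p.1); last by exists 0.
by have [x hx] := adjoint_node_eigen p.2 hm; exists x.
Qed.

Definition s1 l g : X := projT1 (cid (dual_eigen_exists (l, g))).
Definition s2 m v : X := projT1 (cid (eigen_exists (m, v))).

Lemma s1P l g : cplus l -> Sd ((s1 l g, g), (l^* *: s1 l g, adjoint (phi l) g)).
Proof. exact: projT2 (cid (dual_eigen_exists (l, g))). Qed.

Lemma s2P m v : cplus m -> S ((s2 m v, v), (m^* *: s2 m v, phi m^* v)).
Proof. exact: projT2 (cid (eigen_exists (m, v))). Qed.

Let S_energy : energy_preserving S. Proof. by case: S_cons. Qed.
Let Sd_energy : energy_preserving Sd. Proof. by case: S_cons. Qed.
Let Sd_lin := adjoint_node_linear.
Let Sd_pass := energy_passive Sd_energy.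

(** The vectors in the definition of [simple] solve the equations of [s1] and [s2] at the conjugate
    points, and passivity makes these solutions unique. *)
Lemma s_total (x : X) : (forall l g, cplus l -> inner x (s1 l g) = 0) ->
  (forall m v, cplus m -> inner x (s2 m v) = 0) -> x = 0.
Proof.
move=> h1 h2; have [_ S_dense] := S_simple; apply: (dense_total S_dense).
move=> _ [l [m [g [v [a [b [hl hm ha hb ->]]]]]]].
have Sd_dom w : exists x, dom Sd (x, w).
  by exists (s1 1 w); eexists; exact: (s1P w (cplus1 R)).
have [w hw] := control_resolvent_node Sd_lin Sd_pass Sd_dom hl ha.
have [y hy] := control_resolvent_node S_lin S_pass S_dom hm hb.
have e1 := s1P g (cplusJ hl); rewrite conjCK in e1.
have e2 := s2P v (cplusJ hm); rewrite conjCK in e2.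
have [-> _] := passive_eigen_uniq Sd_lin Sd_pass hl hw e1.
have [-> _] := passive_eigen_uniq S_lin S_pass hm hy e2.
by rewrite ipDr h1 ?h2 ?addr0 //; exact: cplusJ.
Qed.

Lemma s2_near m v (a : R[i]) : cplus a -> cplus m ->
  complex.Re m * nm (s2 m v - s2 a v) <= nm (m - a) * nm (s2 a v).
Proof.
move=> ha hm; rewrite -(nmJ (m - a)) rmorphB /= -ReJ; apply: eigen_continuity; first exact: cplusJ.
have := passive_le S_pass (node_sub S_lin (s2P v hm) (s2P v ha)).
by rewrite subrr nm0 expr0n /=; have := sqr_ge0 (nm (phi m^* v - phi a^* v)); lra.
Qed.

Variable Hs : rkhs (@cplus2 R) (Ks phi).
Local Notation H := (rk_space Hs).
Local Notation gidx := (@gidx R U Y).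
Local Notation gx := (@gx _ _ _ phi Hs).
Local Notation gz := (@gz _ _ _ phi Hs).
Local Notation gu := (@gu _ _ _ phi).
Local Notation gy := (@gy _ _ _ phi).
Local Notation e1 := (@e1 _ _ _ phi Hs).
Local Notation e2 := (@e2 _ _ _ phi Hs).

Definition sx (i : gidx) : X := match i with inl p => s1 (sval p.1) p.2 | inr p => s2 (sval p.1) p.2 end.
(** The scalar for which [gz i] is [sc i] times [gx i]; the minus sign belongs to the family that
    comes from the adjoint node. *)
Definition sc (i : gidx) : R[i] := match i with inl p => - (sval p.1)^* | inr p => (sval p.1)^* end.

Lemma gzE i : gz i = sc i *: gx i.
Proof. by case: i => -[[l hl] g] //=; rewrite scaleNr. Qed.

Lemma node_gen x u z y : S ((x, u), (z, y)) -> forall i,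
  inner z (sx i) + inner x (sc i *: sx i) = inner u (gu i) - inner y (gy i).
Proof.
move=> h [[[l hl] g]|[[m hm] v]] /=; last exact: (energy_neutral S_lin S_energy h (s2P v hm)).
rewrite scaleNr ipNr; have E := adjoint_pairing h (s1P g hl).
apply/eqP; rewrite -subr_eq0; apply/eqP.
set a := inner _ _; set b := inner _ (_ *: _); set c := inner _ _; set d := inner _ _.
have -> : a - b - (c - d) = (a + d) - (b + c) by ring.
by rewrite /a /b /c /d E subrr.
Qed.

Lemma sx_neutral i j : inner (sc i *: sx i) (sx j) + inner (sx i) (sc j *: sx j) =
  inner (gu i) (gu j) - inner (gy i) (gy j).
Proof.
case: i => [[[l hl] g]|[[m hm] v]]; last exact: (node_gen (s2P v hm)).
case: j => [[[l' hl'] g']|[[m hm] v]] /=.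
  rewrite !scaleNr ipNl ipNr; have := energy_neutral Sd_lin Sd_energy (s1P g hl) (s1P g' hl').
  by move=> E; rewrite -opprD E opprB.
have := node_gen (s2P v hm) (inl (exist _ l hl, g)) => /= /(congr1 Num.conj).
by rewrite !rmorphD !rmorphN /= -!ipC addrC => ->.
Qed.

(** The energy balance yields the Gram entry multiplied by this factor, with the same right-hand
    side in both nodes. *)
Lemma sx_gram_off i j : sc i + (sc j)^* != 0 -> inner (sx i) (sx j) = inner (gx i) (gx j).
Proof.
move=> ne; apply: (mulfI ne); have := sx_neutral i j.
rewrite -(gen_neutral phi_schur Hs) !gzE !ipZl !ipZr => E; rewrite !mulrDl E //.
Qed.

(** The factor of [sx_gram_off] vanishes when m is conjugate to l. In the orthogonal sum of the two
    state spaces the difference of the two entries is a single inner product with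
    [(s2 m v, e2 m v)], to which [orth_limit] applies. *)
Lemma sx_gram12 l g m v (hl : cplus l) (hm : cplus m) :
  inner (s1 l g) (s2 m v) = inner (e1 l g) (e2 m v).
Proof.
have off m' : cplus m' -> m' != l^* -> inner (s1 l g) (s2 m' v) = inner (e1 l g) (e2 m' v).
  move=> hm' ne; apply: (@sx_gram_off (inl (exist _ l hl, g)) (inr (exist _ m' hm', v))).
  by rewrite /= conjCK addrC subr_eq0.
have [-> {m hm}|/off] := eqVneq m l^*; last exact.
pose f : dsum X H := (s1 l g, - e1 l g); pose e m : dsum X H := (s2 m v, e2 m v).
have hlJ := cplusJ hl.
have : inner f (e l^*) = 0.
  apply: (orth_limit hlJ) => m hm; last first.
    by move=> ne; rewrite dsum_ip /= ipNl off // subrr.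
  have n1 := s2_near v hlJ hm; have n2 := e2_near phi_schur Hs v hlJ hm.
  have rm : 0 <= complex.Re m by exact: ltW.
  rewrite -(@ler_pXn2r _ 2) ?nnegrE ?mulr_ge0 ?nm_ge0 // !exprMn !dsum_nm2 /= !mulrDr -!exprMn.
  by rewrite lerD // ler_pXn2r ?nnegrE ?mulr_ge0 ?nm_ge0.
by rewrite dsum_ip /= ipNl => /eqP; rewrite subr_eq0 => /eqP.
Qed.

Lemma sx_gram i j : inner (sx i) (sx j) = inner (gx i) (gx j).
Proof.
have add_ne0 a b : cplus a -> cplus b -> a + b != 0 :> R[i].
  move=> ha hb; apply/eqP => /(congr1 (@complex.Re R)); rewrite ReD.
  by have := ha; have := hb; rewrite /cplus /=; lra.
case: i j => [[[l hl] g]|[[m hm] v]] [[[l' hl'] g']|[[m' hm'] v']].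
- apply: sx_gram_off; rewrite /= rmorphN /= conjCK -opprD oppr_eq0.
  by apply: add_ne0 => //; exact: cplusJ.
- exact: sx_gram12.
- by rewrite ipC [RHS]ipC /= sx_gram12.
- apply: sx_gram_off; rewrite /= conjCK; apply: add_ne0 => //; exact: cplusJ.
Qed.

(** By [Ss_gen], membership of the image in the graph is tested on the vectors [gx i], the images of
    [sx i]; since E is isometric, the test becomes [node_gen]. *)
Lemma node_similar : unitarily_similar S (Ss Hs).
Proof.
have tX : total sx.
  move=> x hx; apply: s_total => [l g hl|m v hm].
    exact: (hx (inl (exist _ l hl, g))).
  exact: (hx (inr (exist _ m hm, v))).
have tH : total gx.
  move=> x hx; apply: (rk_total phi_schur) => [l g hl|m v hm].
    exact: (hx (inl (exist _ l hl, g))).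
  exact: (hx (inr (exist _ m hm, v))).
have [E [Ei Es Eg]] := unitary_extension sx_gram tX tH.
exists E; split => // x u z y h; apply/(Ss_gen phi_schur) => i.
by rewrite gzE -Eg -linearZ_LR !Ei; exact: (node_gen h).
Qed.

End Uniqueness.

Theorem theorem1p1 (R : realType) (U Y : hilbertType R)
    (U_separable : separable U) (Y_separable : separable Y)
    (phi : R[i] -> {linear U -> Y}) (phi_schur : operator_schur phi) :
  [/\ positive_kernel (@cplus2 R) (Ks phi),
      inhabited (rkhs (@cplus2 R) (Ks phi))
    & forall Hs : rkhs (@cplus2 R) (Ks phi),
        [/\ system_node (Ss Hs),
            conservative (Ss Hs),
            simple (Ss Hs),
            has_transfer_function (Ss Hs) phi
          & forall (X : hilbertType R) (S : node U X Y),
              system_node S -> conservative S -> simple S ->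
              has_transfer_function S phi ->
              unitarily_similar S (Ss Hs)]].
Proof.
split; [exact: Ks_positive|exact: Ks_rkhs|move=> Hs; split].
- exact: Ss_system_node.
- exact: Ss_conservative.
- exact: Ss_simple.
- exact: Ss_transfer.
- by move=> X S S_node S_cons S_simple S_tf; exact: (node_similar phi_schur).
Qed.
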